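(* Let $U$ be a Haar distributed random matrix either in the unitary group $\mathbb U(n)$ (case $\beta=2$) or in the orthogonal group $\mathbb O(n)$ (case $\beta=1$). For $0\le p,q\le n$ put $$T_{p,q}=\sum_{1\le i\le p,\ 1\le j\le q}|U_{ij}|^2\qquad(T_{p,q}=0 \text{ if } p=0 \text{ or } q=0),$$ and define the two-parameter process $$W^{(n)}(s,t)=T_{\lfloor ns\rfloor,\lfloor nt\rfloor}-\mathbb E\,T_{\lfloor ns\rfloor,\lfloor nt\rfloor},\qquad s,t\in[0,1].$$ Then, as $n\to\infty$, $W^{(n)}$ converges in distribution in $D([0,1]^2)$ to $\sqrt{2/\beta}\,W^{(\infty)}$, where $W^{(\infty)}$ (the tied-down Brownian bridge) is a centered continuous Gaussian process on $[0,1]^2$ with covariance $$\mathbb E\big[W^{(\infty)}(s,t)W^{(\infty)}(s',t')\big]=(s\wedge s'-ss')(t\wedge t'-tt').$$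
   Context: $D([0,1]^2)$ is the two-parameter Skorokhod space of Bickel and Wichura: functions $[0,1]^2\to\mathbb R$ that are right continuous at each point with respect to the coordinatewise partial order of $[0,1]^2$ and admit limits in all orthants, endowed with the Skorokhod topology of Bickel–Wichura. *)

(* Defs.v *)
From HB Require Import structures.
From mathcomp Require Import all_boot all_order all_algebra.
From mathcomp Require Import all_classical all_reals all_analysis.
From mathcomp Require Import complex.
Set Implicit Arguments. Unset Strict Implicit. Unset Printing Implicit Defensive.
Import Order.TTheory GRing.Theory Num.Theory.
Import numFieldNormedType.Exports.
Local Open Scope classical_set_scope.
Local Open Scope ring_scope.

(* n x n complex matrices, with the Borel sigma-algebra, i.e. the one  *)
(* generated by the real and imaginary parts of the entries.           *)
Definition cmatrix (R : realType) (n : nat) : Type := 'M[R[i]]_n.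

Section cmatrix_measurable.
Context (R : realType) (n : nat).

HB.instance Definition _ := Choice.on (cmatrix R n).
HB.instance Definition _ := isPointed.Build (cmatrix R n) 0.

Definition cmatrix_gen : set (set (cmatrix R n)) :=
  [set B | exists (i j : 'I_n) (A : set R), measurable A /\
     (B = (fun M : cmatrix R n => @complex.Re R (M i j)) @^-1` A \/
      B = (fun M : cmatrix R n => @complex.Im R (M i j)) @^-1` A)].

Definition cmatrix_meas : set (set (cmatrix R n)) := <<s cmatrix_gen >>.

Let cm0 : cmatrix_meas set0. Proof. exact: sigma_algebra0. Qed.
Let cmC A : cmatrix_meas A -> cmatrix_meas (~` A).
Proof. exact: sigma_algebraC. Qed.
Let cmU (F : (set (cmatrix R n))^nat) : (forall k, cmatrix_meas (F k)) ->
  cmatrix_meas (\bigcup_k (F k)).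
Proof. exact: sigma_algebra_bigcup. Qed.

HB.instance Definition _ := @isMeasurable.Build default_measure_display
  (cmatrix R n) cmatrix_meas cm0 cmC cmU.
End cmatrix_measurable.

Section defs.
Context (R : realType).

Definition sqmod (z : R[i]) : R := complex.Re z ^+ 2 + complex.Im z ^+ 2.

(* the unitary group U(n) (beta = 2) and the orthogonal group O(n)
   (beta = 1), the latter seen as the real unitary matrices *)
Definition unitary_mx (n : nat) (M : 'M[R[i]]_n) : Prop :=
  M *m (map_mx (@conjc R) M)^T = 1%:M.

Definition haar_group (beta n : nat) : set (cmatrix R n) :=
  [set M | unitary_mx M /\ (beta = 1%N -> forall i j, @complex.Im R (M i j) = 0)].

Arguments haar_group : clear implicits.

Definition haar_prob (beta n : nat) (P : probability (cmatrix R n) R) : Prop :=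
  P (haar_group beta n) = 1%E /\
  forall V : cmatrix R n, haar_group beta n V ->
  forall B : set (cmatrix R n), measurable B ->
    P ((fun M : cmatrix R n => (V *m M : cmatrix R n)) @^-1` B) = P B.

Definition Tpq (n p q : nat) (M : cmatrix R n) : R :=
  \sum_(i < n | (i < p)%N) \sum_(j < n | (j < q)%N) sqmod (M i j).

Definition Wn (n : nat) (P : probability (cmatrix R n) R)
    (M : cmatrix R n) : R -> R -> R :=
  fun s t =>
    let p := Num.truncn (n%:R * s) in
    let q := Num.truncn (n%:R * t) in
    Tpq p q M - fine (\int[P]_(N in setT) (Tpq p q N)%:E)%E.

(* Paths are represented as functions R -> R -> R; only their values   *)
(* on [0,1]^2 matter.                                                  *)
Definition unit_itv : set R := `[0, 1]%classic.

Definition qrel (b : bool) (s' s : R) : Prop := if b then s <= s' else s' < s.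

Definition quadrant_lim (x : R -> R -> R) (s t : R) (b1 b2 : bool) (l : R)
  : Prop :=
  forall e : R, 0 < e -> exists2 d : R, 0 < d & forall s' t' : R,
    unit_itv s' -> unit_itv t' -> qrel b1 s' s -> qrel b2 t' t ->
    `|s' - s| < d -> `|t' - t| < d -> `|x s' t' - l| < e.

Definition inD (x : R -> R -> R) : Prop :=
  forall s t : R, unit_itv s -> unit_itv t ->
    quadrant_lim x s t true true (x s t) /\
    forall b1 b2 : bool, exists l : R, quadrant_lim x s t b1 b2 l.

Definition time_change (l : R -> R) : Prop :=
  l 0 = 0 /\ l 1 = 1 /\ {within unit_itv, continuous l} /\
  (forall s t : R, 0 <= s -> s < t -> t <= 1 -> l s < l t).

(* Bickel--Wichura Skorokhod metric:
   d(x,y) = inf_{lambda} max(||x - y o lambda||, ||lambda - id||),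
   lambda(s,t) = (l1 s, l2 t) *)
Definition skorokhod_dist (x y : R -> R -> R) : \bar R :=
  ereal_inf [set e : \bar R | exists l1 l2 : R -> R,
    [/\ time_change l1, time_change l2 &
    e = maxe (ereal_sup [set (`|x s t - y (l1 s) (l2 t)|)%:E | s in unit_itv
                          & t in unit_itv])
             (maxe (ereal_sup [set (`|l1 s - s|)%:E | s in unit_itv])
                   (ereal_sup [set (`|l2 t - t|)%:E | t in unit_itv]))]].

Definition bounded_on_D (f : (R -> R -> R) -> R) : Prop :=
  exists M : R, forall x, inD x -> `|f x| <= M.

Definition continuous_on_D (f : (R -> R -> R) -> R) : Prop :=
  forall x, inD x -> forall e : R, 0 < e -> exists2 d : R, 0 < d &
    forall y, inD y -> (skorokhod_dist x y < d%:E)%E -> `|f x - f y| < e.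

Definition centered_normal_law (v : R) : set R -> \bar R :=
  if v == 0 then \d_(0:R) else normal_prob 0 (Num.sqrt v).

Definition bridge_cov (s t s' t' : R) : R :=
  (Num.min s s' - s * s') * (Num.min t t' - t * t').

Definition tied_down_bridge d (O : measurableType d) (P : probability O R)
    (W : R -> R -> O -> R) : Prop :=
  [/\ (forall s t, measurable_fun setT (W s t)),
      (forall w : O, {within unit_itv `*` unit_itv,
                        continuous (fun p : R * R => W p.1 p.2 w)}) &
      (forall (k : nat) (s t a : 'I_k -> R),
         (forall i, unit_itv (s i) /\ unit_itv (t i)) ->
         forall A : set R, measurable A ->
         P ((fun w => \sum_(i < k) a i * W (s i) (t i) w) @^-1` A) =
         centered_normal_law
           (\sum_(i < k) \sum_(j < k)
               a i * a j * bridge_cov (s i) (t i) (s j) (t j)) A)].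

End defs.

(* Main.v *)
(* Left invariance of Haar measure under exp(tA), A in the Lie algebra, gives
   integration by parts for the generators; the Casimir identity
     sum_A A X A = 2 (2 - beta) X^T - 2 beta Tr(X)
   makes T_pq - pq/n an eigenfunction of the Laplacian sum_A D_A^2, with eigenvalue
   -4 beta n.  Its carre du champ is bounded, which yields moments of all even orders
   for T_pq and for its increments, and the mixed carre du champ of T_pq and T_p'q'
   is 8 (T_(min p p', min q q') - Z) with Z = Re Tr(P S_q P' S_q'), S_q = M Q M^*.
   Applying the Laplacian to Z shows that Z / n concentrates, so linear combinations
   of the W(s,t) satisfy an approximate Stein identity, whence their characteristic
   functions converge.  Tightness comes from dyadic chaining with eighth moments.
   Finally a Skorokhod-continuous bounded functional is approximated from below by
   functionals that are Lipschitz for the sup norm, for which finite-dimensional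
   convergence and the modulus estimate suffice. *)
Require Import Defs.
From HB Require Import structures.
From mathcomp Require Import all_boot all_order all_algebra.
From mathcomp Require Import all_classical all_reals all_analysis.
From mathcomp Require Import complex.
From mathcomp Require Import measurable_realfun ring lra zify.
Set Implicit Arguments.
Unset Strict Implicit.
Unset Printing Implicit Defensive.
Import Order.TTheory GRing.Theory Num.Theory.
Import numFieldNormedType.Exports.
Local Open Scope classical_set_scope.
Local Open Scope ring_scope.

(** * Bounded random variables and one-parameter flows *)

(** The obstacle is that the carre du champ is itself random: Z has degree 4 in the entries and is
    of order n. What saves the argument is that the Laplacian of Z closes up to lower order: it is -
    8 beta n Z plus products of T's, which fluctuate on scale 1, and testing it against a function
    of the process costs only O(n). Hence Z is close to a deterministic value when tested against
    such functions, with error O(1) against a size n, and no variance of Z is estimated. The factor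
    2 / beta is 8 / (4 beta), the carre du champ over the eigenvalue. Both groups are treated at
    once: c = 2 - beta multiplies every transposed term; it drops out of the eigenvalue and of the
    carre du champ and survives only in the lower-order part of the Laplacian of Z. The limit
    process being given, expectations are compared directly and no compactness of laws is invoked.
    Composites of functionals with random paths must also be shown measurable; the approximations
    that give convergence give this as well. *)

Section bounded_measurable.
Context d (T : measurableType d) (R : realType) (D : set T).
Implicit Types F H : T -> R.

(** Bounds are required on [D] only: [D] will be the group, where matrix entries are bounded, while
    they are unbounded on the space of all matrices. *)
Definition bm F := measurable_fun D F /\ exists C : R, forall x, D x -> `|F x| <= C.

Lemma bm_cst (c : R) : bm (fun=> c).
Proof. by split; [exact: measurable_cst | exists `|c|]. Qed.

Lemma bmD F H : bm F -> bm H -> bm (fun x => F x + H x).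
Proof.
move=> [mF [C FC]] [mH [K HK]]; split; first exact: measurable_funD.
by exists (C + K) => x Dx; rewrite (le_trans (ler_normD _ _)) // lerD ?FC ?HK.
Qed.

Lemma bmM F H : bm F -> bm H -> bm (fun x => F x * H x).
Proof.
move=> [mF [C FC]] [mH [K HK]]; split; first exact: measurable_funM.
by exists (C * K) => x Dx; rewrite normrM ler_pM ?FC ?HK.
Qed.

Lemma bmZ (c : R) F : bm F -> bm (fun x => c * F x).
Proof. by move=> bF; apply: bmM => //; exact: bm_cst. Qed.

Lemma bmN F : bm F -> bm (fun x => - F x).
Proof.
by move=> bF; under eq_fun do rewrite -mulN1r; exact: bmZ.
Qed.

Lemma bmB F H : bm F -> bm H -> bm (fun x => F x - H x).
Proof. by move=> bF bH; apply: bmD => //; exact: bmN. Qed.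

Lemma bmX F n : bm F -> bm (fun x => F x ^+ n).
Proof.
move=> bF; elim: n => [|n IHn]; first exact: bm_cst.
by under eq_fun do rewrite exprS; exact: bmM.
Qed.

Lemma bm_sum (I : Type) (s : seq I) (p : pred I) (F : I -> T -> R) :
  (forall i, p i -> bm (F i)) -> bm (fun x => \sum_(i <- s | p i) F i x).
Proof.
move=> bF; elim: s => [|i s IHs].
  by under eq_fun do rewrite big_nil; exact: bm_cst.
under eq_fun do rewrite big_cons; case: (boolP (p i)) => // pi.
by apply: bmD => //; exact: bF.
Qed.

Lemma bm_continuous (g : R -> R) F (C : R) :
  continuous g -> (forall y, `|g y| <= C) -> measurable_fun D F ->
  bm (fun x => g (F x)).
Proof.
move=> cg gC mF; split; last by exists C.
apply: (@measurableT_comp _ _ _ _ _ _ g) => //.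
exact: continuous_measurable_fun.
Qed.

Lemma bm_cos F : measurable_fun D F -> bm (fun x => cos (F x)).
Proof.
apply: (bm_continuous (C := 1)); first exact: continuous_cos.
by move=> y; rewrite ler_norml cos_le1 cos_geN1.
Qed.

Lemma bm_norm F : bm F -> bm (fun x => `|F x|).
Proof.
move=> [mF [C FC]]; split; first exact: measurableT_comp.
by exists C => x Dx; rewrite normr_id FC.
Qed.

End bounded_measurable.

Section expectation.
Context d (T : measurableType d) (R : realType) (mu : probability T R).
Context (D : set T) (mD : measurable D) (muD : mu D = 1%E).
Implicit Types F H : T -> R.

Local Notation E F := (Rintegral mu D F).

Lemma bm_integrable F : bm D F -> mu.-integrable D (EFin \o F).
Proof.
move=> [mF [C FC]]; apply: measurable_bounded_integrable => //.
  by rewrite [X in (X < _)%E]muD ltry.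
exists `|C|; split; first exact: num_real.
move=> y Cy x Dx; apply: (le_trans (FC x Dx)).
by rewrite (le_trans (ler_norm _)) // ltW.
Qed.
Hint Resolve bm_integrable : core.

Lemma Ex_cst c : E (fun=> c) = c.
Proof. by rewrite Rintegral_cst // [X in fine X]muD mulr1. Qed.

Lemma ExD F H : bm D F -> bm D H -> E (fun x => F x + H x) = E F + E H.
Proof. by move=> bF bH; apply: RintegralD => //; exact: bm_integrable. Qed.

Lemma ExB F H : bm D F -> bm D H -> E (fun x => F x - H x) = E F - E H.
Proof. by move=> bF bH; apply: RintegralB => //; exact: bm_integrable. Qed.

Lemma ExZ c F : bm D F -> E (fun x => c * F x) = c * E F.
Proof. by move=> bF; apply: RintegralZl => //; exact: bm_integrable. Qed.

Lemma ExN F : bm D F -> E (fun x => - F x) = - E F.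
Proof.
by move=> bF; rewrite -mulN1r -ExZ //; apply: eq_Rintegral => x _; rewrite mulN1r.
Qed.

Lemma Ex_sum (I : Type) (s : seq I) (F : I -> T -> R) :
  (forall i, bm D (F i)) ->
  E (fun x => \sum_(i <- s) F i x) = \sum_(i <- s) E (F i).
Proof.
move=> bF; elim: s => [|i s IHs].
  rewrite big_nil -[RHS]Ex_cst; apply: eq_Rintegral => x _; exact: big_nil.
rewrite big_cons -IHs -ExD //; last by apply: bm_sum.
by apply: eq_Rintegral => x _; rewrite big_cons.
Qed.

Lemma Ex_le F H : bm D F -> bm D H -> (forall x, D x -> F x <= H x) -> E F <= E H.
Proof. by move=> bF bH FH; apply: le_Rintegral => //; exact: bm_integrable. Qed.

Lemma Ex_norm F : bm D F -> `|E F| <= E (fun x => `|F x|).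
Proof. by move=> bF; apply: le_normr_Rintegral => //; exact: bm_integrable. Qed.

Lemma Ex_bound F C : bm D F -> (forall x, D x -> `|F x| <= C) -> `|E F| <= C.
Proof.
move=> bF FC; apply: (le_trans (Ex_norm bF)); rewrite -[leRHS]Ex_cst.
by apply: Ex_le => //; [exact: bm_norm | exact: bm_cst].
Qed.

Lemma Ex_eq F H : (forall x, D x -> F x = H x) -> E F = E H.
Proof. by move=> FH; apply: eq_Rintegral => x; rewrite inE => /FH. Qed.

Lemma Ex_cvg (F : nat -> T -> R) H C : (forall k, measurable_fun D (F k)) ->
  (forall k x, D x -> `|F k x| <= C) ->
  (forall x, D x -> (fun k => F k x) @ \oo --> H x) ->
  (fun k => E (F k)) @ \oo --> E H.
Proof.
move=> mF FC FH.
have mH : measurable_fun D H.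
  exact: (measurable_fun_cvg mF).
have HC x : D x -> `|H x| <= C.
  move=> Dx; have cF : (fun k => `|F k x|) @ \oo --> `|H x|.
    by apply: cvg_norm; exact: FH.
  rewrite -(cvg_lim (@Rhausdorff R) cF); apply: limr_le.
    by apply/cvg_ex; exists `|H x|.
  by near=> k; exact: FC.
have [_ _ cvgE] : [/\ mu.-integrable D (EFin \o H),
    (fun k => \int[mu]_(x in D) `|(EFin \o F k) x - (EFin \o H) x|)%E @ \oo --> 0%E &
    (fun k => \int[mu]_(x in D) ((EFin \o F k) x))%E @ \oo -->
      (\int[mu]_(x in D) ((EFin \o H) x))%E].
  apply: (@dominated_convergence _ _ _ mu D mD (fun k => EFin \o F k) (EFin \o H)
    (fun=> C%:E)).
  - by move=> k; exact/measurable_EFinP.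
  - exact/measurable_EFinP.
  - by apply/aeW => x Dx; apply: cvg_EFin; [exact: nearW | exact: FH].
  - by apply: (@bm_integrable (fun=> C)); exact: bm_cst.
  - by apply/aeW => x k Dx; rewrite /= lee_fin; exact: FC.
apply: fine_cvg; rewrite fineK //.
by apply: integrable_fin_num => //; apply: bm_integrable; split => //; exists C.
Unshelve. all: by end_near.
Qed.

End expectation.

Lemma continuous_is_derive (R : realType) (f df : R -> R) :
  (forall x : R, is_derive x 1 f (df x)) -> continuous f.
Proof.
move=> fd x; apply: differentiable_continuous; apply/derivable1_diffP.
exact: (@ex_derive _ _ _ _ _ _ _ (fd x)).
Qed.

Lemma is_derive_lipschitz (R : realType) (f df : R -> R) (C a b : R) :
  (forall x : R, is_derive x 1 f (df x)) ->
  (forall x, `|df x| <= C) -> `|f b - f a| <= C * `|b - a|.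
Proof.
move=> fd dfC; wlog ab : a b / a <= b => [h|].
  by have [/h//|/ltW /h] := leP a b; rewrite (distrC (f a)) (distrC a).
have [|c _ ->] := @MVT_segment R f df a b ab (fun x _ => fd x).
  by apply: continuous_subspaceT; exact: continuous_is_derive fd.
by rewrite normrM ler_wpM2r.
Qed.

(** The derivative is taken at time 0 only; the group law of the flow carries it to other times, see
    [flow_der_at]. *)
Definition flow_der (T : Type) (R : realType) (D : set T) (phi : R -> T -> T)
    (F F' : T -> R) :=
  forall x, D x -> is_derive (0 : R) 1 (fun t => F (phi t x)) (F' x).

Section flow.
Context d (T : measurableType d) (R : realType) (mu : probability T R).
Context (D : set T) (mD : measurable D) (muD : mu D = 1%E).
Context (phi : R -> T -> T).
Hypothesis phiD : forall t x, D x -> D (phi t x).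
Hypothesis phi0 : forall x, D x -> phi 0 x = x.
Hypothesis phiA : forall s t x, D x -> phi (s + t) x = phi s (phi t x).
Hypothesis mphi : forall t, measurable_fun setT (phi t).
Hypothesis phi_inv : forall t F, bm D F ->
  \int[mu]_(x in D) F (phi t x) = \int[mu]_(x in D) F x.

Lemma flow_der_at F F' x (t : R) : flow_der D phi F F' -> D x ->
  is_derive t 1 (fun s => F (phi s x)) (F' (phi t x)).
Proof.
move=> FF' Dx.
have -> : (fun s => F (phi s x)) = (fun h => F (phi h (phi t x))) \o shift (- t).
  by apply/funext => s /=; rewrite -phiA // addrNK.
rewrite -[F' _]mulr1.
apply: (@is_derive1_comp _ (fun h => F (phi h (phi t x))) (shift (- t)) t).
  by rewrite /= subrr; apply: FF'; exact: phiD.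
exact: is_derive_shift.
Qed.

(** By invariance each difference quotient has mean zero. The mean value theorem along the orbit
    bounds it by the bound of [F'], so the quotients at times 1 / (k + 1) converge in mean. *)
Lemma flow_ibp F F' : bm D F -> bm D F' -> flow_der D phi F F' ->
  \int[mu]_(x in D) F' x = 0.
Proof.
move=> bF bF' FF'; have [mF' [C F'C]] := bF'.
pose h k : R := k.+1%:R^-1.
have h_gt0 k : 0 < h k by rewrite invr_gt0.
pose Q k x := (h k)^-1 * (F (phi (h k) x) - F x).
have bFphi k : bm D (fun x => F (phi (h k) x)).
  have [mF [K FK]] := bF; split; last by exists K => x Dx; exact/FK/phiD.
  apply: (measurable_comp mD _ mF); last exact: measurable_funTS.
  by move=> _ [x Dx <-]; exact: phiD.
have bQ k : bm D (Q k) by apply: bmZ; exact: bmB.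
have QE k : \int[mu]_(x in D) Q k x = 0.
  rewrite (ExZ mD muD); last exact: bmB.
  by rewrite (ExB mD muD) // phi_inv // subrr mulr0.
have cvgQ : (fun k => \int[mu]_(x in D) Q k x) @ \oo --> \int[mu]_(x in D) F' x.
  apply: (Ex_cvg mD muD (C := C)) => [k|k x Dx|x Dx].
  - exact: (bQ k).1.
  - rewrite /Q normrM gtr0_norm ?invr_gt0 ?h_gt0 // ler_pdivrMl ?h_gt0 //.
    rewrite mulrC -[in leRHS](gtr0_norm (h_gt0 k)) -[X in C * `|X|]subr0.
    rewrite -[X in _ - F X]phi0 //.
    apply: (@is_derive_lipschitz _ (fun s => F (phi s x)) (fun s => F' (phi s x))).
      by move=> t; exact: flow_der_at.
    by move=> t; exact/F'C/phiD.
  - have [dF <-] := FF' x Dx.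
    have /cvg_ex[l dl] := dF; rewrite /derive (cvg_lim _ dl) //.
    have /cvg_at_rightP dl' := cvg_dnbhs_at_right dl.
    have := dl' h (conj h_gt0 (@cvg_harmonic R)).
    apply: cvg_trans; apply: near_eq_cvg; near=> k.
    by rewrite /Q /= addr0 [h k *: _]mulr1 phi0.
rewrite (_ : (fun k => _) = fun=> 0) in cvgQ; last by apply/funext.
by rewrite -(cvg_lim (@Rhausdorff R) cvgQ) lim_cst.
Unshelve. all: by end_near.
Qed.

End flow.

(** * Lie algebra generators *)

Section complex_parts.
Context (R : realType).
Implicit Types (x y : R[i]) (a : R).
Local Notation Re := (@complex.Re R).
Local Notation Im := (@complex.Im R).

Lemma ReD x y : Re (x + y) = Re x + Re y. Proof. by case: x; case: y. Qed.
Lemma ImD x y : Im (x + y) = Im x + Im y. Proof. by case: x; case: y. Qed.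
Lemma ReN x : Re (- x) = - Re x. Proof. by case: x. Qed.
Lemma ImN x : Im (- x) = - Im x. Proof. by case: x. Qed.
Lemma ReB x y : Re (x - y) = Re x - Re y. Proof. by rewrite ReD ReN. Qed.
Lemma ReM x y : Re (x * y) = Re x * Re y - Im x * Im y.
Proof. by case: x; case: y. Qed.
Lemma ImM x y : Im (x * y) = Re x * Im y + Im x * Re y.
Proof. by case: x => a b; case: y => c e; rewrite /= addrC mulrC [in RHS]mulrC; ring. Qed.
Lemma ReJ x : Re (conjc x) = Re x. Proof. by case: x. Qed.
Lemma ImJ x : Im (conjc x) = - Im x. Proof. by case: x. Qed.
Lemma ReZ a x : Re (a%:C%C * x) = a * Re x.
Proof. by rewrite ReM /= mul0r subr0. Qed.
Lemma ImZ a x : Im (a%:C%C * x) = a * Im x.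
Proof. by rewrite ImM /= mul0r addr0. Qed.

Lemma Re_nat n : Re (n%:R : R[i]) = n%:R.
Proof. by elim: n => // n IHn; rewrite !mulrS ReD IHn. Qed.

Lemma ReMn n x : Re (n%:R * x) = n%:R * Re x.
Proof. by elim: n => [|n IHn]; rewrite ?mul0r // !mulrS !mulrDl ReD !mul1r IHn. Qed.

Lemma Re_sum (I : Type) (s : seq I) (p : pred I) (F : I -> R[i]) :
  Re (\sum_(i <- s | p i) F i) = \sum_(i <- s | p i) Re (F i).
Proof. by apply: (big_morph Re ReD). Qed.

Lemma Im_sum (I : Type) (s : seq I) (p : pred I) (F : I -> R[i]) :
  Im (\sum_(i <- s | p i) F i) = \sum_(i <- s | p i) Im (F i).
Proof. by apply: (big_morph Im ImD). Qed.

Lemma complex_ext x y : Re x = Re y -> Im x = Im y -> x = y.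
Proof. by case: x => a b; case: y => c e /= -> ->. Qed.

Lemma ReMJ x : Re (x * conjc x) = sqmod x.
Proof. by rewrite ReM ReJ ImJ /sqmod mulrN opprK -!expr2. Qed.

End complex_parts.

Section adjoint.
Context (R : realType).
Local Notation C := R[i].

Definition adj m n (M : 'M[C]_(m, n)) : 'M[C]_(n, m) := (map_mx (@conjc R) M)^T.

Lemma adjE m n (M : 'M[C]_(m, n)) i j : adj M i j = conjc (M j i).
Proof. by rewrite !mxE. Qed.

Lemma adjM m n p (M : 'M[C]_(m, n)) (N : 'M[C]_(n, p)) :
  adj (M *m N) = adj N *m adj M.
Proof. by rewrite /adj map_mxM trmx_mul. Qed.

Lemma adjK m n (M : 'M[C]_(m, n)) : adj (adj M) = M.
Proof. by apply/matrixP => i j; rewrite !adjE conjcK. Qed.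

Lemma adjD m n (M N : 'M[C]_(m, n)) : adj (M + N) = adj M + adj N.
Proof. by rewrite /adj map_mxD linearD. Qed.

Lemma adjN m n (M : 'M[C]_(m, n)) : adj (- M) = - adj M.
Proof. by rewrite /adj map_mxN linearN. Qed.

Lemma adjZ m n a (M : 'M[C]_(m, n)) : adj (a *: M) = conjc a *: adj M.
Proof. by rewrite /adj map_mxZ linearZ. Qed.

Lemma adj1 n : adj (1%:M : 'M[C]_n) = 1%:M.
Proof. by rewrite /adj map_mx1 trmx1. Qed.

Lemma tr_adj n (M : 'M[C]_n) : \tr (adj M) = conjc (\tr M).
Proof.
by rewrite /mxtrace rmorph_sum; apply: eq_bigr => i _; rewrite adjE.
Qed.

End adjoint.

Section generators.
Context (R : realType) (beta n : nat).
Local Notation C := R[i].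

(* Each unordered pair {a, b} occurs twice in this spanning family of the Lie algebra;
   hence the factors 2 in the Casimir sums. *)
Definition gen (t : 'I_beta * 'I_n * 'I_n) : 'M[C]_n :=
  if t.1.1 == 0 :> nat then delta_mx t.1.2 t.2 - delta_mx t.2 t.1.2
  else 'i%C *: (delta_mx t.1.2 t.2 + delta_mx t.2 t.1.2).

Lemma gen_adj t : adj (gen t) = - gen t.
Proof.
have adj_delta a b : adj (delta_mx a b) = delta_mx b a :> 'M[C]_n.
  by rewrite /adj map_delta_mx trmx_delta.
rewrite /gen; case: ifP => _.
  by rewrite adjD adjN !adj_delta opprB.
rewrite adjZ adjD !adj_delta addrC -scaleNr; congr (_ *: _).
by apply: complex_ext; rewrite /= ?oppr0.
Qed.

Lemma gen_real t i j : beta = 1%N -> complex.Im (gen t i j) = 0.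
Proof.
move=> b1; case: t => [[e a] b]; rewrite /gen /=.
have -> : (e == 0 :> nat) by case: e => m /=; rewrite b1 ltnS leqn0.
rewrite !mxE ImD ImN.
by do 2!(case: (_ && _)); rewrite /= ?oppr0 addr0.
Qed.

(** A generator is normal with spectrum in {0, ci, -ci}, so dividing by [c] gives a cubic relation,
    which makes its exponential a quadratic polynomial. The scale is 2 for a nonzero diagonal
    generator and 1 otherwise. *)
Lemma gen_cube t : exists c : R, exists B : 'M[C]_n,
  [/\ c != 0, gen t = (c%:C)%C *: B & B *m B *m B = - B].
Proof.
case: t => [[e a] b]; rewrite /gen /=; have [<-|ab] := eqVneq a b.
  case: ifP => _.
    exists 1, 0; split; last by rewrite !mulmx0 oppr0.
      exact: oner_neq0.
    by rewrite subrr scaler0.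
  exists 2, ('i%C *: delta_mx a a); split; first by rewrite pnatr_eq0.
    rewrite scalerDr -mulr2n -scaler_nat; congr (_ *: _).
    by rewrite (_ : 2%:R = 1 + 1) // -[2]/(1 + 1) rmorphD rmorph1.
  rewrite -!scalemxAl -!scalemxAr -scalemxAl !scalerA !mul_delta_mx -scaleNr.
  by congr (_ *: _); rewrite mulrA -expr2 sqr_i mulN1r.
have ba : b != a by rewrite eq_sym.
have E1 i k : delta_mx i a *m delta_mx b k = 0 :> 'M[C]_n by rewrite mul_delta_mx_0.
have E2 i k : delta_mx i b *m delta_mx a k = 0 :> 'M[C]_n by rewrite mul_delta_mx_0.
have E := (@mul_delta_mx C, E1, E2,
  mulmxDl, mulmxDr, mulmxBl, mulmxBr, subr0, sub0r, addr0, add0r, mulmxN, mulNmx,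
  mul0mx, mulmx0, oppr0).
case: ifP => _.
  exists 1; exists (delta_mx a b - delta_mx b a); split; first exact: oner_neq0.
    by rewrite scale1r.
  by rewrite !E opprB opprK addrC.
exists 1, ('i%C *: (delta_mx a b + delta_mx b a)); split; first exact: oner_neq0.
  by rewrite scale1r.
rewrite -!scalemxAl -!scalemxAr -scalemxAl !scalerA.
by rewrite !E -scaleNr mulrA -[in 'i * 'i]expr2 sqr_i mulN1r; congr (_ *: _).
Qed.

Lemma sum_delta_cc (i j k l : 'I_n) :
  \sum_(a < n) \sum_(b < n)
     ((i == a) && (j == b))%:R * ((k == a) && (l == b))%:R =
  ((i == k) && (j == l))%:R :> C.
Proof.
rewrite (bigD1 i) //= [X in _ + X]big1 ?addr0; last first.
  move=> a /negPf ia; rewrite big1 // => b _.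
  by rewrite eq_sym ia mul0r.
rewrite (bigD1 j) //= [X in _ + X]big1 ?addr0; last first.
  by move=> b /negPf jb; rewrite (eq_sym j) jb andbF mul0r.
by rewrite !eqxx mul1r (eq_sym k) (eq_sym l).
Qed.

Lemma sum_delta_cd (i j k l : 'I_n) :
  \sum_(a < n) \sum_(b < n)
     ((i == a) && (j == b))%:R * ((k == b) && (l == a))%:R =
  ((i == l) && (j == k))%:R :> C.
Proof.
rewrite -sum_delta_cc; apply: eq_bigr => a _; apply: eq_bigr => b _.
by rewrite (andbC (k == b)).
Qed.

Lemma sum_delta_dc (i j k l : 'I_n) :
  \sum_(a < n) \sum_(b < n)
     ((i == b) && (j == a))%:R * ((k == a) && (l == b))%:R =
  ((i == l) && (j == k))%:R :> C.
Proof.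
by rewrite exchange_big sum_delta_cd.
Qed.

Lemma sum_delta_dd (i j k l : 'I_n) :
  \sum_(a < n) \sum_(b < n)
     ((i == b) && (j == a))%:R * ((k == b) && (l == a))%:R =
  ((i == k) && (j == l))%:R :> C.
Proof. by rewrite exchange_big sum_delta_cc. Qed.

Hypothesis hbeta : beta = 1%N \/ beta = 2%N.

(** The Casimir tensor in coordinates. The antisymmetric family contributes u - v and the symmetric
    one, because of its factor i, - u - v: the u parts cancel when both are present, whence the
    coefficient 2 - beta. *)
Lemma gen_tensor (i j k l : 'I_n) :
  \sum_t gen t i j * gen t k l =
  (2 * (2 - beta))%:R * ((i == k) && (j == l))%:R
  - (2 * beta)%:R * ((i == l) && (j == k))%:R.
Proof.
pose u (a b : 'I_n) : C := ((i == a) && (j == b))%:R * ((k == a) && (l == b))%:R +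
   ((i == b) && (j == a))%:R * ((k == b) && (l == a))%:R.
pose v (a b : 'I_n) : C := ((i == a) && (j == b))%:R * ((k == b) && (l == a))%:R +
   ((i == b) && (j == a))%:R * ((k == a) && (l == b))%:R.
have su : \sum_a \sum_b u a b = 2 * ((i == k) && (j == l))%:R.
  under eq_bigr do rewrite big_split.
  by rewrite big_split /= sum_delta_cc sum_delta_dd -mulr2n mulr_natl.
have sv : \sum_a \sum_b v a b = 2 * ((i == l) && (j == k))%:R.
  under eq_bigr do rewrite big_split.
  by rewrite big_split /= sum_delta_cd sum_delta_dc -mulr2n mulr_natl.
have g0 (e : 'I_beta) a b : e = 0%N :> nat ->
    gen (e, a, b) i j * gen (e, a, b) k l = u a b - v a b.
  by move=> e0; rewrite /gen /= e0 eqxx !mxE /u /v; ring.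
have g1 (e : 'I_beta) a b : e = 1%N :> nat ->
    gen (e, a, b) i j * gen (e, a, b) k l = - u a b - v a b.
  move=> e1; rewrite /gen /= e1 /= !mxE /u /v mulrACA -expr2 sqr_i; ring.
rewrite -(pair_bigA _ (fun p b => gen (p, b) i j * gen (p, b) k l)) /=.
rewrite -(pair_bigA _ (fun e a => \sum_b gen (e, a, b) i j * gen (e, a, b) k l)) /=.
have S0 (e : 'I_beta) : e = 0%N :> nat ->
    \sum_a \sum_b gen (e, a, b) i j * gen (e, a, b) k l =
    2 * ((i == k) && (j == l))%:R - 2 * ((i == l) && (j == k))%:R.
  move=> e0; rewrite -su -sv -sumrB; apply: eq_bigr => a _.
  by rewrite -sumrB; apply: eq_bigr => b _; exact: g0.
have S1 (e : 'I_beta) : e = 1%N :> nat ->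
    \sum_a \sum_b gen (e, a, b) i j * gen (e, a, b) k l =
    - (2 * ((i == k) && (j == l))%:R) - 2 * ((i == l) && (j == k))%:R.
  move=> e0; rewrite -su -sv -sumrN -sumrB; apply: eq_bigr => a _.
  by rewrite -sumrN -sumrB; apply: eq_bigr => b _; exact: g1.
set x := 2 * _ in S0 S1 *; set y := 2 * _ in S0 S1 *.
transitivity (\sum_(e < beta) (if e == 0 :> nat then x - y else - x - y)).
  apply: eq_bigr => e _; case: ifPn => [/eqP/S0//|e0]; apply: S1.
  by case: hbeta e0 => h; case: e => [[|[|e]]] //=; rewrite h.
rewrite !natrM -!mulrA; clear S0 S1 su sv g0 g1 u v.
case: hbeta => ->; first by rewrite big_ord1 /= !mul1r.
by rewrite 2!big_ord_recl big_ord0 /= subnn /x /y; ring.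
Qed.

(** Contraction of the inner indices of [gen_tensor]. It drives the Laplacian, whereas [casimir_tr]
    drives the carre du champ. *)
Lemma casimir (X : 'M[C]_n) :
  \sum_t gen t *m X *m gen t =
  (2 * (2 - beta))%:R *: X^T - ((2 * beta)%:R * \tr X)%:M.
Proof.
apply/matrixP => i l; rewrite summxE.
under eq_bigr => t _.
  rewrite mxE; under eq_bigr => k _.
    rewrite mxE big_distrl /=; under eq_bigr => j _ do rewrite mulrAC.
    over.
  over.
rewrite exchange_big /=; under eq_bigr => k _.
  rewrite exchange_big /=; under eq_bigr => j _.
    rewrite -big_distrl /= gen_tensor mulrBl.
    over.
  rewrite sumrB; over.
rewrite sumrB !mxE; congr (_ - _).
  rewrite (bigD1 i) //= [X in _ + X]big1 ?addr0; last first.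
    move=> k /negPf ki; rewrite big1 // => j _.
    by rewrite eq_sym ki mulr0 mul0r.
  rewrite (bigD1 l) //= [X in _ + X]big1 ?addr0; last first.
    by move=> j /negPf jl; rewrite jl andbF mulr0 mul0r.
  by rewrite !eqxx mulr1.
rewrite /mxtrace big_distrr -sumrMnl; apply: eq_bigr => k _ /=.
rewrite (bigD1 k) //= [X in _ + X]big1 ?addr0; last first.
  by move=> j /negPf jk; rewrite jk andbF mulr0 mul0r.
by rewrite eqxx andbT mulrAC mulr_natr.
Qed.

Lemma casimir_tr (X Y : 'M[C]_n) :
  \sum_t \tr (gen t *m X) * \tr (gen t *m Y) =
  (2 * (2 - beta))%:R * \tr (X *m Y^T) - (2 * beta)%:R * \tr (X *m Y).
Proof.
have trE (A B : 'M[C]_n) : \tr (A *m B) = \sum_i \sum_j A i j * B j i.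
  by apply: eq_bigr => i _; rewrite mxE.
transitivity (\sum_i \sum_j \sum_k \sum_l
    (\sum_t gen t i j * gen t k l) * (X j i * Y l k)).
  under eq_bigr => t _.
    rewrite !trE big_distrl /=; under eq_bigr => i _.
      rewrite big_distrl /=; under eq_bigr => j _.
        rewrite big_distrr /=; under eq_bigr => k _.
          rewrite big_distrr /=; under eq_bigr => l _ do rewrite mulrACA.
          over.
        over.
      over.
    over.
  rewrite exchange_big; apply: eq_bigr => i _ /=.
  rewrite exchange_big; apply: eq_bigr => j _ /=.
  rewrite exchange_big; apply: eq_bigr => k _ /=.
  rewrite exchange_big; apply: eq_bigr => l _ /=.
  by rewrite big_distrl.
rewrite !trE !big_distrr /=.
under [X in _ = X - _]eq_bigr do rewrite big_distrr.
under [X in _ = _ - X]eq_bigr do rewrite big_distrr.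
rewrite [X in _ = X - _]exchange_big [X in _ = _ - X]exchange_big /=.
rewrite -sumrB; apply: eq_bigr => i _.
rewrite -sumrB; apply: eq_bigr => j _.
under eq_bigr => k _.
  under eq_bigr => l _ do rewrite gen_tensor mulrBl.
  rewrite sumrB; over.
rewrite sumrB; congr (_ - _).
  rewrite (bigD1 i) //= [X in _ + X]big1 ?addr0; last first.
    by move=> k /negPf ki; rewrite big1 // => l _; rewrite eq_sym ki mulr0 mul0r.
  rewrite (bigD1 j) //= [X in _ + X]big1 ?addr0; last first.
    by move=> l /negPf lj; rewrite eq_sym lj andbF mulr0 mul0r.
  by rewrite !eqxx mulr1 !mxE.
rewrite (bigD1 j) //= [X in _ + X]big1 ?addr0; last first.
  by move=> k /negPf kj; rewrite big1 // => l _; rewrite (eq_sym j) kj andbF mulr0 mul0r.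
rewrite (bigD1 i) //= [X in _ + X]big1 ?addr0; last first.
  by move=> l /negPf li; rewrite eq_sym li mulr0 mul0r.
by rewrite !eqxx mulr1.
Qed.

End generators.

Section complex_measurable.
Context d (T : measurableType d) (R : realType) (D : set T).
Implicit Types f g : T -> R[i].

Definition cbm f := bm D (fun x => complex.Re (f x)) /\ bm D (fun x => complex.Im (f x)).

Definition cmeas f := measurable_fun D (fun x => complex.Re (f x)) /\
  measurable_fun D (fun x => complex.Im (f x)).

Lemma cbm_cst c : cbm (fun=> c). Proof. by split; exact: bm_cst. Qed.

Lemma cbmD f g : cbm f -> cbm g -> cbm (fun x => f x + g x).
Proof.
move=> [rf imf] [rg img]; split.
  by under eq_fun do rewrite ReD; exact: bmD.
by under eq_fun do rewrite ImD; exact: bmD.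
Qed.

Lemma cbmM f g : cbm f -> cbm g -> cbm (fun x => f x * g x).
Proof.
move=> [rf imf] [rg img]; split.
  by under eq_fun do rewrite ReM; apply: bmB; exact: bmM.
by under eq_fun do rewrite ImM; apply: bmD; exact: bmM.
Qed.

Lemma cbmN f : cbm f -> cbm (fun x => - f x).
Proof. by move=> cf; under eq_fun do rewrite -mulN1r; apply: cbmM => //; exact: cbm_cst. Qed.

Lemma cbmJ f : cbm f -> cbm (fun x => conjc (f x)).
Proof.
move=> [rf imf]; split.
  by under eq_fun do rewrite ReJ.
by under eq_fun do rewrite ImJ; exact: bmN.
Qed.

Lemma cbm_sum (I : Type) (s : seq I) (p : pred I) (F : I -> T -> R[i]) :
  (forall i, p i -> cbm (F i)) -> cbm (fun x => \sum_(i <- s | p i) F i x).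
Proof.
move=> cF; split.
  by under eq_fun do rewrite Re_sum; apply: bm_sum => i /cF[].
by under eq_fun do rewrite Im_sum; apply: bm_sum => i /cF[].
Qed.

Lemma cmeas_cst c : cmeas (fun=> c). Proof. by split; exact: measurable_cst. Qed.

Lemma cmeasD f g : cmeas f -> cmeas g -> cmeas (fun x => f x + g x).
Proof.
move=> [rf imf] [rg img]; split.
  by under eq_fun do rewrite ReD; exact: measurable_funD.
by under eq_fun do rewrite ImD; exact: measurable_funD.
Qed.

Lemma cmeasM f g : cmeas f -> cmeas g -> cmeas (fun x => f x * g x).
Proof.
move=> [rf imf] [rg img]; split.
  by under eq_fun do rewrite ReM; apply: measurable_funB; exact: measurable_funM.
by under eq_fun do rewrite ImM; apply: measurable_funD; exact: measurable_funM.
Qed.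

Lemma cmeasJ f : cmeas f -> cmeas (fun x => conjc (f x)).
Proof.
move=> [rf imf]; split.
  by under eq_fun do rewrite ReJ.
by under eq_fun do rewrite ImJ; apply: measurableT_comp.
Qed.

Lemma cmeas_sum (I : Type) (s : seq I) (F : I -> T -> R[i]) :
  (forall i, cmeas (F i)) -> cmeas (fun x => \sum_(i <- s) F i x).
Proof.
move=> cF; elim: s => [|i s IHs].
  by under eq_fun do rewrite big_nil; exact: cmeas_cst.
by under eq_fun do rewrite big_cons; exact: cmeasD.
Qed.

End complex_measurable.

(** * The group and its Haar measure *)

Section haar.
Context (R : realType) (beta n : nat).
Local Notation C := R[i].
Local Notation G := (@haar_group R beta n).

Lemma cmeas_entry i j : cmeas setT (fun M : cmatrix R n => M i j).
Proof.
split=> _ A mA; rewrite setTI; apply: sub_sigma_algebra; exists i, j, A; split => //.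
  by left.
by right.
Qed.

Lemma measurable_cmatrix d (T : measurableType d) (f : T -> cmatrix R n) :
  (forall i j, cmeas setT (fun x => f x i j)) -> measurable_fun setT f.
Proof.
move=> mf; apply: (@measurability _ _ _ _ setT f (@cmatrix_gen R n)) => //.
move=> _ [_ [i [j [A [mA [->|->]]]]] <-]; rewrite setTI -comp_preimage.
  by have := (mf i j).1 measurableT A mA; rewrite setTI.
by have := (mf i j).2 measurableT A mA; rewrite setTI.
Qed.

Lemma measurable_mulmx (V : cmatrix R n) :
  measurable_fun setT (fun M : cmatrix R n => V *m M : cmatrix R n).
Proof.
apply: measurable_cmatrix => i j; under eq_fun do rewrite mxE.
apply: cmeas_sum => k; apply: cmeasM; first exact: cmeas_cst.
exact: cmeas_entry.
Qed.

Lemma unitaryP (M : 'M[C]_n) : unitary_mx M <-> M *m adj M = 1%:M.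
Proof. by []. Qed.

Lemma unitary_adj (M : 'M[C]_n) : unitary_mx M -> adj M *m M = 1%:M.
Proof. exact: mulmx1C. Qed.

Lemma haar_groupM (V M : cmatrix R n) : G V -> G M -> G (V *m M).
Proof.
move=> [uV rV] [uM rM]; split.
  rewrite unitaryP adjM mulmxA -(mulmxA V) (_ : M *m adj M = 1%:M) //.
  by rewrite mulmx1.
move=> b1 i j; rewrite mxE Im_sum big1 // => k _.
by rewrite ImM rV // rM // mulr0 mul0r addr0.
Qed.

Lemma haar_group_adj (V : cmatrix R n) : G V -> G (adj V).
Proof.
move=> [uV rV]; split; first by rewrite unitaryP adjK unitary_adj.
by move=> b1 i j; rewrite adjE ImJ rV // oppr0.
Qed.

Lemma sqmod_ge0 (z : C) : 0 <= sqmod z.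
Proof. by rewrite addr_ge0 // sqr_ge0. Qed.

Lemma sqmod_eq0 (z : C) : sqmod z = 0 -> z = 0.
Proof.
move/eqP; rewrite paddr_eq0 ?sqr_ge0 // !sqrf_eq0 => /andP[/eqP r0 /eqP i0].
exact: complex_ext.
Qed.

(** The group is the zero set of one nonnegative measurable function; the factor [(beta == 1%N)%:R]
    switches the reality condition on. *)
Lemma measurable_haar_group : measurable G.
Proof.
pose h (M : cmatrix R n) : R := \sum_i \sum_j (sqmod ((M *m adj M - 1%:M) i j)
   + (beta == 1%N)%:R * complex.Im (M i j) ^+ 2).
have i0 (M : cmatrix R n) i j : 0 <= (beta == 1%N)%:R * complex.Im (M i j) ^+ 2.
  by rewrite mulr_ge0 // sqr_ge0.
have h0 (M : cmatrix R n) i j : 0 <= sqmod ((M *m adj M - 1%:M) i j)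
   + (beta == 1%N)%:R * complex.Im (M i j) ^+ 2.
  by rewrite addr_ge0 ?sqmod_ge0.
have -> : G = h @^-1` [set 0].
  apply/seteqP; split=> [M [uM rM]|M] /=.
    rewrite /h big1 // => i _; rewrite big1 // => j _.
    rewrite (_ : M *m adj M = 1%:M) // subrr mxE /sqmod /= expr0n /= add0r.
    by case: eqP => [/rM ->|_]; rewrite ?mul0r ?expr0n ?mulr0 ?addr0.
  move=> hM0.
  have e0 i j : sqmod ((M *m adj M - 1%:M) i j)
     + (beta == 1%N)%:R * complex.Im (M i j) ^+ 2 = 0.
    have := hM0; rewrite /h; move/eqP; rewrite psumr_eq0; last first.
      by move=> k _; apply: sumr_ge0.
    move=> /allP /(_ i); rewrite mem_index_enum psumr_eq0 // => /(_ isT).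
    by move=> /allP /(_ j); rewrite mem_index_enum => /(_ isT) /eqP.
  split.
    apply/unitaryP/subr0_eq/matrixP => i j; rewrite [RHS]mxE; apply: sqmod_eq0.
    have /eqP := e0 i j; rewrite paddr_eq0 ?sqmod_ge0 //.
    by move=> /andP[/eqP].
  move=> b1 i j; have /eqP := e0 i j.
  rewrite paddr_eq0 ?sqmod_ge0 // b1 eqxx mul1r sqrf_eq0.
  by move=> /andP[_ /eqP].
suff mh : measurable_fun setT h.
  by rewrite -[_ @^-1` _]setTI; apply: mh => //; exact: measurable_set1.
apply: measurable_sum => i; apply: measurable_sum => j.
have [m1 m2] : cmeas setT (fun M : cmatrix R n => (M *m adj M - 1%:M) i j).
  under eq_fun do rewrite !mxE.
  apply: cmeasD; last exact: cmeas_cst.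
  apply: cmeas_sum => k; under eq_fun do rewrite adjE.
  by apply: cmeasM; [|apply: cmeasJ]; exact: cmeas_entry.
apply: measurable_funD.
  by apply: measurable_funD; exact: measurable_funX.
apply: measurable_funM; first exact: measurable_cst.
by apply: measurable_funX; have [] := cmeas_entry i j.
Qed.

Lemma cbm_entry i j : cbm G (fun M : cmatrix R n => M i j).
Proof.
have [mr mi] := cmeas_entry i j.
have b1 (M : cmatrix R n) : G M -> sqmod (M i j) <= 1.
  (* A diagonal entry of the unitarity relation says that each row has norm 1. *)
  move=> [uM _]; have := congr1 (fun X : 'M[C]_n => complex.Re (X i i)) uM.
  rewrite !mxE eqxx Re_sum /= (bigD1 j) //= !mxE ReMJ => <-.
  by rewrite lerDl; apply: sumr_ge0 => k _; rewrite !mxE ReMJ sqmod_ge0.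
split; split; try exact: measurable_funTS.
  exists 1 => M /b1 /= h; rewrite -ler_sqr ?nnegrE // expr1n real_normK ?num_real //.
  by rewrite (le_trans _ h) // /sqmod lerDl sqr_ge0.
exists 1 => M /b1 /= h; rewrite -ler_sqr ?nnegrE // expr1n real_normK ?num_real //.
by rewrite (le_trans _ h) // /sqmod lerDr sqr_ge0.
Qed.

Context (P : probability (cmatrix R n) R) (HP : haar_prob beta P).

(** The change of variables wants a function measurable everywhere, while [F] is controlled on the
    group only. It is extended by zero, which is harmless because left translation by [V] preserves
    the group. *)
Lemma haar_inv (V : cmatrix R n) (F : cmatrix R n -> R) : G V -> bm G F ->
  \int[P]_(M in G) F (V *m M) = \int[P]_(M in G) F M.
Proof.
move=> GV bF; have [PG PV] := HP; congr fine.
pose phi (M : cmatrix R n) : cmatrix R n := V *m M.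
have mphi : measurable_fun setT phi by exact: measurable_mulmx.
have phiG : phi @^-1` G = G.
  apply/seteqP; split => M /=; last exact: haar_groupM.
  move=> GVM; have := haar_groupM (haar_group_adj GV) GVM.
  by rewrite mulmxA unitary_adj ?mul1mx //; case: GV.
have mG := measurable_haar_group.
pose F' : cmatrix R n -> R := F \_ G.
have mF' : measurable_fun setT (EFin \o F').
  by apply/measurable_EFinP; apply/(measurable_restrictT _ _).1 => //; exact: bF.1.
have F'E M : G M -> F' M = F M by move=> GM; rewrite /F' patchE mem_set.
have intF' : P.-integrable (phi @^-1` G) ((EFin \o F') \o phi).
  rewrite phiG; apply: (@bm_integrable _ _ _ P G mG PG (F' \o phi)); split.
    apply: measurable_funTS; apply: measurableT_comp => //.
    exact/measurable_EFinP.
  have [_ [K FK]] := bF; exists K => M GM.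
  by rewrite /= F'E; [apply: FK|]; exact: haar_groupM.
have := integral_pushforward mphi mF' intF' mG.
rewrite phiG => E.
transitivity (\int[P]_(M in G) (((EFin \o F') \o phi) M))%E.
  apply: eq_integral => M; rewrite inE => GM /=.
  by rewrite F'E //; exact: haar_groupM.
rewrite -E; transitivity (\int[P]_(M in G) ((EFin \o F') M))%E.
  by apply: eq_measure_integral => A mA _ /=; rewrite /pushforward /= PV.
by apply: eq_integral => M; rewrite inE => GM /=; rewrite F'E.
Qed.

End haar.

(** * Differentiation rules along a flow *)

Section flow_der_rules.
Context (T : Type) (R : realType) (D : set T) (phi : R -> T -> T).
Hypothesis phi0 : forall x, D x -> phi 0 x = x.
Implicit Types F H : T -> R.
Local Notation der := (flow_der D phi).

Lemma flow_der_cst (c : R) : der (fun=> c) (fun=> 0).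
Proof. by move=> x _; exact: is_derive_cst. Qed.

Lemma flow_derD F F' H H' : der F F' -> der H H' ->
  der (fun x => F x + H x) (fun x => F' x + H' x).
Proof. by move=> dF dH x Dx; apply: is_deriveD; [exact: dF|exact: dH]. Qed.

Lemma flow_derN F F' : der F F' -> der (fun x => - F x) (fun x => - F' x).
Proof. by move=> dF x Dx; apply: is_deriveN; exact: dF. Qed.

Lemma flow_derM F F' H H' : der F F' -> der H H' ->
  der (fun x => F x * H x) (fun x => F' x * H x + F x * H' x).
Proof.
move=> dF dH x Dx; apply: (is_derive_eq (is_deriveM (dF x Dx) (dH x Dx))).
by rewrite phi0 // addrC /GRing.scale /= [H x * _]mulrC.
Qed.

Lemma flow_der_comp (g g' : R -> R) F F' : (forall y : R, is_derive y 1 g (g' y)) ->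
  der F F' -> der (fun x => g (F x)) (fun x => g' (F x) * F' x).
Proof.
move=> dg dF x Dx.
apply: (@is_derive1_comp _ g (fun t => F (phi t x)) 0); last exact: dF.
by rewrite phi0.
Qed.

Lemma flow_der_eq F F' H H' : F =1 H -> F' =1 H' -> der F F' -> der H H'.
Proof. by move=> /funext -> /funext ->. Qed.

Lemma flow_der_sum (I : Type) (s : seq I) (F F' : I -> T -> R) :
  (forall i, der (F i) (F' i)) ->
  der (fun x => \sum_(i <- s) F i x) (fun x => \sum_(i <- s) F' i x).
Proof.
move=> dF; elim: s => [|i s IHs].
  by apply: (flow_der_eq _ _ (flow_der_cst 0)) => x; rewrite big_nil.
by apply: (flow_der_eq _ _ (flow_derD (dF i) IHs)) => x; rewrite big_cons.
Qed.

Definition cder (f f' : T -> R[i]) :=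
  der (fun x => complex.Re (f x)) (fun x => complex.Re (f' x)) /\
  der (fun x => complex.Im (f x)) (fun x => complex.Im (f' x)).

Lemma cder_eq f f' g g' : f =1 g -> f' =1 g' -> cder f f' -> cder g g'.
Proof. by move=> /funext -> /funext ->. Qed.

Lemma cder_cst c : cder (fun=> c) (fun=> 0).
Proof. by split; exact: flow_der_cst. Qed.

Lemma cderD f f' g g' : cder f f' -> cder g g' ->
  cder (fun x => f x + g x) (fun x => f' x + g' x).
Proof.
move=> [rf imf] [rg img]; split.
  by apply: (flow_der_eq _ _ (flow_derD rf rg)) => x; rewrite ReD.
by apply: (flow_der_eq _ _ (flow_derD imf img)) => x; rewrite ImD.
Qed.

Lemma cderM f f' g g' : cder f f' -> cder g g' ->
  cder (fun x => f x * g x) (fun x => f' x * g x + f x * g' x).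
Proof.
move=> [rf imf] [rg img]; split.
  apply: (flow_der_eq _ _ (flow_derD (flow_derM rf rg)
    (flow_derN (flow_derM imf img)))) => x; first by rewrite ReM.
  by rewrite ReD !ReM; ring.
apply: (flow_der_eq _ _ (flow_derD (flow_derM rf img) (flow_derM imf rg))) => x.
  by rewrite ImM.
by rewrite ImD !ImM; ring.
Qed.

Lemma cderJ f f' : cder f f' -> cder (fun x => conjc (f x)) (fun x => conjc (f' x)).
Proof.
move=> [rf imf]; split.
  by apply: (flow_der_eq _ _ rf) => x; rewrite ReJ.
by apply: (flow_der_eq _ _ (flow_derN imf)) => x; rewrite ImJ.
Qed.

Lemma cder_sum (I : Type) (s : seq I) (f f' : I -> T -> R[i]) :
  (forall i, cder (f i) (f' i)) ->
  cder (fun x => \sum_(i <- s) f i x) (fun x => \sum_(i <- s) f' i x).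
Proof.
move=> df; split.
  apply: (flow_der_eq _ _ (flow_der_sum s (fun i => (df i).1))) => x;
    by rewrite Re_sum.
by apply: (flow_der_eq _ _ (flow_der_sum s (fun i => (df i).2))) => x; rewrite Im_sum.
Qed.

Definition mder m n (f f' : T -> 'M[R[i]]_(m, n)) :=
  forall i j, cder (fun x => f x i j) (fun x => f' x i j).

Lemma mder_cst m n (c : 'M[R[i]]_(m, n)) : mder (fun=> c) (fun=> 0).
Proof.
by move=> i j; apply: (cder_eq _ _ (cder_cst _)) => x //; rewrite mxE.
Qed.

Lemma mderM m n p (f f' : T -> 'M[R[i]]_(m, n)) (g g' : T -> 'M[R[i]]_(n, p)) :
  mder f f' -> mder g g' ->
  mder (fun x => f x *m g x) (fun x => f' x *m g x + f x *m g' x).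
Proof.
move=> df dg i j.
apply: (cder_eq _ _ (cder_sum _ (fun k => cderM (df i k) (dg k j)))) => x.
  by rewrite mxE.
by rewrite !mxE -big_split.
Qed.

Lemma mder_adj m n (f f' : T -> 'M[R[i]]_(m, n)) : mder f f' ->
  mder (fun x => adj (f x)) (fun x => adj (f' x)).
Proof.
by move=> df i j; apply: (cder_eq _ _ (cderJ (df j i))) => x; rewrite adjE.
Qed.

Lemma cder_tr n (f f' : T -> 'M[R[i]]_n) : mder f f' ->
  cder (fun x => \tr (f x)) (fun x => \tr (f' x)).
Proof. by move=> df; apply: cder_sum. Qed.

End flow_der_rules.

(** The relation B^3 = - B closes the span of 1, B and B^2 under products; for the coefficients sin
    and 1 - cos the rule becomes the addition formulas. *)
Lemma mulmx_cube (K : comNzRingType) n (B : 'M[K]_n) (a b a' b' : K) :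
  B *m B *m B = - B ->
  (1%:M + a *: B + b *: (B *m B)) *m (1%:M + a' *: B + b' *: (B *m B)) =
  1%:M + (a + a' - a * b' - b * a') *: B + (b + b' + a * a' - b * b') *: (B *m B).
Proof.
move=> cB.
have B4 : B *m B *m (B *m B) = - (B *m B) by rewrite mulmxA cB mulNmx.
have B3 : B *m (B *m B) = - B by rewrite mulmxA.
rewrite !mulmxDl !mulmxDr !mul1mx !mulmx1 -!scalemxAl -!scalemxAr !scalerA B4 B3 cB.
rewrite !scalerN; move: (B *m B) => B2.
by apply/matrixP => i j; rewrite !mxE; ring.
Qed.

Section rotations.
Context (R : realType) (beta n : nat).
Local Notation C := R[i].
Local Notation G := (@haar_group R beta n).
Context (c : R) (B : 'M[C]_n) (cB : B *m B *m B = - B).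

(* Since B^3 = - B, exp (c t B) is the quadratic polynomial [rot t] in B, so that no
   matrix exponential is needed. *)
Definition cube_exp (a b : R) : 'M[C]_n :=
  1%:M + a%:C%C *: B + b%:C%C *: (B *m B).

Definition rot (t : R) : 'M[C]_n := cube_exp (sin (c * t)) (1 - cos (c * t)).

Lemma rot0 : rot 0 = 1%:M.
Proof. by rewrite /rot mulr0 sin0 cos0 subrr /cube_exp !scale0r !addr0. Qed.

Lemma rotD s t : rot (s + t) = rot s *m rot t.
Proof.
have mulE a b a' b' : cube_exp a b *m cube_exp a' b' =
    cube_exp (a + a' - a * b' - b * a') (b + b' + a * a' - b * b').
  rewrite {1 2}/cube_exp (@mulmx_cube C n B _ _ _ _ cB).
  by rewrite -!rmorphM -!rmorphD -!rmorphN -!rmorphD.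
by rewrite /rot mulE mulrDr sinD cosD; apply: f_equal2; ring.
Qed.

Hypothesis adjB : adj B = - B.
Hypothesis realB : beta = 1%N -> forall i j, complex.Im (B i j) = 0.

Lemma rot_group t : G (rot t).
Proof.
have adj_rot : adj (rot t) = rot (- t).
  rewrite /rot /cube_exp !adjD !adjZ adj1 adjM adjB mulNmx mulmxN opprK !conjc_real.
  by rewrite mulrN sinN cosN rmorphN scalerN scaleNr.
split; first by rewrite unitaryP adj_rot -rotD subrr rot0.
move=> b1 i j; rewrite !mxE !ImD !ImZ realB // mulr0 addr0 Im_sum big1 ?mulr0 ?addr0.
  by case: (_ == _).
by move=> k _; rewrite ImM realB // realB // mulr0 mul0r addr0.
Qed.

Definition rot_flow (t : R) (M : cmatrix R n) : cmatrix R n := rot t *m M.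

Lemma mder_rot : mder G rot_flow (fun M => M) (fun M => (c%:C%C *: B) *m M).
Proof.
have Ere (M : cmatrix R n) i j t : (rot_flow t M) i j = M i j +
    (sin (c * t))%:C%C * (B *m M) i j + (1 - cos (c * t))%:C%C * (B *m (B *m M)) i j.
  have E3 (X Y Z : 'M[C]_n) a b : (X + a *: Y + b *: Z) i j =
    X i j + a * Y i j + b * Z i j by rewrite !mxE.
  by rewrite /rot_flow /rot /cube_exp !mulmxDl mul1mx -!scalemxAl -mulmxA E3.
have dsin (a b e : R) : is_derive (0 : R) 1
    (fun t => a + sin (c * t) * b + (1 - cos (c * t)) * e) (c * b).
  have dc : is_derive (0 : R) 1 ( *%R c) c.
    apply: (is_derive_eq (is_deriveM (is_derive_cst (c : R) (0 : R) 1)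
      (is_derive_id (0 : R) (1 : R)))).
    by rewrite /GRing.scale /= /cst mulr0 addr0 mulr1.
  have ds := is_derive1_comp (is_derive_sin (c * 0)) dc.
  have dk := is_derive1_comp (is_derive_cos (c * 0)) dc.
  apply: (is_derive_eq (is_deriveD (is_deriveD (is_derive_cst a (0 : R) 1)
    (is_deriveM ds (is_derive_cst b (0 : R) 1)))
    (is_deriveM (is_deriveB (is_derive_cst (1 : R) (0 : R) 1) dk) (is_derive_cst e (0 : R) 1)))).
  by rewrite /GRing.scale /= /cst !mulr0 sin0 cos0; ring.
have Rmx (X : 'M[C]_n) i j : complex.Re ((c%:C%C *: X) i j) = c * complex.Re (X i j).
  by rewrite mxE ReZ.
have Imx (X : 'M[C]_n) i j : complex.Im ((c%:C%C *: X) i j) = c * complex.Im (X i j).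
  by rewrite mxE ImZ.
move=> i j; split => M _ /=.
  under eq_fun do rewrite Ere !ReD !ReZ.
  by rewrite -scalemxAl Rmx; exact: dsin.
under eq_fun do rewrite Ere !ImD !ImZ.
by rewrite -scalemxAl Imx; exact: dsin.
Qed.

End rotations.

(** * The Laplacian on traces *)

Section projections.
Context (R : realType) (n : nat).
Local Notation C := R[i].
Implicit Types (P S X Y : 'M[C]_n).
Local Notation Re := (@complex.Re R).

Definition hproj P := P *m P = P /\ adj P = P.

Lemma Re_tr_mul_adj m p (X : 'M[C]_(m, p)) : Re (\tr (X *m adj X)) = \sum_i \sum_j sqmod (X i j).
Proof.
rewrite Re_sum; apply: eq_bigr => i _; rewrite mxE Re_sum; apply: eq_bigr => j _.
by rewrite adjE ReMJ.
Qed.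

Lemma Re_tr_mul_adj_ge0 m p (X : 'M[C]_(m, p)) : 0 <= Re (\tr (X *m adj X)).
Proof.
by rewrite Re_tr_mul_adj; apply: sumr_ge0 => i _; apply: sumr_ge0 => j _; exact: sqmod_ge0.
Qed.

Lemma Re_trJ X : Re (\tr (adj X)) = Re (\tr X).
Proof. by rewrite tr_adj ReJ. Qed.

Lemma hproj_tr_ge0 P S : hproj P -> hproj S -> 0 <= Re (\tr (P *m S)).
Proof.
move=> [pP aP] [pS aS].
have -> : \tr (P *m S) = \tr ((P *m S) *m adj (P *m S)).
  rewrite adjM aP aS mulmxA -(mulmxA P S S) pS [RHS]mxtrace_mulC.
  by rewrite mulmxA pP.
exact: Re_tr_mul_adj_ge0.
Qed.

Lemma hproj_compl P : hproj P -> hproj (1%:M - P).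
Proof.
move=> [pP aP]; split; last by rewrite adjD adjN adj1 aP.
by rewrite mulmxBl !mulmxBr !mul1mx !mulmx1 pP subrr subr0.
Qed.

Lemma hproj_tr_le P S : hproj P -> hproj S -> Re (\tr (P *m S)) <= Re (\tr P).
Proof.
move=> hP hS; rewrite -subr_ge0 -ReB -raddfB /= -{1}[P]mulmx1 -mulmxBr.
exact: hproj_tr_ge0 hP (hproj_compl hS).
Qed.

(** Operator norm at most 1, phrased on vectors. *)
Definition contr X := forall v : 'cV[C]_n,
  \sum_i sqmod ((X *m v) i 0) <= \sum_i sqmod (v i 0).

Lemma contrM X Y : contr X -> contr Y -> contr (X *m Y).
Proof. by move=> cX cY v; rewrite -mulmxA; exact: le_trans (cX _) (cY _). Qed.

Lemma sqnorm_tr (v : 'cV[C]_n) : \sum_i sqmod (v i 0) = Re (\tr (v *m adj v)).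
Proof. by rewrite Re_tr_mul_adj; apply: eq_bigr => i _; rewrite big_ord1. Qed.

(** Pythagoras: the defect is the squared norm of (1 - P) v. *)
Lemma hproj_contr P : hproj P -> contr P.
Proof.
move=> hP v; rewrite !sqnorm_tr -subr_ge0.
suff -> : Re (\tr (v *m adj v)) - Re (\tr (P *m v *m adj (P *m v))) =
    Re (\tr (((1%:M - P) *m v) *m adj ((1%:M - P) *m v))) by exact: Re_tr_mul_adj_ge0.
have e X : hproj X -> \tr (X *m v *m adj (X *m v)) = \tr (X *m (v *m adj v)).
  by move=> [pX aX]; rewrite adjM aX mulmxA mxtrace_mulC !mulmxA pX.
rewrite (e _ hP) (e _ (hproj_compl hP)) -ReB -raddfB /=.
by rewrite mulmxBl mul1mx.
Qed.

(** The k-th diagonal entry is a coordinate of the image of the k-th basis vector, so its real part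
    is at most 1 in modulus. *)
Lemma contr_tr X : contr X -> `|Re (\tr X)| <= n%:R.
Proof.
move=> cX; rewrite Re_sum (le_trans (ler_norm_sum _ _ _)) //.
rewrite -[leRHS]mulr1 -[n in leRHS]card_ord -sum1_card natr_sum mulr_suml.
apply: ler_sum => k _; rewrite mul1r.
have := cX (delta_mx k 0).
rewrite [leRHS](bigD1 k) //= [X in _ + X]big1 ?addr0; last first.
  by move=> i /negPf ik; rewrite mxE ik /sqmod /= expr0n /= addr0.
rewrite mxE !eqxx [sqmod 1]/sqmod /= expr1n expr0n addr0.
rewrite (bigD1 k) //= -colE mxE => h.
rewrite -ler_sqr ?nnegrE // expr1n real_normK ?num_real //.
apply: le_trans h; rewrite /sqmod -addrA lerDl addr_ge0 ?sqr_ge0 //.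
by apply: sumr_ge0 => i _; exact: sqmod_ge0.
Qed.

End projections.

Section casimir_algebra.
Context (K : comNzRingType) (n : nat) (I : finType) (gen : I -> 'M[K]_n) (c b : K).
Hypothesis casimirE : forall X,
  \sum_t gen t *m X *m gen t = (2 * c) *: X^T - (2 * b * \tr X)%:M.
Implicit Types P S X Y Z N : 'M[K]_n.

Definition comm X Y := X *m Y - Y *m X.

(** Symmetry of [X] when c = 1 (orthogonal case), no condition when c = 0 (unitary case): one
    hypothesis serves both groups. *)
Definition bsym X := c *: X^T = c *: X.

(** The double commutator is g^2 S + S g^2 - 2 g S g. The Casimir value of the identity contributes
    4 c S and the last term - 4 c S^T, which cancel by [bsym]: the eigenvalue does not see c. *)
Lemma comm2_sum S : bsym S ->
  \sum_t comm (gen t) (comm (gen t) S) =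
  - (4 * b * n%:R) *: S + (4 * b * \tr S)%:M.
Proof.
move=> bS.
transitivity ((\sum_t gen t *m 1%:M *m gen t) *m S + S *m (\sum_t gen t *m 1%:M *m gen t)
   - ((\sum_t gen t *m S *m gen t) + (\sum_t gen t *m S *m gen t))).
  rewrite mulmx_suml mulmx_sumr -!big_split -sumrB /=; apply: eq_bigr => t _.
  rewrite /comm !mulmxBl !mulmxBr !mulmx1 !mulmxA.
  by rewrite opprB addrACA opprD [_ - _ in RHS]addrC addrA addrAC.
have eS : (2 * c) *: S^T = (2 * c) *: S by rewrite -!scalerA; congr (_ *: _).
rewrite !casimirE trmx1 mxtrace1 eS.
rewrite mulmxBl mulmxBr -!scalemxAl -!scalemxAr mul1mx mulmx1 mul_scalar_mx mul_mx_scalar.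
move: (2 * c) (\tr S) => k s.
by apply/matrixP => i j; rewrite !mxE; ring.
Qed.

Lemma tr_casimir X Y Z : \sum_t \tr (X *m gen t *m Y *m gen t *m Z) =
  2 * c * \tr (X *m Y^T *m Z) - 2 * b * \tr Y * \tr (X *m Z).
Proof.
transitivity (\tr (X *m (\sum_t gen t *m Y *m gen t) *m Z)).
  rewrite mulmx_sumr mulmx_suml raddf_sum; apply: eq_bigr => t _ /=.
  by rewrite !mulmxA.
rewrite casimirE mulmxBr mulmxBl raddfB /= -scalemxAr -scalemxAl mxtraceZ.
by rewrite mul_mx_scalar -scalemxAl mxtraceZ.
Qed.

(** Each of the four terms of the product has the shape X g Y g Z after at most one cyclic move, so
    [tr_casimir] applies; the transposes of S and S' disappear through [bsym]. *)
Lemma cross_sum P S P' S' : P^T = P -> P'^T = P' -> bsym S -> bsym S' ->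
  \sum_t \tr (P *m comm (gen t) S *m (P' *m comm (gen t) S')) =
  2 * c * (\tr (P *m P' *m S *m S') + \tr (P *m S *m S' *m P')
     - 2 * \tr (P *m S *m P' *m S'))
  + 2 * b * (\tr P * \tr (S *m P' *m S') + \tr P' * \tr (P *m S *m S')
     - \tr (S *m P') * \tr (P *m S') - \tr (P *m S) * \tr (P' *m S')).
Proof.
move=> tP tP' bS bS'.
have E t : \tr (P *m comm (gen t) S *m (P' *m comm (gen t) S')) =
    \tr (P *m gen t *m (S *m P') *m gen t *m S')
    - \tr (1%:M *m gen t *m P *m gen t *m (S *m P' *m S'))
    - \tr (P *m S *m gen t *m P' *m gen t *m S')
    + \tr (P *m S *m gen t *m (P' *m S') *m gen t *m 1%:M).
  have -> : \tr (1%:M *m gen t *m P *m gen t *m (S *m P' *m S')) =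
      \tr (P *m gen t *m S *m P' *m S' *m gen t).
    by rewrite mul1mx [RHS]mxtrace_mulC !mulmxA.
  rewrite /comm !mulmxBr !mulmxBl !mulmx1 !mulmxA !raddfB /=.
  by move: (\tr _) (\tr _) (\tr _) (\tr _) => x y z w; ring.
under eq_bigr do rewrite E.
rewrite big_split /= !sumrB !tr_casimir !mul1mx !mulmx1 !trmx_mul tP tP'.
have bSE X Y : c * \tr (X *m S^T *m Y) = c * \tr (X *m S *m Y).
  by rewrite -!mxtraceZ !(scalemxAl c (X *m _)) !(scalemxAr c X) bS.
have bSE' X Y : c * \tr (X *m S'^T *m Y) = c * \tr (X *m S' *m Y).
  by rewrite -!mxtraceZ !(scalemxAl c (X *m _)) !(scalemxAr c X) bS'.
have -> : 2 * c * \tr (P *m (P' *m S^T) *m S') = 2 * (c * \tr (P *m P' *m S *m S')).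
  by rewrite -mulrA mulmxA bSE.
have -> : 2 * c * \tr (P *m S *m (S'^T *m P')) = 2 * (c * \tr (P *m S *m S' *m P')).
  by rewrite -mulrA mulmxA bSE'.
rewrite !mulmxA; ring.
Qed.

End casimir_algebra.

(** * Integration by parts on the group *)

Section haar_calculus.
Context (R : realType) (beta n : nat) (hbeta : beta = 1%N \/ beta = 2%N).
Local Notation C := R[i].
Local Notation G := (@haar_group R beta n).
Local Notation cmx := (cmatrix R n).
Local Notation Re := (@complex.Re R).
Local Notation Im := (@complex.Im R).
Local Notation gen := (@gen R beta n).
Context (P : probability cmx R) (HP : haar_prob beta P).
Local Notation E F := (Rintegral P G F).

Let mG : measurable G := @measurable_haar_group R beta n.
Let PG : P G = 1%E := HP.1.

(** The existential hides the [c] and [B] of [gen_cube]: the calculus below rests on these three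
    facts about the flow. *)
Lemma gen_flow t : exists phi : R -> cmx -> cmx,
  [/\ forall M, G M -> phi 0 M = M,
      mder G phi (fun M => M) (fun M => gen t *m M) &
      forall F F', bm G F -> bm G F' -> flow_der G phi F F' -> E F' = 0].
Proof.
have [c [B [c0 gB cB]]] := gen_cube R t.
have adjB : adj B = - B.
  have := gen_adj R t; rewrite gB adjZ conjc_real -scalerN.
  by move/(congr1 (fun X => (c%:C%C)^-1 *: X)); rewrite !scalerA mulVf ?scale1r //;
    rewrite (inj_eq (@complexI R) c 0).
have realB : beta = 1%N -> forall i j, Im (B i j) = 0.
  move=> b1 i j; have := gen_real R t i j b1; rewrite gB mxE ImZ => /eqP.
  by rewrite mulf_eq0 (negPf c0) => /eqP.
exists (rot_flow c B); split.
- by move=> M _; rewrite /rot_flow rot0 mul1mx.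
- by rewrite gB; exact: mder_rot.
- move=> F F'; apply: (flow_ibp mG PG).
  + by move=> s M GM; apply: haar_groupM => //; exact: rot_group.
  + by move=> M _; rewrite /rot_flow rot0 mul1mx.
  + by move=> s s' M _; rewrite /rot_flow rotD // mulmxA.
  + by move=> s; exact: measurable_mulmx.
  + by move=> s H bH; apply: (haar_inv HP) => //; exact: rot_group.
Qed.

Definition gflow t := sval (cid (gen_flow t)).

Lemma gflow0 t M : G M -> gflow t 0 M = M.
Proof. by rewrite /gflow; case: cid => phi /= [h _ _] /h. Qed.

Lemma mder_id t : mder G (gflow t) (fun M => M) (fun M => gen t *m M).
Proof. by rewrite /gflow; case: cid => phi /= []. Qed.

Lemma gflow_ibp t F F' : bm G F -> bm G F' -> flow_der G (gflow t) F F' -> E F' = 0.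
Proof. by rewrite /gflow; case: cid => phi /= [_ _]; exact. Qed.

(** When Z'_t is the derivative of some Z along generator t, the sum of the Z''_t is the Laplacian
    of Z and this is Green's formula. *)
Lemma ibp_sum (F : cmx -> R) (F' : _ -> cmx -> R) (Z' Z'' : _ -> cmx -> C) :
  bm G F -> (forall t, bm G (F' t)) -> (forall t, flow_der G (gflow t) F (F' t)) ->
  (forall t, cbm G (Z' t)) -> (forall t, cbm G (Z'' t)) ->
  (forall t, cder G (gflow t) (Z' t) (Z'' t)) ->
  E (fun M => F M * Re (\sum_t Z'' t M)) = - E (fun M => \sum_t F' t M * Re (Z' t M)).
Proof.
move=> bF bF' dF bZ' bZ'' dZ.
have b1 t : bm G (fun M => F' t M * Re (Z' t M)) by apply: bmM => //; exact: (bZ' t).1.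
have b2 t : bm G (fun M => F M * Re (Z'' t M)) by apply: bmM => //; exact: (bZ'' t).1.
transitivity (\sum_t E (fun M => F M * Re (Z'' t M))).
  rewrite -(Ex_sum mG PG) //; apply: Ex_eq => M _.
  by rewrite Re_sum big_distrr.
rewrite (Ex_sum mG PG) // -sumrN; apply: eq_bigr => t _.
apply/eqP; rewrite -addr_eq0 addrC -(ExD mG PG) //; apply/eqP.
apply: (@gflow_ibp t (fun M => F M * Re (Z' t M))).
- by apply: bmM => //; exact: (bZ' t).1.
- exact: bmD.
- by apply: flow_derM => //; [move=> M; exact: gflow0 | exact: (dZ t).1].
Qed.

Definition mbm p q (f : cmx -> 'M[C]_(p, q)) := forall i j, cbm G (fun M => f M i j).

Lemma mbm_id : mbm (fun M => M : 'M[C]_n).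
Proof. by move=> i j; exact: cbm_entry. Qed.

Lemma mbm_cst p q (X : 'M[C]_(p, q)) : mbm (fun=> X).
Proof. by move=> i j; exact: cbm_cst. Qed.

Lemma mbmM p q r (f : cmx -> 'M[C]_(p, q)) (g : cmx -> 'M[C]_(q, r)) :
  mbm f -> mbm g -> mbm (fun M => f M *m g M).
Proof.
move=> bf bg i j; under eq_fun do rewrite mxE.
by apply: cbm_sum => k _; exact: cbmM.
Qed.

Lemma mbmB p q (f g : cmx -> 'M[C]_(p, q)) :
  mbm f -> mbm g -> mbm (fun M => f M - g M).
Proof.
move=> bf bg i j; under eq_fun do rewrite 2!mxE.
by apply: cbmD => //; exact: cbmN.
Qed.

Lemma mbm_adj p q (f : cmx -> 'M[C]_(p, q)) : mbm f -> mbm (fun M => adj (f M)).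
Proof. by move=> bf i j; under eq_fun do rewrite adjE; exact: cbmJ. Qed.

Lemma cbm_tr p (f : cmx -> 'M[C]_p) : mbm f -> cbm G (fun M => \tr (f M)).
Proof. by move=> bf; apply: cbm_sum => i _; exact: bf. Qed.

Lemma mder_eq T (D : set T) phi p q (f f' g g' : T -> 'M[C]_(p, q)) :
  f =1 g -> f' =1 g' -> mder D phi f f' -> mder D phi g g'.
Proof. by move=> /funext -> /funext ->. Qed.

Lemma mderB t p q (f f' g g' : cmx -> 'M[C]_(p, q)) :
  mder G (gflow t) f f' -> mder G (gflow t) g g' ->
  mder G (gflow t) (fun M => f M - g M) (fun M => f' M - g' M).
Proof.
move=> df dg i j.
have dN : cder G (gflow t) (fun M => - g M i j) (fun M => - g' M i j).
  apply: (cder_eq _ _ (cderM (@gflow0 t) (cder_cst _ _ (-1)) (dg i j))) => M.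
    by rewrite mulN1r.
  by rewrite mul0r add0r mulN1r.
by apply: (cder_eq _ _ (cderD (df i j) dN)) => M; rewrite !mxE.
Qed.

Lemma mder_cmull t p q r (X : 'M[C]_(p, q)) (f f' : cmx -> 'M[C]_(q, r)) :
  mder G (gflow t) f f' ->
  mder G (gflow t) (fun M => X *m f M) (fun M => X *m f' M).
Proof.
move=> df; apply: (mder_eq _ _ (mderM (@gflow0 t) (mder_cst _ _ X) df)) => M //.
by rewrite mul0mx add0r.
Qed.

Lemma mder_cmulr t p q r (X : 'M[C]_(q, r)) (f f' : cmx -> 'M[C]_(p, q)) :
  mder G (gflow t) f f' ->
  mder G (gflow t) (fun M => f M *m X) (fun M => f' M *m X).
Proof.
move=> df; apply: (mder_eq _ _ (mderM (@gflow0 t) df (mder_cst _ _ X))) => M //.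
by rewrite mulmx0 addr0.
Qed.

Lemma mder_comm t (f f' : cmx -> 'M[C]_n) : mder G (gflow t) f f' ->
  mder G (gflow t) (fun M => comm (gen t) (f M)) (fun M => comm (gen t) (f' M)).
Proof. by move=> df; apply: mderB; [exact: mder_cmull | exact: mder_cmulr]. Qed.

Lemma mbm_comm (X : 'M[C]_n) (f : cmx -> 'M[C]_n) : mbm f -> mbm (fun M => comm X (f M)).
Proof. by move=> bf; apply: mbmB; apply: mbmM => //; exact: mbm_cst. Qed.

Definition Sq (Q : 'M[C]_n) (M : cmx) : 'M[C]_n := M *m Q *m adj M.

Lemma mbm_Sq Q : mbm (Sq Q).
Proof.
apply: mbmM; last by apply: mbm_adj; exact: mbm_id.
by apply: mbmM; [exact: mbm_id | exact: mbm_cst].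
Qed.

Lemma mder_Sq t Q : mder G (gflow t) (Sq Q) (fun M => comm (gen t) (Sq Q M)).
Proof.
have dM := mder_id t.
apply: (mder_eq _ _ (mderM (@gflow0 t) (mder_cmulr Q dM) (mder_adj dM))) => M //.
by rewrite /comm /Sq adjM gen_adj !mulmxN !mulmxA.
Qed.

Lemma hproj_Sq Q M : hproj Q -> G M -> hproj (Sq Q M).
Proof.
move=> [qQ aQ] [uM _]; split; last by rewrite /Sq !adjM adjK aQ mulmxA.
by rewrite /Sq !mulmxA -(mulmxA _ (adj M) M) unitary_adj // mulmx1 -(mulmxA M Q Q) qQ.
Qed.

Lemma SqM Q Q' M : G M -> Sq Q M *m Sq Q' M = Sq (Q *m Q') M.
Proof.
move=> [uM _]; rewrite /Sq !mulmxA -(mulmxA _ (adj M) M) unitary_adj //.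
by rewrite mulmx1 -(mulmxA M Q Q').
Qed.

Lemma tr_Sq Q M : G M -> \tr (Sq Q M) = \tr Q.
Proof. by move=> [uM _]; rewrite /Sq mxtrace_mulC mulmxA unitary_adj // mul1mx. Qed.

Local Notation c := ((2 - beta)%:R : C).

Lemma gen_casimir (X : 'M[C]_n) :
  \sum_t gen t *m X *m gen t = (2 * c) *: X^T - (2 * beta%:R * \tr X)%:M.
Proof. by rewrite casimir // !natrM. Qed.

Lemma bsym_Sq Q M : Q^T = Q -> G M -> bsym c (Sq Q M).
Proof.
move=> tQ [_ rM]; rewrite /bsym; case: hbeta => b; last by rewrite b subnn !scale0r.
have aM : adj M = M^T.
  apply/matrixP => i j; rewrite adjE mxE; apply: complex_ext; rewrite ?ReJ //.
  by rewrite ImJ rM // oppr0.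
by rewrite /Sq aM !trmx_mul trmxK tQ mulmxA.
Qed.

(** Skew-adjointness of [X] makes its traces against generators real, so the product of real parts
    is the real part of the product. By the second hypothesis the transposed trace in [casimir_tr]
    is minus the other one, and 2 (2 - beta) + 2 beta = 4 is the same for both groups. *)
Lemma sum_Gamma (X N : 'M[C]_n) : adj X = - X -> c *: X^T = - (c *: X) ->
  \sum_t Re (\tr (gen t *m X)) * Re (\tr (gen t *m N)) = - 4 * Re (\tr (X *m N)).
Proof.
move=> aX tX.
have imX t : Im (\tr (gen t *m X)) = 0.
  have : conjc (\tr (gen t *m X)) = \tr (gen t *m X).
    by rewrite -tr_adj adjM gen_adj aX mulmxN mulNmx opprK mxtrace_mulC.
  by move/(congr1 Im); rewrite ImJ => h; lra.
transitivity (Re (\sum_t \tr (gen t *m X) * \tr (gen t *m N))).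
  by rewrite Re_sum; apply: eq_bigr => t _; rewrite ReM imX mul0r subr0.
have h : c * \tr (X *m N^T) = - (c * \tr (X *m N)).
  have -> : \tr (X *m N^T) = \tr (X^T *m N).
    by rewrite -mxtrace_tr trmx_mul trmxK mxtrace_mulC.
  by rewrite -!mxtraceZ (scalemxAl c X^T) tX mulNmx -scalemxAl raddfN.
rewrite casimir_tr // natrM -mulrA h natrM -mulrA mulrN -opprD -mulrDr -mulrDl -natrD.
rewrite subnK; last by case: hbeta => ->.
by rewrite mulrA -natrM ReN ReMn mulNr.
Qed.

Lemma adj_comm (X Y : 'M[C]_n) : adj X = X -> adj Y = Y -> adj (comm X Y) = - comm X Y.
Proof. by move=> aX aY; rewrite /comm adjD adjN !adjM aX aY opprB. Qed.

Lemma bsym_comm (X Y : 'M[C]_n) : bsym c X -> Y^T = Y -> c *: (comm X Y)^T = - (c *: comm X Y).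
Proof.
move=> bX tY; rewrite /comm raddfB /= !trmx_mul tY scalerBr scalemxAr bX.
by rewrite (scalemxAl c X^T) bX -scalemxAl -scalemxAr scalerBr opprB.
Qed.

Lemma tr_comm_gen t (X S : 'M[C]_n) : \tr (X *m comm (gen t) S) = \tr (gen t *m comm S X).
Proof.
rewrite /comm !mulmxBr !raddfB /=; apply: f_equal2.
  by rewrite mxtrace_mulC mulmxA.
by apply: f_equal; rewrite mulmxA mxtrace_mulC mulmxA.
Qed.

Definition bsproj (Q : 'M[C]_n) := hproj Q /\ Q^T = Q.

(* For the coordinate projections A, Q of ranks p, q, [tau A Q] is T_pq. *)
Definition tau (A Q : 'M[C]_n) (M : cmx) : R := Re (\tr (A *m Sq Q M)).

Definition dtau t (A Q : 'M[C]_n) (M : cmx) : R := Re (\tr (A *m comm (gen t) (Sq Q M))).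

Lemma bm_tau A Q : bm G (tau A Q).
Proof.
have [] // : cbm G (fun M => \tr (A *m Sq Q M)).
by apply: cbm_tr; apply: mbmM; [exact: mbm_cst | exact: mbm_Sq].
Qed.

Lemma cbm_dtau t A Q : cbm G (fun M => \tr (A *m comm (gen t) (Sq Q M))).
Proof.
by apply: cbm_tr; apply: mbmM; [exact: mbm_cst | apply: mbm_comm; exact: mbm_Sq].
Qed.

Lemma flow_der_tau t A Q : flow_der G (gflow t) (tau A Q) (dtau t A Q).
Proof.
have [] // : cder G (gflow t) (fun M => \tr (A *m Sq Q M))
  (fun M => \tr (A *m comm (gen t) (Sq Q M))).
by apply: cder_tr; apply: mder_cmull; exact: mder_Sq.
Qed.

Lemma Im_tr_hproj (Q : 'M[C]_n) : hproj Q -> Im (\tr Q) = 0.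
Proof. by move=> [_ aQ]; have := congr1 Im (tr_adj Q); rewrite aQ ImJ => h; lra. Qed.

(** The scalar part of [comm2_sum] is what recentres [tau A Q] at tr A tr Q / n. The test function
    [F] is free: it will be constant for the mean, a power for the moments, a bounded function of
    the process for the Stein identity. *)
Lemma ibp_tau (A Q : 'M[C]_n) F F' : bsproj A -> bsproj Q -> (0 < n)%N ->
  bm G F -> (forall t, bm G (F' t)) -> (forall t, flow_der G (gflow t) F (F' t)) ->
  4 * beta%:R * n%:R * E (fun M => F M * (tau A Q M - Re (\tr A) * Re (\tr Q) / n%:R)) =
  E (fun M => \sum_t F' t M * dtau t A Q M).
Proof.
move=> pA pQ n0 bF bF' dF.
have bS : bm G (fun M => F M * (tau A Q M - Re (\tr A) * Re (\tr Q) / n%:R)).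
  by apply: bmM => //; apply: bmB; [exact: bm_tau | exact: bm_cst].
rewrite -(ExZ mG PG) //; apply/eqP; rewrite -eqr_opp; apply/eqP.
rewrite -(ExN mG PG); last by apply: bmZ.
rewrite -(@ibp_sum F F' _ (fun t M => \tr (A *m comm (gen t) (comm (gen t) (Sq Q M))))) //.
- apply: Ex_eq => M GM.
  rewrite -raddf_sum -mulmx_sumr (comm2_sum gen_casimir (bsym_Sq pQ.2 GM)).
  rewrite tr_Sq // mulmxDr raddfD /= -scalemxAr mxtraceZ mul_mx_scalar mxtraceZ.
  have -> : 4 * beta%:R * n%:R = (4 * beta * n)%:R :> C by rewrite !natrM.
  have -> : 4 * beta%:R * \tr Q * \tr A = (4 * beta)%:R * (\tr Q * \tr A) :> C.
    by rewrite !natrM mulrA.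
  rewrite mulNr ReD ReN !ReMn ReM (Im_tr_hproj pQ.1) mul0r subr0 -/(tau A Q M).
  have : n%:R != 0 :> R by rewrite pnatr_eq0 -lt0n.
  rewrite !natrM.
  move: (F M) (tau _ _ _) (Re (\tr Q)) (Re (\tr A)) (n%:R : R) (beta%:R : R) => x y z w k l k0.
  by field.
- by move=> t; exact: cbm_dtau.
- move=> t; apply: cbm_tr; apply: mbmM; first exact: mbm_cst.
  by do 2!apply: mbm_comm; exact: mbm_Sq.
- move=> t; apply: cder_tr; apply: mder_cmull; apply: mder_comm; exact: mder_Sq.
Qed.

End haar_calculus.

Section moments.
Context (R : realType) (beta n : nat) (hbeta : beta = 1%N \/ beta = 2%N).
Context (n_gt0 : (0 < n)%N).
Local Notation C := R[i].
Local Notation G := (@haar_group R beta n).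
Local Notation cmx := (cmatrix R n).
Local Notation Re := (@complex.Re R).
Local Notation Im := (@complex.Im R).
Local Notation gen := (@gen R beta n).
Context (P : probability cmx R) (HP : haar_prob beta P).
Local Notation E F := (Rintegral P G F).
Local Notation gflow := (gflow HP).

Let mG : measurable G := @measurable_haar_group R beta n.
Let PG : P G = 1%E := HP.1.

(* The carre du champ of [tau A Q] and [tau A' Q'], see [Gamma_tau]. *)
Definition gam (A Q A' Q' : 'M[C]_n) (M : cmx) : R :=
  4 * (Re (\tr (A *m A' *m Sq Q' M *m Sq Q M)) + Re (\tr (A' *m A *m Sq Q M *m Sq Q' M))
       - 2 * Re (\tr (A *m Sq Q M *m A' *m Sq Q' M))).

Lemma dtau_gen t A Q M : dtau (beta := beta) t A Q M = Re (\tr (gen t *m comm (Sq Q M) A)).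
Proof. by rewrite /dtau; apply: f_equal; exact: tr_comm_gen. Qed.

Lemma Gamma_tau A Q A' Q' M : bsproj A -> bsproj Q -> bsproj A' -> bsproj Q' -> G M ->
  \sum_t dtau (beta := beta) t A Q M * dtau t A' Q' M = gam A Q A' Q' M.
Proof.
move=> pA pQ pA' pQ' GM.
under eq_bigr do rewrite !dtau_gen.
have [[_ aS] [_ aS']] := (hproj_Sq pQ.1 GM, hproj_Sq pQ'.1 GM).
have aA := pA.1.2; have aA' := pA'.1.2.
rewrite (sum_Gamma hbeta); last 2 first.
- exact: adj_comm.
- by apply: bsym_comm; [exact: (bsym_Sq hbeta pQ.2 GM) | exact: pA.2].
rewrite /gam; move: (Sq Q M) (Sq Q' M) aS aS' => S S' aS aS'.
have -> : comm S A *m comm S' A' = S *m A *m S' *m A' - S *m (A *m A' *m S')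
    - A *m S *m S' *m A' + A *m S *m A' *m S'.
  rewrite /comm mulmxBr !mulmxBl !mulmxA.
  by move: (_ *m _) (_ *m _) (_ *m _) (_ *m _) => x y z w; apply/matrixP => i j; rewrite !mxE; ring.
have trB (X Y : 'M[C]_n) : \tr (X - Y) = \tr X - \tr Y by rewrite raddfB.
rewrite mxtraceD !trB ReD !ReB.
(* The two alternating traces are conjugate, so their real parts merge and three terms remain. *)
have -> : Re (\tr (S *m A *m S' *m A')) = Re (\tr (A *m S *m A' *m S')).
  transitivity (Re (\tr (adj (S *m A *m S' *m A')))); first by rewrite Re_trJ.
  have -> : adj (S *m A *m S' *m A') = (A' *m S') *m (A *m S).
    by rewrite !adjM aS aS' aA aA' !mulmxA.
  by apply: f_equal; rewrite mxtrace_mulC !mulmxA.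
have -> : \tr (S *m (A *m A' *m S')) = \tr (A *m A' *m S' *m S).
  exact: mxtrace_mulC.
have -> : \tr (A *m S *m S' *m A') = \tr (A' *m A *m S *m S').
  by rewrite mxtrace_mulC !mulmxA.
by move: (Re _) (Re _) (Re _) => x y z; ring.
Qed.

(** The subtracted term is a squared norm, and tr (A S) is at most either rank. Keeping the smaller
    rank is what makes a strip of k rows or columns fluctuate on the scale (k / n)^(1/2). *)
Lemma gam_le A Q M : bsproj A -> bsproj Q -> G M ->
  gam A Q A Q M <= 8 * Num.min (Re (\tr A)) (Re (\tr Q)).
Proof.
move=> pA pQ GM; have hS := hproj_Sq pQ.1 GM.
rewrite /gam -(tr_Sq Q GM); move: (Sq Q M) hS => S hS.
rewrite pA.1.1 -mulmxA hS.1.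
have h1 : Re (\tr (A *m S)) <= Num.min (Re (\tr A)) (Re (\tr S)).
  rewrite le_min; apply/andP; split; first exact: hproj_tr_le pA.1 hS.
  by rewrite mxtrace_mulC; exact: hproj_tr_le hS pA.1.
have h2 : 0 <= Re (\tr (A *m S *m A *m S)).
  have -> : \tr (A *m S *m A *m S) = \tr ((A *m S *m A) *m adj (A *m S *m A)).
    rewrite !adjM hS.2 pA.1.2 !mulmxA -(mulmxA _ A A) pA.1.1.
    by rewrite [RHS]mxtrace_mulC !mulmxA pA.1.1.
  exact: Re_tr_mul_adj_ge0.
lra.
Qed.

Lemma flow_derX t (F F' : cmx -> R) k : flow_der G (gflow t) F F' ->
  flow_der G (gflow t) (fun M => F M ^+ k.+1) (fun M => k.+1%:R * F M ^+ k * F' M).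
Proof.
apply: (@flow_der_comp _ _ _ _ (@gflow0 _ _ _ _ _ t)
  (fun x => x ^+ k.+1) (fun x => k.+1%:R * x ^+ k)) => y.
 apply: DeriveDef; first exact: exprn_derivable.
by rewrite exp_derive /GRing.scale /= mulr1.
Qed.

Definition ctau (A Q : 'M[C]_n) (M : cmx) : R := tau A Q M - Re (\tr A) * Re (\tr Q) / n%:R.

Lemma bm_ctau A Q : bm G (ctau A Q).
Proof. by apply: bmB; [exact: bm_tau | exact: bm_cst]. Qed.

Lemma flow_der_ctau t A Q : flow_der G (gflow t) (ctau A Q) (dtau t A Q).
Proof.
have d : flow_der G (gflow t)
    (fun M => tau A Q M + (- (Re (\tr A) * Re (\tr Q) / n%:R)))
    (fun M => dtau t A Q M + 0).
  by apply: flow_derD; [exact: flow_der_tau | exact: flow_der_cst].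
by apply: (flow_der_eq _ _ d) => M //; rewrite addr0.
Qed.

Let lam : R := 4 * beta%:R * n%:R.

Let lam_gt0 : 0 < lam.
Proof. by rewrite /lam !mulr_gt0 ?ltr0n //; case: hbeta => ->. Qed.

(* [ctau] is an eigenfunction, so the moment of order k + 2 is that of order k weighted
   by the carre du champ. *)
Lemma moment_step A Q k : bsproj A -> bsproj Q -> ~~ odd k ->
  E (fun M => ctau A Q M ^+ k.+2) <=
  k.+1%:R * (8 * Num.min (Re (\tr A)) (Re (\tr Q)) / lam) * E (fun M => ctau A Q M ^+ k).
Proof.
move=> pA pQ ek.
have bdt t : bm G (dtau (beta := beta) t A Q) by have [] := cbm_dtau t A Q.
have := @ibp_tau R beta n hbeta P HP A Q (fun M => ctau A Q M ^+ k.+1)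
  (fun t M => k.+1%:R * ctau A Q M ^+ k * dtau t A Q M) pA pQ n_gt0.
have bX j : bm G (fun M => ctau A Q M ^+ j) by apply: bmX; exact: bm_ctau.
have bXc : bm G (fun M => k.+1%:R * ctau A Q M ^+ k) by exact: bmZ.
move=> /(_ (bX _)) /(_ (fun t => bmM bXc (bdt t))).
move=> /(_ (fun t => flow_derX k (flow_der_ctau t A Q))).
rewrite -/lam => H.
have -> : E (fun M => ctau A Q M ^+ k.+2) = lam^-1 *
    E (fun M => \sum_t k.+1%:R * ctau A Q M ^+ k * dtau (beta := beta) t A Q M * dtau t A Q M).
  rewrite -H mulKf ?gt_eqF //; apply: Ex_eq => M _.
  by rewrite exprSr.
rewrite ler_pdivrMl //.
set m := Num.min _ _.
have -> : lam * (k.+1%:R * (8 * m / lam) * E (fun M => ctau A Q M ^+ k)) =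
    E (fun M => k.+1%:R * (8 * m) * ctau A Q M ^+ k).
  rewrite (ExZ mG PG) //; have : lam != 0 by rewrite gt_eqF.
  by move: (E _) => x l0; field.
apply: (Ex_le mG PG).
- apply: bm_sum => t _; apply: bmM => //.
  by apply: bmM.
- exact: bmZ.
- move=> M GM.
  under eq_bigr do rewrite -mulrA.
  rewrite -big_distrr /= (Gamma_tau pA pQ pA pQ GM) [leRHS]mulrAC.
  (* Since k is even, [ctau A Q M ^+ k] is nonnegative and the bound on the carre du champ can be
     multiplied by it. *)
  by rewrite ler_wpM2l ?gam_le // mulr_ge0 // exprn_even_ge0.
Qed.

End moments.

(** * Concentration and the Stein identity *)

Section truncations.
Context (R : realType) (n : nat).
Local Notation C := R[i].
Local Notation Re := (@complex.Re R).
Local Notation pid p := (pid_mx p : 'M[C]_n).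

Lemma trmx_pid p : (pid p)^T = pid p.
Proof. by rewrite tr_pid_mx. Qed.

Lemma adj_pid p : adj (pid p) = pid p.
Proof. by rewrite /adj map_pid_mx trmx_pid. Qed.

Lemma pid_pid p q : (p <= n)%N -> pid p *m pid q = pid (minn p q).
Proof.
move=> pn; rewrite mul_pid_mx; apply: f_equal.
by apply/minn_idPr; exact: leq_trans (geq_minl p q) pn.
Qed.

Lemma bsproj_pid p : (p <= n)%N -> bsproj (pid p).
Proof.
by move=> pn; split; [split; [rewrite pid_pid // minnn | exact: adj_pid] | exact: trmx_pid].
Qed.

Lemma bsproj_pidB p q : (p <= q <= n)%N -> bsproj (pid q - pid p).
Proof.
move=> /andP[pq qn]; have pn := leq_trans pq qn; split; first split.
- rewrite mulmxBl !mulmxBr !pid_pid // !minnn (minn_idPl pq) (minn_idPr pq).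
  by rewrite subrr subr0.
- by rewrite adjD adjN !adj_pid.
- by rewrite raddfB /= !trmx_pid.
Qed.

Lemma tr_pid p : (p <= n)%N -> \tr (pid p) = p%:R.
Proof.
move=> pn; rewrite /mxtrace.
transitivity (\sum_(i < n | (i < p)%N) (1 : C)).
  by rewrite [RHS]big_mkcond; apply: eq_bigr => i _; rewrite mxE eqxx /=; case: ifP.
by rewrite (big_ord_narrow pn) sumr_const card_ord.
Qed.

Lemma pid_mulE p q (X : 'M[C]_(n, q)) i j :
  (pid_mx p *m X) i j = ((i < p)%N)%:R * X i j.
Proof.
rewrite mxE (bigD1 i) //= big1 ?addr0; last first.
  by move=> k /negPf ki; rewrite mxE eq_sym (inj_eq val_inj) ki mul0r.
by rewrite mxE eqxx.
Qed.

Lemma Tpq_tau p q (M : cmatrix R n) : Tpq p q M = tau (pid p) (pid q) M.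
Proof.
rewrite /tau Re_sum /Tpq big_mkcond; apply: eq_bigr => i _.
rewrite pid_mulE; case: ifP => _; last by rewrite mul0r.
rewrite mul1r /Sq -mulmxA mxE Re_sum big_mkcond; apply: eq_bigr => j _.
rewrite pid_mulE adjE; case: ifP => _; last by rewrite mul0r mulr0.
by rewrite mul1r ReMJ.
Qed.

Lemma tauBl (A B Q : 'M[C]_n) M : tau (A - B) Q M = tau A Q M - tau B Q M.
Proof. by rewrite /tau mulmxBl raddfB ReB. Qed.

Lemma tauBr (A Q Q' : 'M[C]_n) M : tau A (Q - Q') M = tau A Q M - tau A Q' M.
Proof. by rewrite /tau /Sq mulmxBr mulmxBl mulmxBr raddfB ReB. Qed.

End truncations.

Section trace_bound.
Context (R : realType) (n : nat).
Local Notation C := R[i].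
Local Notation Re := (@complex.Re R).
Implicit Types X Y : 'M[C]_n.

(** Trace norm at most [b], by duality with the operator norm. *)
Definition trb X (b : R) := forall Y, contr Y -> `|Re (\tr (Y *m X))| <= b.

Lemma trb_contr X : contr X -> trb X n%:R.
Proof. by move=> cX Y cY; apply: contr_tr; exact: contrM. Qed.

Lemma trbD X Y a b : trb X a -> trb Y b -> trb (X + Y) (a + b).
Proof.
move=> hX hY Z cZ; rewrite mulmxDr raddfD ReD.
by rewrite (le_trans (ler_normD _ _)) // lerD ?hX ?hY.
Qed.

Lemma trbN X a : trb X a -> trb (- X) a.
Proof. by move=> hX Z cZ; rewrite mulmxN raddfN ReN normrN hX. Qed.

Lemma trb_mul X Y a : contr X -> trb Y a -> trb (X *m Y) a.
Proof. by move=> cX hY Z cZ; rewrite mulmxA; apply: hY; exact: contrM. Qed.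

Lemma trb_tr X a : trb X a -> `|Re (\tr X)| <= a.
Proof.
move=> /(_ 1%:M); rewrite mul1mx; apply.
by move=> v; rewrite mul1mx.
Qed.

End trace_bound.

Section cross_traces.
Context (R : realType) (beta n : nat) (hbeta : beta = 1%N \/ beta = 2%N).
Context (n_gt0 : (0 < n)%N).
Local Notation C := R[i].
Local Notation G := (@haar_group R beta n).
Local Notation cmx := (cmatrix R n).
Local Notation Re := (@complex.Re R).
Local Notation Im := (@complex.Im R).
Local Notation gen := (@gen R beta n).
Context (P : probability cmx R) (HP : haar_prob beta P).
Local Notation E F := (Rintegral P G F).
Local Notation gflow := (gflow HP).
Local Notation c := ((2 - beta)%:R : C).

Let mG : measurable G := @measurable_haar_group R beta n.
Let PG : P G = 1%E := HP.1.

Definition zeta (A Q A' Q' : 'M[C]_n) (M : cmx) : C :=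
  \tr (A *m Sq Q M *m (A' *m Sq Q' M)).

Definition dzeta t (A Q A' Q' : 'M[C]_n) (M : cmx) : C :=
  \tr (A *m comm (gen t) (Sq Q M) *m (A' *m Sq Q' M) +
       A *m Sq Q M *m (A' *m comm (gen t) (Sq Q' M))).

Definition ddzeta t (A Q A' Q' : 'M[C]_n) (M : cmx) : C :=
  \tr (A *m comm (gen t) (comm (gen t) (Sq Q M)) *m (A' *m Sq Q' M) +
       A *m comm (gen t) (Sq Q M) *m (A' *m comm (gen t) (Sq Q' M)) +
       (A *m comm (gen t) (Sq Q M) *m (A' *m comm (gen t) (Sq Q' M)) +
       A *m Sq Q M *m (A' *m comm (gen t) (comm (gen t) (Sq Q' M))))).

Lemma mderD_group t (f f' g g' : cmx -> 'M[C]_n) :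
  mder G (gflow t) f f' -> mder G (gflow t) g g' ->
  mder G (gflow t) (fun M => f M + g M) (fun M => f' M + g' M).
Proof.
move=> df dg i j; apply: (cder_eq _ _ (cderD (df i j) (dg i j))) => M; by rewrite !mxE.
Qed.

Lemma cder_dzeta t A Q A' Q' : cder G (gflow t) (dzeta t A Q A' Q') (ddzeta t A Q A' Q').
Proof.
have d0 B S := mder_cmull B (mder_Sq HP t S).
have d1 B S := mder_cmull B (mder_comm (mder_Sq HP t S)).
have f0 M := gflow0 HP t (M := M).
apply: cder_tr; apply: mderD_group; apply: mderM => //.
Qed.

Lemma mbmD (f g : cmx -> 'M[C]_n) : mbm beta f -> mbm beta g -> mbm beta (fun M => f M + g M).
Proof.
by move=> bf bg i j; under eq_fun do rewrite mxE; exact: cbmD.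
Qed.

Lemma cbm_zetas t A Q A' Q' : [/\ cbm G (zeta A Q A' Q'), cbm G (dzeta t A Q A' Q') &
  cbm G (ddzeta t A Q A' Q')].
Proof.
have b0 B S : mbm beta (fun M => B *m Sq S M) by apply: mbmM; [exact: mbm_cst|exact: mbm_Sq].
have b1 B S : mbm beta (fun M => B *m comm (gen t) (Sq S M)).
  by apply: mbmM; [exact: mbm_cst|apply: mbm_comm; exact: mbm_Sq].
have b2 B S : mbm beta (fun M => B *m comm (gen t) (comm (gen t) (Sq S M))).
  by apply: mbmM; [exact: mbm_cst|do 2 apply: mbm_comm; exact: mbm_Sq].
split; apply: cbm_tr; first exact: mbmM.
  by apply: mbmD; exact: mbmM.
by do 2 apply: mbmD; apply: mbmM.
Qed.

(** The gradient of [zeta], read off by cyclicity: [dzeta] becomes a pairing with [gen t], and the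
    sum over generators can be contracted. *)
Definition grad_zeta (A Q A' Q' : 'M[C]_n) (M : cmx) : 'M[C]_n :=
  comm (Sq Q M) (A' *m Sq Q' M *m A) + comm (Sq Q' M) (A *m Sq Q M *m A').

Lemma dzetaE t A Q A' Q' M : dzeta t A Q A' Q' M = \tr (gen t *m grad_zeta A Q A' Q' M).
Proof.
rewrite /dzeta /grad_zeta [in RHS]mulmxDr 2!mxtraceD; apply: f_equal2.
  transitivity (\tr ((A' *m Sq Q' M *m A) *m comm (gen t) (Sq Q M))).
    by rewrite mxtrace_mulC !mulmxA.
  exact: tr_comm_gen.
transitivity (\tr ((A *m Sq Q M *m A') *m comm (gen t) (Sq Q' M))).
  by rewrite !mulmxA.
exact: tr_comm_gen.
Qed.

(** 32 = 4 * 2 * 4: the constant of [sum_Gamma], the two terms of the commutator of S0 and A0, and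
    the four products of contractions in the gradient, each of trace norm at most n. *)
Lemma dtau_dzeta_bound A0 Q0 A Q A' Q' M : bsproj A0 -> bsproj Q0 ->
  bsproj A -> bsproj Q -> bsproj A' -> bsproj Q' -> G M ->
  `|\sum_t dtau (beta := beta) t A0 Q0 M * Re (dzeta t A Q A' Q' M)| <= 32 * n%:R.
Proof.
move=> pA0 pQ0 pA pQ pA' pQ' GM.
under eq_bigr do rewrite dtau_gen dzetaE.
have hS0 := hproj_Sq pQ0.1 GM.
rewrite (sum_Gamma hbeta); last 2 first.
- by apply: adj_comm; [exact: hS0.2 | exact: pA0.1.2].
- by apply: bsym_comm; [exact: (bsym_Sq hbeta pQ0.2 GM) | exact: pA0.2].
have cS (B : 'M[C]_n) : bsproj B -> contr (Sq B M).
  by move=> pB; apply: hproj_contr; exact: hproj_Sq pB.1 GM.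
have cA (B : 'M[C]_n) : bsproj B -> contr B by move=> pB; apply: hproj_contr; exact: pB.1.
have := (cS _ pQ0, cS _ pQ, cS _ pQ', cA _ pA0, cA _ pA, cA _ pA').
rewrite /grad_zeta; move: (Sq Q0 M) (Sq Q M) (Sq Q' M) => S0 S S' [[[[[c0 c1] c2] c3] c4] c5].
have tN : trb (comm S (A' *m S' *m A) + comm S' (A *m S *m A'))
    (n%:R + n%:R + (n%:R + n%:R)).
  have c6 : contr (A' *m S' *m A) by apply: contrM => //; exact: contrM.
  have c7 : contr (A *m S *m A') by apply: contrM => //; exact: contrM.
  by apply: trbD; (apply: trbD; [|apply: trbN]); apply: trb_contr; apply: contrM.
have tX : trb (comm S0 A0 *m (comm S (A' *m S' *m A) + comm S' (A *m S *m A')))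
    (n%:R + n%:R + (n%:R + n%:R) + (n%:R + n%:R + (n%:R + n%:R))).
  move: tN; move: (_ + comm S' _) => N tN.
  have c8 : contr (S0 *m A0) by exact: contrM.
  have c9 : contr (A0 *m S0) by exact: contrM.
  by rewrite /comm mulmxBl; apply: trbD; [|apply: trbN]; apply: trb_mul.
rewrite normrM (_ : `|- 4| = 4 :> R); last by rewrite normrN ger0_norm.
have := trb_tr tX; move: `|_| => x hx; lra.
Qed.

End cross_traces.

(** Every product of projections and every trace is a variable tied by a hypothesis, so that what
    remains is scalar algebra on top of [comm2_sum] and [cross_sum]. The cross term enters twice, as
    in [ddzeta]. *)
Lemma second_variation_sum (K : comNzRingType) (n : nat) (I : finType)
    (gen : I -> 'M[K]_n) (c b : K) (P S P' S' P2 S2 : 'M[K]_n)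
    (z s s' r r' a1 a2 a3 a5 a6 a7 a8 a9 a10 : K) :
  (forall X, \sum_t gen t *m X *m gen t = (2 * c) *: X^T - (2 * b * \tr X)%:M) ->
  P^T = P -> P'^T = P' -> bsym c S -> bsym c S' ->
  P *m P' = P2 -> P' *m P = P2 -> S *m S' = S2 -> S' *m S = S2 ->
  \tr (P *m S *m (P' *m S')) = z -> \tr S = s -> \tr S' = s' -> \tr P = r -> \tr P' = r' ->
  \tr (P2 *m S') = a1 -> \tr (P2 *m S) = a2 -> \tr (P2 *m S2) = a3 ->
  \tr (P' *m S2) = a5 -> \tr (P *m S2) = a6 -> \tr (P' *m S) = a7 ->
  \tr (P *m S') = a8 -> \tr (P *m S) = a9 -> \tr (P' *m S') = a10 ->
  \sum_t \tr (P *m comm (gen t) (comm (gen t) S) *m (P' *m S') +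
       P *m comm (gen t) S *m (P' *m comm (gen t) S') +
       (P *m comm (gen t) S *m (P' *m comm (gen t) S') +
       P *m S *m (P' *m comm (gen t) (comm (gen t) S')))) =
  - (8 * b * n%:R) * z + 4 * b * (s * a1 + s' * a2)
  + 2 * (2 * c * (a3 + a3 - 2 * z) + 2 * b * (r * a5 + r' * a6 - a7 * a8 - a9 * a10)).
Proof.
move=> cE tP tP' bS bS' pp pp' ss ss'.
move=> <- <- <- <- <- <- <- <- <- <- <- <- <- <-.
have cs := cross_sum cE tP tP' bS bS'.
rewrite pp -(mulmxA P2) ss in cs.
have h4 : \tr (P *m S *m S' *m P') = \tr (P2 *m S2).
  by rewrite mxtrace_mulC !mulmxA pp' -mulmxA ss.
have h5 : \tr (S *m P' *m S') = \tr (P' *m S2).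
  by rewrite -mulmxA mxtrace_mulC -mulmxA ss'.
have h6 : \tr (P *m S *m S') = \tr (P *m S2) by rewrite -mulmxA ss.
have h7 : \tr (S *m P') = \tr (P' *m S) by exact: mxtrace_mulC.
have h8 : \tr (P *m S *m P' *m S') = \tr (P *m S *m (P' *m S')) by rewrite !mulmxA.
rewrite h4 h5 h6 h7 h8 in cs; rewrite -cs.
under eq_bigr do rewrite !mxtraceD.
rewrite !big_split /=.
have -> : \sum_t \tr (P *m comm (gen t) (comm (gen t) S) *m (P' *m S')) =
    \tr (P *m (\sum_t comm (gen t) (comm (gen t) S)) *m (P' *m S')).
  by rewrite mulmx_sumr mulmx_suml raddf_sum.
have -> : \sum_t \tr (P *m S *m (P' *m comm (gen t) (comm (gen t) S'))) =
    \tr (P *m S *m (P' *m (\sum_t comm (gen t) (comm (gen t) S')))).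
  by rewrite !mulmx_sumr raddf_sum.
rewrite (comm2_sum cE bS) (comm2_sum cE bS').
rewrite !(mulmxDr, mulmxDl) !mxtraceD.
rewrite !mul_mx_scalar -!scalemxAr -!scalemxAl !mxtraceZ.
have -> : \tr (P *m (P' *m S')) = \tr (P2 *m S') by rewrite mulmxA pp.
have -> : \tr (P *m S *m P') = \tr (P2 *m S) by rewrite mxtrace_mulC mulmxA pp'.
move: (\sum_t _) => x; move: (\tr _) (\tr _) (\tr _) (\tr _) (\tr _) => *; ring.
Qed.

Lemma Re_second_variation (R : realType) (b c n p q p' q' : nat) (z : R[i])
    (x1 x2 x3 x5 x6 x7 x8 x9 x10 : R) :
  complex.Re (- (8 * b%:R * n%:R) * z
    + 4 * b%:R * (q%:R * (x1%:C)%C + q'%:R * (x2%:C)%C)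
    + 2 * (2 * c%:R * ((x3%:C)%C + (x3%:C)%C - 2 * z)
    + 2 * b%:R * (p%:R * (x5%:C)%C + p'%:R * (x6%:C)%C
       - (x7%:C)%C * (x8%:C)%C - (x9%:C)%C * (x10%:C)%C))) =
  - (8 * b%:R * n%:R) * complex.Re z + 4 * b%:R * (q%:R * x1 + q'%:R * x2)
    + 2 * (2 * c%:R * (x3 + x3 - 2 * complex.Re z)
    + 2 * b%:R * (p%:R * x5 + p'%:R * x6 - x7 * x8 - x9 * x10)).
Proof.
have Im_nat k : complex.Im (k%:R : R[i]) = 0.
  by elim: k => // k IHk; rewrite mulrS ImD IHk addr0.
rewrite !(ReD, ReN, ReM, ImD, ImN, ImM, Re_nat, Im_nat) /=.
by move: (complex.Re z) (complex.Im z) => *; ring.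
Qed.

Section zeta_generator.
Context (R : realType) (beta n : nat) (hbeta : beta = 1%N \/ beta = 2%N).
Local Notation C := R[i].
Local Notation G := (@haar_group R beta n).
Local Notation cmx := (cmatrix R n).
Local Notation Re := (@complex.Re R).
Local Notation Im := (@complex.Im R).
Local Notation gen := (@gen R beta n).
Local Notation pid p := (pid_mx p : 'M[C]_n).
Local Notation T p q := (tau (pid p) (pid q)).

Definition Zr p q p' q' (M : cmx) : R := Re (zeta (pid p) (pid q) (pid p') (pid q') M).

Lemma tr_pid_Sq p q M : (p <= n)%N -> (q <= n)%N -> G M ->
  \tr (pid p *m Sq (pid q) M) = (T p q M)%:C%C.
Proof.
move=> pn qn GM; apply: complex_ext => //=.
have [_ aS] := hproj_Sq (bsproj_pid R qn).1 GM.
have := congr1 Im (tr_adj (pid p *m Sq (pid q) M)).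
by rewrite adjM aS adj_pid mxtrace_mulC ImJ => h; lra.
Qed.

(** The terms are of order n^2, except the one with factor 2 - beta, which is of order n and will be
    treated as an error. The products of two T's come from the trace term of [casimir]. *)
Lemma sum_ddzeta p q p' q' M : (p <= n)%N -> (q <= n)%N -> (p' <= n)%N -> (q' <= n)%N ->
  G M ->
  Re (\sum_t ddzeta (beta := beta) t (pid p) (pid q) (pid p') (pid q') M) =
  - (8 * beta%:R * n%:R) * Zr p q p' q' M
  + 8 * (2 - beta)%:R * (T (minn p p') (minn q q') M - Zr p q p' q' M)
  + 4 * beta%:R * (q%:R * T (minn p p') q' M + q'%:R * T (minn p p') q M
     + p%:R * T p' (minn q q') M + p'%:R * T p (minn q q') M
     - T p' q M * T p q' M - T p q M * T p' q' M).
Proof.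
move=> pn qn pn' qn' GM.
have m1 : (minn p p' <= n)%N := leq_trans (geq_minl p p') pn.
have m2 : (minn q q' <= n)%N := leq_trans (geq_minl q q') qn.
have b1 := bsym_Sq hbeta (trmx_pid R n q) GM.
have b2 := bsym_Sq hbeta (trmx_pid R n q') GM.
set z := zeta (pid p) (pid q) (pid p') (pid q') M.
have pp : pid p *m pid p' = pid (minn p p') by exact: pid_pid.
have pp' : pid p' *m pid p = pid (minn p p') by rewrite minnC; exact: pid_pid.
have qq : pid q *m pid q' = pid (minn q q') by exact: pid_pid.
have qq' : pid q' *m pid q = pid (minn q q') by rewrite minnC; exact: pid_pid.
have := second_variation_sum (gen_casimir (R := R) (n := n) hbeta) (trmx_pid R n p)
  (trmx_pid R n p') b1 b2 pp pp' (etrans (SqM _ _ GM) (congr1 (fun X => Sq X M) qq))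
  (etrans (SqM _ _ GM) (congr1 (fun X => Sq X M) qq')) (erefl z)
  (etrans (tr_Sq _ GM) (tr_pid R qn)) (etrans (tr_Sq _ GM) (tr_pid R qn'))
  (tr_pid R pn) (tr_pid R pn') (tr_pid_Sq m1 qn' GM) (tr_pid_Sq m1 qn GM)
  (tr_pid_Sq m1 m2 GM) (tr_pid_Sq pn' m2 GM) (tr_pid_Sq pn m2 GM)
  (tr_pid_Sq pn' qn GM) (tr_pid_Sq pn qn' GM) (tr_pid_Sq pn qn GM) (tr_pid_Sq pn' qn' GM).
move/(congr1 Re); rewrite /Zr -/z => ->; clearbody z.
move: (T _ _ M) (T _ _ M) (T _ _ M) (T _ _ M) (T _ _ M) (T _ _ M) (T _ _ M) (T _ _ M) (T _ _ M) => *.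
by rewrite Re_second_variation; ring.
Qed.

End zeta_generator.

(** The summands on the right are permuted so as to follow the list of index pairs in
    [zeta_concentration]. *)
Lemma ler_norm8 (R : realType) (x1 x2 x3 x4 x5 x6 x7 x8 : R) :
  `|x1 + x2 + x3 + x4 - (x5 + x6) - (x7 + x8)| <=
  `|x1| + (`|x2| + (`|x3| + (`|x4| + (`|x6| + (`|x5| + (`|x8| + `|x7|)))))).
Proof.
rewrite ler_norml.
have no (x : R) : - `|x| <= x <= `|x| by rewrite -ler_norml.
have := (no x1, no x2, no x3, no x4); have := (no x5, no x6, no x7, no x8).
move=> [[[/andP[? ?] /andP[? ?]] /andP[? ?]] /andP[? ?]].
move=> [[[/andP[? ?] /andP[? ?]] /andP[? ?]] /andP[? ?]].
by apply/andP; split; lra.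
Qed.

Section stein_bound.
Context (R : realType) (beta n : nat) (hbeta : beta = 1%N \/ beta = 2%N).
Context (n_gt0 : (0 < n)%N).
Local Notation C := R[i].
Local Notation G := (@haar_group R beta n).
Local Notation cmx := (cmatrix R n).
Local Notation Re := (@complex.Re R).
Local Notation gen := (@gen R beta n).
Local Notation pid p := (pid_mx p : 'M[C]_n).
Local Notation T p q := (tau (pid p) (pid q)).
Context (P : probability cmx R) (HP : haar_prob beta P).
Local Notation E F := (Rintegral P G F).
Local Notation gflow := (gflow HP).

Let mG : measurable G := @measurable_haar_group R beta n.
Let PG : P G = 1%E := HP.1.

Let n0 : n%:R != 0 :> R. Proof. by rewrite pnatr_eq0 -lt0n. Qed.
Let n1 : 1 <= n%:R :> R. Proof. by rewrite ler1n. Qed.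
Let b1 : 1 <= beta%:R :> R. Proof. by rewrite ler1n; case: hbeta => ->. Qed.

Definition mT (p q : nat) : R := p%:R * q%:R / n%:R.

Definition ctrT p q (M : cmx) : R := T p q M - mT p q.

Lemma ctrT_ctau p q M : (p <= n)%N -> (q <= n)%N -> ctrT p q M = ctau (pid p) (pid q) M.
Proof. by move=> pn qn; rewrite /ctau !tr_pid // !Re_nat. Qed.

Lemma bm_ctrT p q : bm G (ctrT p q).
Proof. by apply: bmB; [exact: bm_tau | exact: bm_cst]. Qed.

Lemma moment2 A Q : bsproj A -> bsproj Q ->
  E (fun M => ctau A Q M ^+ 2) <= 2 * Num.min (Re (\tr A)) (Re (\tr Q)) / n%:R.
Proof.
move=> pA pQ; have := moment_step hbeta n_gt0 HP pA pQ (erefl : ~~ odd 0).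
rewrite (_ : (fun M => ctau A Q M ^+ 0) = fun=> 1); last by apply/funext => M; rewrite expr0.
rewrite (Ex_cst mG PG) mulr1 mul1r => /le_trans; apply.
have m0 : 0 <= Num.min (Re (\tr A)) (Re (\tr Q)).
  rewrite le_min; have := hproj_tr_ge0 pA.1 pA.1; rewrite pA.1.1 => ->.
  by have := hproj_tr_ge0 pQ.1 pQ.1; rewrite pQ.1.1 => ->.
have b0 : (0 < beta)%N by case: hbeta => ->.
rewrite ler_pdivrMr ?mulr_gt0 ?ltr0n //.
rewrite (_ : _ / _ * _ = 8 * Num.min (Re (\tr A)) (Re (\tr Q)) * beta%:R); last by field.
by rewrite ler_peMr // mulr_ge0.
Qed.

(** Uniform in n, p and q: T may be as large as n but fluctuates on scale 1. The same bound later
    controls the truncation error in [fidi_cvg]. *)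
Lemma E_norm_ctrT p q : (p <= n)%N -> (q <= n)%N -> E (fun M => `|ctrT p q M|) <= 2.
Proof.
move=> pn qn; have W2 : E (fun M => ctrT p q M ^+ 2) <= 2.
  rewrite (_ : E _ = E (fun M => ctau (pid p) (pid q) M ^+ 2)); last first.
    by apply: Ex_eq => M _; rewrite ctrT_ctau.
  apply: (le_trans (moment2 (bsproj_pid R pn) (bsproj_pid R qn))).
  rewrite !tr_pid // !Re_nat -mulrA ler_piMr // ler_pdivrMr ?ltr0n // mul1r.
  by rewrite ge_min ler_nat pn.
(* |x| is at most (1 + x^2) / 2. *)
apply: (@le_trans _ _ (E (fun M => 2^-1 * (1 + ctrT p q M ^+ 2)))).
  apply: (Ex_le mG PG); first by apply: bm_norm; exact: bm_ctrT.
    by apply: bmZ; apply: bmD; [exact: bm_cst | apply: bmX; exact: bm_ctrT].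
  by move=> M _; have := sqr_ge0 (`|ctrT p q M| - 1); rewrite sqrrB1 real_normK ?num_real //; lra.
rewrite (ExZ mG PG); last by apply: bmD; [exact: bm_cst | apply: bmX; exact: bm_ctrT].
rewrite (ExD mG PG) ?(Ex_cst mG PG); [lra | exact: bm_cst | by apply: bmX; exact: bm_ctrT].
Qed.

Lemma tau_pid_bound p q M : (p <= n)%N -> (q <= n)%N -> G M -> `|T p q M| <= n%:R.
Proof.
move=> pn qn GM; have hS := hproj_Sq (bsproj_pid R qn).1 GM.
have hA := (bsproj_pid R pn).1.
rewrite ger0_norm; last exact: hproj_tr_ge0.
by apply: (le_trans (hproj_tr_le hA hS)); rewrite tr_pid // Re_nat ler_nat.
Qed.

Lemma Zr_bound p q p' q' M : (p <= n)%N -> (q <= n)%N -> (p' <= n)%N -> (q' <= n)%N ->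
  G M -> `|Zr p q p' q' M| <= n%:R.
Proof.
move=> pn qn pn' qn' GM; apply: contr_tr.
have c1 k : (k <= n)%N -> contr (pid k) by move=> kn; apply: hproj_contr; exact: (bsproj_pid R kn).1.
have c2 k : (k <= n)%N -> contr (Sq (pid k) M).
  by move=> kn; apply: hproj_contr; exact: hproj_Sq (bsproj_pid R kn).1 GM.
by move: (c1 _ pn) (c1 _ pn') (c2 _ qn) (c2 _ qn') => *; apply: contrM; exact: contrM.
Qed.

Lemma mT_bound p q : (p <= n)%N -> (q <= n)%N -> `|mT p q| <= n%:R.
Proof.
move=> pn qn; rewrite ger0_norm; last by rewrite !mulr_ge0 // invr_ge0.
by rewrite ler_pdivrMr ?ltr0n // ler_pM // ler_nat.
Qed.

(* The approximate mean of [Zr]: the value at which the Laplacian of [Zr], computed in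
   [sum_ddzeta], vanishes once each T_pq is replaced by its mean. *)
Definition mZ (p q p' q' : nat) : R :=
  (2 * n%:R)^-1 * (q%:R * mT (minn p p') q' + q'%:R * mT (minn p p') q
    + p%:R * mT p' (minn q q') + p'%:R * mT p (minn q q')
    - mT p' q * mT p q' - mT p q * mT p' q').

Context (I : finType) (p q : I -> nat) (th : I -> R).
Hypothesis pn : forall i, (p i <= n)%N.
Hypothesis qn : forall i, (q i <= n)%N.

Definition ctrT_comb (M : cmx) : R := \sum_i th i * ctrT (p i) (q i) M.

Let B : R := \sum_i `|th i|.

Lemma bm_ctrT_comb : bm G ctrT_comb.
Proof. by apply: bm_sum => i _; apply: bmZ; exact: bm_ctrT. Qed.

Definition dctrT_comb t (M : cmx) : R := \sum_i th i * dtau (beta := beta) t (pid (p i)) (pid (q i)) M.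

Lemma bm_dtau t A Q : bm G (dtau (beta := beta) t A Q).
Proof. by have [] := cbm_dtau t A Q. Qed.

Lemma bm_dctrT_comb t : bm G (dctrT_comb t).
Proof. by apply: bm_sum => i _; apply: bmZ; exact: bm_dtau. Qed.

Lemma flow_der_ctrT_comb t : flow_der G (gflow t) ctrT_comb (dctrT_comb t).
Proof.
apply: flow_der_sum => i.
have dW : flow_der G (gflow t) (fun M => T (p i) (q i) M + - mT (p i) (q i))
    (fun M => dtau (beta := beta) t (pid (p i)) (pid (q i)) M + 0).
  by apply: flow_derD; [exact: flow_der_tau | exact: flow_der_cst].
have d := flow_derM (@gflow0 _ _ _ _ _ t) (flow_der_cst (D := G) (gflow t) (th i)) dW.
by apply: (flow_der_eq _ _ d) => M //; rewrite mul0r add0r addr0.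
Qed.

Lemma bm_lip_comp (h h' : R -> R) (F : cmx -> R) :
  (forall y : R, is_derive y 1 h (h' y)) -> (forall y, `|h y| <= 1) -> bm G F ->
  bm G (fun M => h (F M)).
Proof.
move=> dh h1 bF; apply: (bm_continuous (C := 1)) => //; last exact: bF.1.
exact: continuous_is_derive dh.
Qed.

Lemma bm_Zr a b a' b' : bm G (Zr a b a' b').
Proof.
have [] // : cbm G (zeta (pid a) (pid b) (pid a') (pid b')).
have b0 k l : mbm beta (fun M => pid k *m Sq (pid l) M).
  by apply: mbmM; [exact: mbm_cst|exact: mbm_Sq].
by apply: cbm_tr; exact: mbmM.
Qed.

Section test_function.
Context (h h' : R -> R).
Hypothesis dh : forall y : R, is_derive y 1 h (h' y).
Hypothesis ch' : continuous h'.
Hypothesis h1 : forall y, `|h y| <= 1.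
Hypothesis h'1 : forall y, `|h' y| <= 1.

Let bh : bm G (fun M => h (ctrT_comb M)).
Proof. by apply: bm_lip_comp dh _ _ => //; exact: bm_ctrT_comb. Qed.

Let bh' : bm G (fun M => h' (ctrT_comb M)).
Proof. by apply: (bm_continuous (C := 1)) => //; exact: bm_ctrT_comb.1. Qed.

Let dhY t : flow_der G (gflow t) (fun M => h (ctrT_comb M)) (fun M => h' (ctrT_comb M) * dctrT_comb t M).
Proof. by apply: (@flow_der_comp _ _ _ _ (@gflow0 _ _ _ _ _ t)) => //; exact: flow_der_ctrT_comb. Qed.

Lemma norm_weights_ge0 : 0 <= B. Proof. by apply: sumr_ge0. Qed.

(** The Laplacian of [zeta] is of order n^2, but integration by parts moves one derivative to [h]
    and leaves a pairing of gradients, of order n by [dtau_dzeta_bound]. *)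
Lemma Eh_ddzeta a b a' b' : (a <= n)%N -> (b <= n)%N -> (a' <= n)%N -> (b' <= n)%N ->
  `|E (fun M => h (ctrT_comb M) *
     Re (\sum_t ddzeta (beta := beta) t (pid a) (pid b) (pid a') (pid b') M))| <= 32 * B * n%:R.
Proof.
move=> an bn an' bn'.
have cz (t : 'I_beta * 'I_n * 'I_n) := cbm_zetas t (pid a) (pid b) (pid a') (pid b').
have bz t : bm G (fun M => Re (dzeta (beta := beta) t (pid a) (pid b) (pid a') (pid b') M)).
  by have [_ []] := cz t.
have bF' t : bm G (fun M => h' (ctrT_comb M) * dctrT_comb t M) by apply: bmM => //; exact: bm_dctrT_comb.
rewrite (@ibp_sum R beta n P HP (fun M => h (ctrT_comb M)) (fun t M => h' (ctrT_comb M) * dctrT_comb t M)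
  (fun t => dzeta t (pid a) (pid b) (pid a') (pid b'))) //; last 3 first.
- by move=> t; have [] := cz t.
- by move=> t; have [] := cz t.
- by move=> t; exact: cder_dzeta.
rewrite normrN; apply: (Ex_bound mG PG).
  by apply: bm_sum => t _; exact: bmM.
move=> M GM.
have -> : \sum_t h' (ctrT_comb M) * dctrT_comb t M * Re (dzeta t (pid a) (pid b) (pid a') (pid b') M) =
    h' (ctrT_comb M) * \sum_i th i * \sum_t dtau (beta := beta) t (pid (p i)) (pid (q i)) M *
      Re (dzeta t (pid a) (pid b) (pid a') (pid b') M).
  rewrite big_distrr /=; under [RHS]eq_bigr do rewrite !big_distrr /=.
  rewrite [RHS]exchange_big /=; apply: eq_bigr => t _.
  by rewrite -mulrA /dctrT_comb big_distrl big_distrr /=; apply: eq_bigr => i _; rewrite !mulrA.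
rewrite normrM (le_trans (ler_piMl _ (h'1 _))) //.
rewrite (le_trans (ler_norm_sum _ _ _)) // mulrAC mulr_sumr; apply: ler_sum => i _.
rewrite normrM mulrC ler_wpM2r //.
by apply: dtau_dzeta_bound => //; apply: bsproj_pid.
Qed.

(** By [sum_ddzeta], the Laplacian of Z is - 8 beta n (Z - mZ) plus O(n) and terms of size n times
    deviations of T. Against [h] the Laplacian contributes O(n), and the deviations O(n) in mean;
    dividing by 8 beta n leaves O(1), while Z itself is of order n. *)
Lemma zeta_concentration a b a' b' : (a <= n)%N -> (b <= n)%N -> (a' <= n)%N -> (b' <= n)%N ->
  `|E (fun M => h (ctrT_comb M) * (Zr a b a' b' M - mZ a b a' b'))| <= 4 * B + 18.
Proof.
move=> an bn an' bn'.
have m1 : (minn a a' <= n)%N := leq_trans (geq_minl a a') an.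
have m2 : (minn b b' <= n)%N := leq_trans (geq_minl b b') bn.
have bZ : bm G (Zr a b a' b') by exact: bm_Zr.
pose L M := Re (\sum_t ddzeta (beta := beta) t (pid a) (pid b) (pid a') (pid b') M).
have bL : bm G L.
  rewrite /L; under eq_fun do rewrite Re_sum.
  by apply: bm_sum => t _; have [_ _ []] := cbm_zetas t (pid a) (pid b) (pid a') (pid b').
pose s := [:: (minn a a', b'); (minn a a', b); (a', minn b b'); (a, minn b b');
  (a', b); (a, b'); (a, b); (a', b')].
(* 16 n covers the term with factor 2 - beta, where T and Z are at most n. Each of the eight
   deviations has mean modulus at most 2, which makes the 64 beta below. *)
pose U M := 16 * n%:R + 4 * beta%:R * n%:R * \sum_(x <- s) `|ctrT x.1 x.2 M|.
have bU' : bm G (fun M => \sum_(x <- s) `|ctrT x.1 x.2 M|).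
  by apply: bm_sum => x _; apply: bm_norm; exact: bm_ctrT.
have bU : bm G U by apply: bmD; [exact: bm_cst | apply: bmZ].
have EU : E U <= (16 + 64 * beta%:R) * n%:R.
  have -> : E U = 16 * n%:R + 4 * beta%:R * n%:R * \sum_(x <- s) E (fun M => `|ctrT x.1 x.2 M|).
    have bW (x : nat * nat) : bm G (fun M => `|ctrT x.1 x.2 M|) by apply: bm_norm; exact: bm_ctrT.
    rewrite -(Ex_sum mG PG) // -(ExZ mG PG) // -[X in X + _](Ex_cst mG PG) -(ExD mG PG) //.
      exact: bm_cst.
    exact: bmZ.
  rewrite !big_cons big_nil addr0 /=.
  have e1 := E_norm_ctrT m1 bn'; have e2 := E_norm_ctrT m1 bn; have e3 := E_norm_ctrT an' m2.
  have e4 := E_norm_ctrT an m2; have e5 := E_norm_ctrT an' bn; have e6 := E_norm_ctrT an bn'.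
  have e7 := E_norm_ctrT an bn; have e8 := E_norm_ctrT an' bn'.
  rewrite (mulrDl 16) lerD2l (_ : 64 * _ * _ = 4 * beta%:R * n%:R * 16); last by ring.
  by rewrite ler_wpM2l ?mulr_ge0 //; lra.
pose F1 M := h (ctrT_comb M) * (Zr a b a' b' M - mZ a b a' b').
have bF1 : bm G F1 by apply: bmM => //; apply: bmB => //; exact: bm_cst.
have bF2 : bm G (fun M => h (ctrT_comb M) * L M) by exact: bmM.
have := Eh_ddzeta an bn an' bn'; rewrite -/(L _) => EF2.
have key : `|E (fun M => 8 * beta%:R * n%:R * F1 M + h (ctrT_comb M) * L M)| <= E U.
  have bK : bm G (fun M => 8 * beta%:R * n%:R * F1 M + h (ctrT_comb M) * L M).
    by apply: bmD => //; exact: bmZ.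
  apply: (le_trans (Ex_norm mG PG bK)); apply: (Ex_le mG PG) => //; first exact: bm_norm.
  move=> M GM; rewrite /F1 /L (sum_ddzeta hbeta) //.
  have t1 := tau_pid_bound an' bn GM; have t2 := tau_pid_bound an bn GM.
  have t3 := tau_pid_bound m1 m2 GM; have z1 := Zr_bound an bn an' bn' GM.
  have u1 := mT_bound an bn'; have u2 := mT_bound an' bn'.
  have WE k l : T k l M = ctrT k l M + mT k l by rewrite /ctrT subrK.
  set X := (X in `|X|).
  (* Products are linearised by T T' - m m' = T (T' - m') + m' (T - m), where T and m' are at most
     n. *)
  have -> : X = h (ctrT_comb M) * (8 * (2 - beta)%:R * (T (minn a a') (minn b b') M - Zr a b a' b' M)
     + 4 * beta%:R * (b%:R * ctrT (minn a a') b' M + b'%:R * ctrT (minn a a') b M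
     + a%:R * ctrT a' (minn b b') M + a'%:R * ctrT a (minn b b') M
     - (T a' b M * ctrT a b' M + mT a b' * ctrT a' b M)
     - (T a b M * ctrT a' b' M + mT a' b' * ctrT a b M))).
    rewrite /X /mZ !WE; set cc : R := (2 - beta)%:R.
    move: (h _) (Zr _ _ _ _ _) (ctrT _ _ _) (ctrT _ _ _) (ctrT _ _ _) (ctrT _ _ _) (ctrT _ _ _) (ctrT _ _ _) => *.
    by field.
  rewrite normrM (le_trans (ler_piMl _ (h1 _))) // /U !big_cons big_nil addr0 /=.
  rewrite (le_trans (ler_normD _ _)) // lerD //.
    rewrite normrM ger0_norm ?mulr_ge0 // (_ : 16 * n%:R = 8 * (n%:R + n%:R)); last by ring.
    have c1 : (2 - beta)%:R <= 1 :> R by rewrite lern1; case: hbeta => ->.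
    rewrite -mulrA ler_wpM2l // -[leRHS]mul1r ler_pM //.
    by rewrite (le_trans (ler_normB _ _)) // lerD.
  rewrite normrM ger0_norm ?mulr_ge0 // -(mulrA (4 * beta%:R)) ler_wpM2l ?mulr_ge0 //.
  have nk k x : (k <= n)%N -> `|k%:R * x| <= n%:R * `|x| :> R.
    by move=> kn; rewrite normrM ler_wpM2r // ger0_norm // ler_nat.
  have nx (y x : R) : `|y| <= n%:R -> `|y * x| <= n%:R * `|x|.
    by move=> yn; rewrite normrM ler_wpM2r.
  apply: (le_trans (ler_norm8 _ _ _ _ _ _ _ _)).
  rewrite !(mulrDr n%:R).
  apply: lerD; first exact: nk bn.
  apply: lerD; first exact: nk bn'.
  apply: lerD; first exact: nk an.
  apply: lerD; first exact: nk an'.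
  by do 3 (apply: lerD; first by apply: nx); apply: nx.
have := le_trans key EU.
rewrite (ExD mG PG) ?(ExZ mG PG) //; last exact: bmZ.
move=> K1.
have K2 : `|8 * beta%:R * n%:R * E F1| <= (16 + 64 * beta%:R) * n%:R + 32 * B * n%:R.
  rewrite -[X in `|X|](addrK (E (fun M => h (ctrT_comb M) * L M))).
  by rewrite (le_trans (ler_normB _ _)) // lerD.
have n2 : 0 < n%:R :> R by rewrite ltr0n.
rewrite normrM gtr0_norm in K2; last by rewrite !mulr_gt0 // (lt_le_trans _ b1).
rewrite -(ler_pM2l (_ : 0 < 8 * beta%:R * n%:R)); last by rewrite !mulr_gt0 // (lt_le_trans _ b1).
apply: (le_trans K2).
rewrite -mulrDl (mulrAC _ n%:R) ler_pM2r //.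
have := norm_weights_ge0; have := b1; nra.
Qed.

End test_function.

End stein_bound.

Section stein_identity.
Context (R : realType) (beta n : nat) (hbeta : beta = 1%N \/ beta = 2%N).
Context (n_gt0 : (0 < n)%N).
Local Notation C := R[i].
Local Notation G := (@haar_group R beta n).
Local Notation cmx := (cmatrix R n).
Local Notation Re := (@complex.Re R).
Local Notation gen := (@gen R beta n).
Local Notation pid p := (pid_mx p : 'M[C]_n).
Local Notation T p q := (tau (pid p) (pid q)).
Context (P : probability cmx R) (HP : haar_prob beta P).
Local Notation E F := (Rintegral P G F).
Local Notation gflow := (gflow HP).
Local Notation mT := (mT R n).
Local Notation mZ := (mZ R n).

Let mG : measurable G := @measurable_haar_group R beta n.
Let PG : P G = 1%E := HP.1.

Let n0 : n%:R != 0 :> R. Proof. by rewrite pnatr_eq0 -lt0n. Qed.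
Let n1 : 1 <= n%:R :> R. Proof. by rewrite ler1n. Qed.
Let b1 : 1 <= beta%:R :> R. Proof. by rewrite ler1n; case: hbeta => ->. Qed.

Context (I : finType) (p q : I -> nat) (th : I -> R).
Hypothesis pn : forall i, (p i <= n)%N.
Hypothesis qn : forall i, (q i <= n)%N.
Local Notation Y := (ctrT_comb (R := R) (n := n) p q th).
Local Notation dY := (dctrT_comb (R := R) (n := n) (beta := beta) p q th).
Let B : R := \sum_i `|th i|.

Lemma gam_pid a b a' b' M : (a <= n)%N -> (b <= n)%N -> (a' <= n)%N -> (b' <= n)%N ->
  G M -> gam (pid a) (pid b) (pid a') (pid b') M =
  8 * (T (minn a a') (minn b b') M - Zr a b a' b' M).
Proof.
move=> an bn an' bn' GM.
have trE (X X' X2 S S' S2 : 'M[C]_n) :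
    X *m X' = X2 -> S *m S' = S2 -> \tr (X *m X' *m S *m S') = \tr (X2 *m S2).
  by move=> <- <-; rewrite mulmxA.
have pp : pid a *m pid a' = pid (minn a a') by exact: pid_pid.
have pp' : pid a' *m pid a = pid (minn a a') by rewrite minnC; exact: pid_pid.
have qq : pid b *m pid b' = pid (minn b b') by exact: pid_pid.
have qq' : pid b' *m pid b = pid (minn b b') by rewrite minnC; exact: pid_pid.
have e1 := trE _ _ _ _ _ _ pp (etrans (SqM _ _ GM) (congr1 (fun X => Sq X M) qq')).
have e2 := trE _ _ _ _ _ _ pp' (etrans (SqM _ _ GM) (congr1 (fun X => Sq X M) qq)).
have e3 : \tr (pid a *m Sq (pid b) M *m pid a' *m Sq (pid b') M) =
    zeta (pid a) (pid b) (pid a') (pid b') M by rewrite /zeta !mulmxA.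
have h (x1 x2 x3 y1 y3 : C) : x1 = y1 -> x2 = y1 -> x3 = y3 ->
    4 * (Re x1 + Re x2 - 2 * Re x3) = 8 * (Re y1 - Re y3).
  by move=> -> -> ->; move: (Re _) (Re _) => *; ring.
exact: h e1 e2 e3.
Qed.

Lemma bm_gam A Q A' Q' : bm G (gam (n := n) A Q A' Q').
Proof.
have m1 X : mbm beta (fun=> X : 'M[C]_n) by exact: mbm_cst.
have m2 X : mbm beta (Sq X) by exact: mbm_Sq.
have c1 (f : cmx -> 'M[C]_n) : mbm beta f -> bm G (fun M => Re (\tr (f M))).
  by move=> /cbm_tr[].
apply: bmZ; apply: bmB; last apply: bmZ; try apply: bmD; apply: c1;
  by do 3 (apply: mbmM => //).
Qed.

(** The carre du champ 8 (T - Z) divided by 8 n, with T and Z replaced by [mT] and [mZ]. The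
    remaining 8 n / (4 beta n) is the factor 2 / beta of the limit. *)
Definition stein_var : R := \sum_i \sum_j th i * th j *
  ((mT (minn (p j) (p i)) (minn (q j) (q i)) - mZ (p j) (q j) (p i) (q i)) / n%:R).

(** Integration by parts against each coordinate, then replacement of the random carre du champ by
    its centre. Per pair of indices, [E_norm_ctrT] costs 2 and [zeta_concentration] costs 4 B + 18;
    the eigenvalue 4 beta n in the denominator makes the error O(1 / n). *)
Lemma stein_identity_approx (g g' g'' : R -> R) :
  (forall y : R, is_derive y 1 g (g' y)) -> (forall y : R, is_derive y 1 g' (g'' y)) ->
  continuous g'' -> (forall y, `|g y| <= 1) -> (forall y, `|g' y| <= 1) ->
  (forall y, `|g'' y| <= 1) ->
  `|E (fun M => g (Y M) * Y M) - 2 / beta%:R * stein_var * E (fun M => g' (Y M))| <=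
  2 * (4 * B + 20) * B ^+ 2 / n%:R.
Proof.
move=> dg dg' cg'' g1 g'1 g''1.
have bg : bm G (fun M => g (Y M)) by apply: bm_lip_comp dg _ _ => //; exact: bm_ctrT_comb.
have bg' : bm G (fun M => g' (Y M)) by apply: bm_lip_comp dg' _ _ => //; exact: bm_ctrT_comb.
have b0 : 0 < beta%:R :> R by exact: lt_le_trans b1.
have nn0 : 0 < n%:R :> R by exact: lt_le_trans n1.
pose lam : R := 4 * beta%:R * n%:R.
have lam0 : 0 < lam by rewrite /lam !mulr_gt0.
pose gm i j := gam (pid (p j)) (pid (q j)) (pid (p i)) (pid (q i)).
have bgm i j : bm G (gm i j) by exact: bm_gam.
have bg'm i j : bm G (fun M => g' (Y M) * gm i j M) by exact: bmM.
have bdYt t : bm G (dY t) by exact: bm_dctrT_comb.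
have E1 i : lam * E (fun M => g (Y M) * ctrT (p i) (q i) M) =
    \sum_j th j * E (fun M => g' (Y M) * gm i j M).
  have pA := bsproj_pid R (pn i); have pQ := bsproj_pid R (qn i).
  have -> : E (fun M => g (Y M) * ctrT (p i) (q i) M) = E (fun M => g (Y M) *
      (tau (pid (p i)) (pid (q i)) M
       - Re (\tr (pid (p i))) * Re (\tr (pid (q i))) / n%:R)).
    by apply: Ex_eq => M _; rewrite ctrT_ctau.
  rewrite (@ibp_tau R beta n hbeta P HP _ _ (fun M => g (Y M))
    (fun t M => g' (Y M) * dY t M) pA pQ n_gt0 bg); last 2 first.
  - by move=> t; exact: bmM.
  - by move=> t; apply: (@flow_der_comp _ _ _ _ (@gflow0 _ _ _ _ _ t)) => //; exact: flow_der_ctrT_comb.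
  under eq_bigr do rewrite -(ExZ mG PG) //.
  rewrite -(Ex_sum mG PG); last by move=> j; exact: bmZ.
  apply: Ex_eq => M GM.
  transitivity (\sum_j th j * (g' (Y M) * \sum_t dtau (beta := beta) t (pid (p j)) (pid (q j)) M *
      dtau t (pid (p i)) (pid (q i)) M)).
    under [RHS]eq_bigr do rewrite !big_distrr /=.
    rewrite [RHS]exchange_big /=; apply: eq_bigr => t _.
    rewrite /dctrT_comb -mulrA big_distrl big_distrr /=; apply: eq_bigr => j _.
    by move: (g' _) (dtau _ _ _ _) (dtau _ _ _ _) => *; ring.
  apply: eq_bigr => j _; apply: f_equal; apply: f_equal.
  by apply: Gamma_tau => //; apply: bsproj_pid.
have E2 i j : `|E (fun M => g' (Y M) * gm i j M) -
    8 * (mT (minn (p j) (p i)) (minn (q j) (q i)) - mZ (p j) (q j) (p i) (q i)) *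
    E (fun M => g' (Y M))| <= 8 * (4 * B + 20).
  have m1 : (minn (p j) (p i) <= n)%N := leq_trans (geq_minl _ _) (pn j).
  have m2 : (minn (q j) (q i) <= n)%N := leq_trans (geq_minl _ _) (qn j).
  set pp := minn _ _ in m1 *; set qq := minn _ _ in m2 *.
  pose F1 M := g' (Y M) * ctrT pp qq M.
  pose F2 M := g' (Y M) * (Zr (p j) (q j) (p i) (q i) M - mZ (p j) (q j) (p i) (q i)).
  have bF1 : bm G F1 by apply: bmM => //; exact: bm_ctrT.
  have bF2 : bm G F2 by apply: bmM => //; apply: bmB; [exact: bm_Zr | exact: bm_cst].
  have -> : E (fun M => g' (Y M) * gm i j M) = 8 * (E F1 - E F2) +
     8 * (mT pp qq - mZ (p j) (q j) (p i) (q i)) * E (fun M => g' (Y M)).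
    rewrite -(ExB mG PG) // -!(ExZ mG PG) //; last exact: bmB.
    rewrite -(ExD mG PG) //; [|by apply: bmZ; exact: bmB|exact: bmZ].
    apply: Ex_eq => M GM; rewrite /gm gam_pid // /F1 /F2 /ctrT.
    by move: (g' _) (tau _ _ M) (Zr _ _ _ _ M) => *; ring.
  rewrite addrK normrM ger0_norm // ler_wpM2l // (le_trans (ler_normB _ _)) //.
  rewrite (_ : 4 * B + 20 = 2 + (4 * B + 18)); last by ring.
  apply: lerD; last first.
    exact: (zeta_concentration hbeta n_gt0 HP th pn qn dg' cg'' g'1 g''1).
  apply: (le_trans (Ex_norm mG PG bF1)); apply: le_trans (E_norm_ctrT hbeta n_gt0 HP m1 m2).
  apply: (Ex_le mG PG); [exact: bm_norm | by apply: bm_norm; exact: bm_ctrT |].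
  by move=> M _; rewrite normrM ler_piMl.
have E3 : lam * E (fun M => g (Y M) * Y M) =
    \sum_i \sum_j th i * th j * E (fun M => g' (Y M) * gm i j M).
  have bgW i : bm G (fun M => g (Y M) * ctrT (p i) (q i) M) by apply: bmM => //; exact: bm_ctrT.
  have -> : E (fun M => g (Y M) * Y M) = \sum_i th i * E (fun M => g (Y M) * ctrT (p i) (q i) M).
    under [RHS]eq_bigr do rewrite -(ExZ mG PG) //.
    rewrite -(Ex_sum mG PG); last by move=> i; exact: bmZ.
    apply: Ex_eq => M _; rewrite {2}/ctrT_comb big_distrr /=; apply: eq_bigr => i _.
    by rewrite mulrCA.
  rewrite big_distrr /=; apply: eq_bigr => i _.
  by rewrite mulrCA E1 big_distrr /=; apply: eq_bigr => j _; rewrite mulrA.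
have E4 : lam * (2 / beta%:R * stein_var * E (fun M => g' (Y M))) =
    \sum_i \sum_j th i * th j *
    (8 * (mT (minn (p j) (p i)) (minn (q j) (q i)) - mZ (p j) (q j) (p i) (q i)) *
    E (fun M => g' (Y M))).
  have -> : lam * (2 / beta%:R * stein_var * E (fun M => g' (Y M))) =
      (8 * n%:R * E (fun M => g' (Y M))) * stein_var.
    by rewrite /lam; have := gt_eqF b0; move: (E _) stein_var => x v /negbT bn0; field.
  rewrite /stein_var big_distrr /=; apply: eq_bigr => i _; rewrite big_distrr /=; apply: eq_bigr => j _.
  by move: (E _) (mT _ _) (mZ _ _ _ _) => *; field.
rewrite -(ler_pM2l lam0) -[X in X * `|_|](gtr0_norm lam0) -normrM mulrBr E3 E4.
rewrite -sumrB (le_trans (ler_norm_sum _ _ _)) //.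
apply: (@le_trans _ _ (\sum_i \sum_j `|th i| * `|th j| * (8 * (4 * B + 20)))).
  apply: ler_sum => i _; rewrite -sumrB (le_trans (ler_norm_sum _ _ _)) //.
  by apply: ler_sum => j _; rewrite -mulrBr !normrM ler_wpM2l ?mulr_ge0 // E2.
have sumB (k : R) : \sum_i \sum_j `|th i| * `|th j| * k = B ^+ 2 * k.
  rewrite expr2 {1}/B -[RHS]mulrA big_distrl; apply: eq_bigr => i _ /=.
  by rewrite /B big_distrl big_distrr /=; apply: eq_bigr => j _; rewrite !mulrA.
rewrite sumB.
have B0 : 0 <= B by apply: sumr_ge0.
rewrite (_ : lam * _ = B ^+ 2 * (8 * (4 * B + 20)) * beta%:R); last by rewrite /lam; field.
by rewrite ler_peMr // !mulr_ge0 ?exprn_ge0 // addr_ge0 // mulr_ge0.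
Qed.

End stein_identity.

(** * Characteristic functions *)

(** The integrating factor exp (v r^2 / 2) reduces this to the mean value theorem. The sign of [v]
    is free, hence the absolute value in the bound. *)
Lemma ode_gauss (R : realType) (phi phi' : R -> R) (v K : R) :
  (forall r : R, is_derive r 1 phi (phi' r)) ->
  (forall r, 0 <= r <= 1 -> `|phi' r + v * r * phi r| <= K) ->
  `|phi 1 - expR (- v / 2) * phi 0| <= expR `|v| * K.
Proof.
move=> dphi hK.
pose u r := expR (v / 2 * r ^+ 2) * phi r.
pose u' r := expR (v / 2 * r ^+ 2) * (phi' r + v * r * phi r).
have du (r : R) : is_derive r 1 u (u' r).
  have d1 : is_derive r 1 (fun x : R => v / 2 * x ^+ 2) (v * r).
    have d2 : is_derive r 1 (@GRing.exp R ^~ 2%N) (2 * r).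
      apply: DeriveDef; first exact: exprn_derivable.
      by rewrite exp_derive /GRing.scale /= expr1 mulr1.
    apply: (is_derive_eq (is_deriveM (is_derive_cst (v / 2) r 1) d2)).
    by rewrite /GRing.scale /= /cst mulr0 addr0; field.
  have d3 := @is_derive1_comp R expR (fun x => v / 2 * x ^+ 2) r _ _ (is_derive_expR _) d1.
  apply: (is_derive_eq (is_deriveM d3 (dphi r))).
  by rewrite /GRing.scale /= /u' /comp; ring.
have [c /[!in_itv]/= c01 uc] := @MVT_segment R u u' 0 1 ler01 (fun x _ => du x)
  (continuous_subspaceT (continuous_is_derive du)).
have -> : phi 1 - expR (- v / 2) * phi 0 = expR (- v / 2) * (u 1 - u 0).
  rewrite /u expr1n expr0n mulr1 mulr0 expR0 mul1r mulrBr mulrA -expRD.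
  by rewrite mulNr addNr expR0 mul1r.
have K0 : 0 <= K by apply: le_trans (hK 0 _); rewrite // lexx ler01.
rewrite uc subr0 mulr1 /u' mulrA -expRD normrM ger0_norm ?expR_ge0 //.
apply: ler_pM => //; rewrite ?expR_ge0 //; last exact: hK.
rewrite ler_expR; have /andP[c0 c1] := c01.
have c2 : 0 <= 1 - c ^+ 2 <= 1.
  by rewrite expr2; apply/andP; split; nra.
have -> : - v / 2 + v / 2 * c ^+ 2 = (- v) * ((1 - c ^+ 2) / 2) by field.
have nv : - v <= `|v| by rewrite -normrN ler_norm.
apply: (@le_trans _ _ (`|v| * ((1 - c ^+ 2) / 2))).
  by rewrite ler_wpM2r //; lra.
by rewrite ler_piMr //; lra.
Qed.

Section derive_under.
Context d (T : measurableType d) (R : realType) (mu : {measure set T -> \bar R}).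
Context (D : set T) (mD : measurable D) (Y w : T -> R).
Hypothesis mY : measurable_fun D Y.
Hypothesis intw : mu.-integrable D (EFin \o w).
Hypothesis intYw : mu.-integrable D (EFin \o (fun x => Y x * w x)).

Lemma integrable_bounded_weight (f : T -> R) : measurable_fun D f ->
  (forall x, D x -> `|f x| <= 1) -> mu.-integrable D (EFin \o (fun x => f x * w x)).
Proof.
move=> mf f1; apply: (le_integrable mD _ _ intw).
  apply/measurable_EFinP; apply: measurable_funM => //.
  exact/measurable_EFinP/(measurable_int mu).
by move=> x Dx; rewrite /= lee_fin normrM ler_piMl // f1.
Qed.

(** The weight allows two uses: [w] = 1 under the Haar law, and [w] a normal density under Lebesgue
    measure. The derivative is dominated by |Y w| uniformly in r. *)
Lemma is_derive_under (h h' : R -> R) (r : R) :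
  (forall y : R, is_derive y 1 h (h' y)) -> continuous h' ->
  (forall y, `|h y| <= 1) -> (forall y, `|h' y| <= 1) ->
  is_derive r 1 (fun r => \int[mu]_(x in D) (h (r * Y x) * w x))
    (\int[mu]_(x in D) (h' (r * Y x) * (Y x * w x))).
Proof.
move=> dh ch' h1 h'1.
have ch := continuous_is_derive dh.
pose f (s : R) (y : T) := h (s * Y y) * w y.
have df (s : R) y : is_derive s 1 (f ^~ y) (h' (s * Y y) * (Y y * w y)).
  have d1 : is_derive s 1 (fun s : R => s * Y y) (Y y).
    apply: (is_derive_eq (is_deriveM (is_derive_id s (1 : R)) (is_derive_cst (Y y) s 1))).
    by rewrite /GRing.scale /= mulr0 add0r mulr1.
  have d2 := @is_derive1_comp R h (fun s => s * Y y) s _ _ (dh _) d1.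
  apply: (is_derive_eq (is_deriveM d2 (is_derive_cst (w y) s 1))).
  by rewrite /GRing.scale /= mulr0 add0r; ring.
have d1E s y : partial1of2 f s y = h' (s * Y y) * (Y y * w y).
  by rewrite partial1of2E; exact: derive_val.
have mh s : measurable_fun D (fun y => h (s * Y y)).
  apply: (@measurableT_comp _ _ _ _ _ _ h); first exact: continuous_measurable_fun.
  by apply: measurable_funM.
have rI : `]r - 1, r + 1[%classic r by rewrite /= in_itv /=; apply/andP; split; lra.
have fint x : `]r - 1, r + 1[%classic x -> mu.-integrable D (EFin \o f x).
  by move=> _; exact: integrable_bounded_weight.
have fder x y : `]r - 1, r + 1[%classic x -> D y -> derivable (f ^~ y) x 1.
  by move=> _ _; exact: (@ex_derive _ _ _ _ _ _ _ (df x y)).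
have Gub x y : `]r - 1, r + 1[%classic x -> D y -> `|partial1of2 f x y| <= `|Y y * w y|.
  by move=> _ _; rewrite d1E normrM ler_piMl.
have Gint : mu.-integrable D (EFin \o (fun y => `|Y y * w y|)).
  by have := integrable_abse intYw.
have G0 y : 0 <= `|Y y * w y| by [].
apply: DeriveDef.
  exact: (derivable_under_integral mD rI fint fder G0 Gint Gub).
rewrite -derive1E (differentiation_under_integral mD rI fint fder G0 Gint Gub).
by apply: eq_Rintegral => y _; rewrite d1E.
Qed.

End derive_under.

Lemma is_derive_scale_comp (R : realType) (h h' : R -> R) (r : R) :
  (forall y : R, is_derive y 1 h (h' y)) ->
  forall y : R, is_derive y 1 (fun x => h (r * x)) (r * h' (r * y)).
Proof.
move=> dh y.
have d1 : is_derive y 1 (fun s : R => r * s) r.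
  apply: (is_derive_eq (is_deriveM (is_derive_cst r y 1) (is_derive_id y (1 : R)))).
  by rewrite /GRing.scale /= mulr0 addr0 mulr1.
by rewrite mulrC; exact: (@is_derive1_comp R h (fun s => r * s) y _ _ (dh _) d1).
Qed.

Lemma near_natS_ge (R : realType) (x : R) : \forall k \near \oo, x <= k.+1%:R.
Proof.
exists (Num.truncn x) => // k /= xk.
by rewrite (le_trans (ltW (truncnS_gt x))) // ler_nat.
Qed.

(** * The Gaussian characteristic function *)

Section normal_characteristic.
Context (R : realType) (s : R) (s_gt0 : 0 < s).
Local Notation mu := (@lebesgue_measure R).
Local Notation p := (normal_pdf 0 s).

Let s0 : s != 0. Proof. by rewrite gt_eqF. Qed.

Lemma normal_pdf0E x : p x = normal_peak s * expR (- (x ^+ 2 / (s ^+ 2 *+ 2))).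
Proof. by rewrite normal_pdfE // /normal_fun subr0 mulNr. Qed.

Lemma integral_normal_prob (f : R -> R) : measurable_fun setT f ->
  (forall x, `|f x| <= 1) ->
  \int[normal_prob 0 s]_(x in setT) f x = \int[mu]_(x in setT) (f x * p x).
Proof.
move=> mf f1; congr fine.
have finf : (normal_prob 0 s).-integrable setT (EFin \o f).
  apply: bm_integrable => //; first exact: probability_setT.
  by split => //; exists 1 => x _; exact: f1.
rewrite -(Radon_Nikodym_change_of_variables (normal_prob_dominates 0 s) _ finf) //=.
apply: ae_eq_integral => //.
- apply: emeasurable_funM => //; first exact: (measurable_int (normal_prob 0 s)).
  apply: (measurable_int mu).
  by apply: Radon_Nikodym_integrable; exact: normal_prob_dominates.
- under eq_fun do rewrite EFinM.
  apply: emeasurable_funM; first exact: (measurable_int (normal_prob 0 s)).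
  by apply/measurable_EFinP; exact: measurable_normal_pdf.
- under [X in ae_eq _ _ _ X]eq_fun do rewrite EFinM.
  apply: ae_eqe_mul2l => /=.
  rewrite Radon_NikodymE //=; first exact: normal_prob_dominates.
  move=> abmu; case: cid => /= h [h1 h2 h3].
  apply: integral_ae_eq => //=.
  by apply/measurable_EFinP; exact: measurable_normal_pdf.
by move=> E _ mE; rewrite -h3.
Qed.

(** A Gaussian of variance 2 s^2 absorbs the factor x: with z = x^2 / (4 s^2), |x| <= s (1 + z) <= s
    exp z. Integrability of x p then follows from that of a density. *)
Lemma normal_pdf_abs_bound : exists C : R, forall x, `|x * p x| <= C * normal_pdf 0 (s * Num.sqrt 2) x.
Proof.
have t0 : s * Num.sqrt 2 != 0 by rewrite mulf_neq0 // gt_eqF // sqrtr_gt0.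
have k0 := normal_peak_gt0 t0.
exists (normal_peak s * s / normal_peak (s * Num.sqrt 2)) => x.
rewrite normal_pdf0E normal_pdfE // /normal_fun subr0 exprMn sqr_sqrtr //.
rewrite [leRHS]mulrA divfK ?gt_eqF // normrM [X in _ * X]ger0_norm; last first.
  by rewrite mulr_ge0 ?normal_peak_ge0 ?expR_ge0.
rewrite mulrCA -[leRHS]mulrA ler_wpM2l ?normal_peak_ge0 //.
set z := x ^+ 2 / (s ^+ 2 * 4).
have -> : x ^+ 2 / (s ^+ 2 *+ 2) = z + z by rewrite /z -mulr_natr; field.
have -> : - x ^+ 2 / (s ^+ 2 * 2 *+ 2) = - z by rewrite /z -[X in _ / X]mulr_natr; field.
rewrite opprD expRD mulrA ler_wpM2r ?expR_ge0 // expRN ler_pdivrMr ?expR_gt0 //.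
apply: (@le_trans _ _ (s * (1 + z))); last by rewrite ler_wpM2l ?expR_ge1Dx // ltW.
have := sqr_ge0 (2 * s - `|x|); rewrite sqrrB real_normK ?num_real // => h.
have -> : s * (1 + z) = (4 * s ^+ 2 + x ^+ 2) / (4 * s) by rewrite /z; field.
rewrite ler_pdivlMr ?mulr_gt0 //; move: h; rewrite exprMn -mulr_natr; lra.
Qed.

Lemma integrable_normal : mu.-integrable setT (EFin \o p).
Proof. exact: integrable_normal_pdf. Qed.

Lemma integrable_x_normal : mu.-integrable setT (EFin \o (fun x => x * p x)).
Proof.
have [C hC] := normal_pdf_abs_bound.
have intg : mu.-integrable setT (fun x => (C%:E * (normal_pdf 0 (s * Num.sqrt 2) x)%:E)%E).
  by apply: integrableZl => //; exact: integrable_normal_pdf.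
apply: (le_integrable measurableT _ _ intg).
- apply/measurable_EFinP; apply: measurable_funM => //; exact: measurable_normal_pdf.
- by move=> x _; rewrite /= lee_fin (le_trans (hC x)) // ler_norm.
Qed.

(** The same domination bounds (k + 1) times the density at distance k + 1, which therefore decays
    at least like 1 / (k + 1). *)
Lemma normal_pdf_cvg0 (e : R) (eE : e = 1 \/ e = - 1) :
  (fun k => p (e * k.+1%:R)) @ \oo --> (0 : R).
Proof.
have [C hC] := normal_pdf_abs_bound.
pose C' := `|C| * normal_peak (s * Num.sqrt 2).
have t0 : s * Num.sqrt 2 != 0 by rewrite mulf_neq0 // gt_eqF // sqrtr_gt0.
apply: (@squeeze_cvgr _ _ _ _ (fun=> 0) (fun k => C' * k.+1%:R^-1)).
- apply: nearW => k; rewrite normal_pdf_ge0 /= ler_pdivlMr ?ltr0n //.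
  have := hC (e * k.+1%:R); rewrite normrM (ger0_norm (normal_pdf_ge0 _ _ _)).
  have -> : `|e * k.+1%:R| = k.+1%:R.
    by case: eE => ->; rewrite ?mulN1r ?mul1r ?normrN ger0_norm.
  rewrite mulrC => /le_trans; apply.
  rewrite (le_trans (ler_wpM2r (normal_pdf_ge0 _ _ _) (ler_norm C))) //.
  by rewrite ler_wpM2l // normal_pdf_ub.
- exact: cvg_cst.
- rewrite -[X in _ --> X](mulr0 C'); apply: cvgM; first exact: cvg_cst.
  exact: cvg_harmonic.
Qed.

Lemma is_derive_normal_pdf (x : R) : is_derive x 1 p (- (x / s ^+ 2) * p x).
Proof.
have -> : p = (fun x => normal_peak s * expR (- (x ^+ 2 / (s ^+ 2 *+ 2)))).
  by apply/funext => y; rewrite normal_pdf0E.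
have d1 : is_derive x 1 (@GRing.exp R ^~ 2%N) (2 * x).
  apply: DeriveDef; first exact: exprn_derivable.
  by rewrite exp_derive /GRing.scale /= expr1 mulr1.
have d2 : is_derive x 1 (fun x : R => - (x ^+ 2 / (s ^+ 2 *+ 2))) (- (x / s ^+ 2)).
  apply: (is_derive_eq (is_deriveN (is_deriveM d1 (is_derive_cst (s ^+ 2 *+ 2)^-1 x 1)))).
  by rewrite /GRing.scale /= /cst mulr0 add0r -mulr_natr; field.
have d3 := @is_derive1_comp R expR _ x _ _ (is_derive_expR _) d2.
apply: (is_derive_eq (is_deriveM (is_derive_cst (normal_peak s) x 1) d3)).
by rewrite /GRing.scale /= mulr0 addr0; ring.
Qed.

(** The derivative of h (r x) p (x) integrates to boundary terms on [- (k + 1), k + 1], and these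
    vanish as k grows. *)
Lemma normal_stein (h h' : R -> R) (r : R) :
  (forall y : R, is_derive y 1 h (h' y)) -> continuous h' ->
  (forall y, `|h y| <= 1) -> (forall y, `|h' y| <= 1) ->
  \int[mu]_(x in setT) (h (r * x) * (x * p x)) =
  s ^+ 2 * r * \int[mu]_(x in setT) (h' (r * x) * p x).
Proof.
move=> dh ch' h1 h'1.
pose F x := h (r * x) * p x.
pose f1 x := h' (r * x) * p x.
pose f2 x := h (r * x) * (x * p x).
pose f x := r * f1 x - (s ^+ 2)^-1 * f2 x.
have cr : continuous ( *%R r : R -> R) by exact: mulrl_continuous.
have ch := continuous_is_derive dh.
have ch1 : continuous (fun x => h (r * x)).
  by move=> x; apply: (@continuous_comp _ _ _ ( *%R r) h); [exact: cr | exact: ch].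
have ch2 : continuous (fun x => h' (r * x)).
  by move=> x; apply: (@continuous_comp _ _ _ ( *%R r) h'); [exact: cr | exact: ch'].
have mp : measurable_fun setT (id : R -> R) by exact: measurable_id.
have int1 : mu.-integrable setT (EFin \o f1).
  apply: (integrable_bounded_weight measurableT integrable_normal) => //.
  exact: continuous_measurable_fun.
have int2 : mu.-integrable setT (EFin \o f2).
  apply: (integrable_bounded_weight measurableT integrable_x_normal) => //.
  exact: continuous_measurable_fun.
have intr1 : mu.-integrable setT (EFin \o (fun x => r * f1 x)).
  by rewrite (_ : EFin \o _ = fun x => (r%:E * (EFin \o f1) x)%E) //; exact: integrableZl.
have ints2 : mu.-integrable setT (EFin \o (fun x => (s ^+ 2)^-1 * f2 x)).
  rewrite (_ : EFin \o _ = fun x => ((s ^+ 2)^-1%:E * (EFin \o f2) x)%E) //.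
  exact: integrableZl.
have intf : mu.-integrable setT (EFin \o f).
  rewrite (_ : EFin \o _ = (EFin \o (fun x => r * f1 x)%R) \-
    (EFin \o (fun x => (s ^+ 2)^-1 * f2 x)%R))%E //.
  exact: integrableB.
have cp : continuous p by exact: continuous_normal_pdf.
have dF (x : R) : is_derive x 1 F (f x).
  have d1 := is_derive_scale_comp r dh x.
  apply: (is_derive_eq (is_deriveM d1 (is_derive_normal_pdf x))).
  by rewrite /GRing.scale /= /f /f1 /f2; field.
have cf : continuous f.
  move=> x; apply: cvgB; apply: cvgM; try exact: cvg_cst.
    by apply: cvgM; [exact: ch2 | exact: cp].
  apply: cvgM; first exact: ch1.
  by apply: cvgM; [exact: cvg_id | exact: cp].
pose I k : set R := `[- k.+1%:R, k.+1%:R]%classic.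
have ftc k : (\int[mu]_(x in I k) (f x)%:E = (F k.+1%:R)%:E - (F (- k.+1%:R))%:E)%E.
  apply: continuous_FTC2.
  - by rewrite gtrN // ltr0n.
  - exact: continuous_subspaceT.
  - have cF := continuous_is_derive dF.
    split.
    + by move=> x _; exact: (@ex_derive _ _ _ _ _ _ _ (dF x)).
    + by apply: cvg_at_right_filter; exact: cF.
    + by apply: cvg_at_left_filter; exact: cF.
  - by move=> x _; rewrite derive1E; exact: (@derive_val _ _ _ _ _ _ _ (dF x)).
have lim1 : (fun k => \int[mu]_(x in I k) (f x)%:E)%E @ \oo --> (\int[mu]_(x in setT) (f x)%:E)%E.
  have -> : (fun k => \int[mu]_(x in I k) (f x)%:E)%E =
            (fun k => \int[mu]_(x in setT) ((f \_ (I k)) x)%:E)%E.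
    apply/funext => k; rewrite integral_mkcond; apply: eq_integral => x _.
    by rewrite restrict_EFin.
  suff [] : [/\ mu.-integrable setT (EFin \o f),
      (fun k => \int[mu]_(x in setT) `|((f \_ (I k)) x)%:E - (EFin \o f) x|)%E @ \oo --> 0%E &
      (fun k => \int[mu]_(x in setT) ((f \_ (I k)) x)%:E)%E @ \oo -->
        (\int[mu]_(x in setT) ((EFin \o f) x))%E] by [].
  apply: (@dominated_convergence _ _ _ mu setT measurableT
    (fun k x => ((f \_ (I k)) x)%:E) (EFin \o f) (fun x => `|(f x)%:E|)%E).
  - move=> k; apply/measurable_EFinP; apply/(measurable_restrictT _ _).1 => //.
      exact: measurable_itv.
    by apply: measurable_funTS; exact: continuous_measurable_fun.
  - by apply/measurable_EFinP; exact: continuous_measurable_fun.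
  - apply/aeW => x _; apply: cvg_near_cst.
    near=> k; rewrite patchE mem_set //= /I /= in_itv /= -ler_norml.
    by near: k; exact: near_natS_ge.
  - exact: integrable_abse.
  - apply/aeW => x k _; rewrite /= lee_fin patchE; case: ifP => // _.
    by rewrite normr0.
have lim2 : (fun k => (F k.+1%:R)%:E - (F (- k.+1%:R))%:E)%E @ \oo --> 0%E.
  have hp0 (e : R) : e = 1 \/ e = -1 -> (fun k => F (e * k.+1%:R)) @ \oo --> (0 : R).
    move=> eE; apply: norm_cvg0.
    apply: (@squeeze_cvgr _ _ _ _ (fun=> 0) (fun k => p (e * k.+1%:R))).
    - apply: nearW => k; rewrite normr_ge0 /= /F normrM.
      by rewrite [X in _ * X]ger0_norm ?normal_pdf_ge0 // ler_piMl ?normal_pdf_ge0.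
    - exact: cvg_cst.
    - exact: normal_pdf_cvg0.
  have h0 : (fun k => F k.+1%:R - F (- k.+1%:R)) @ \oo --> (0 : R).
    rewrite -[X in _ --> X](subr0 0); apply: cvgB.
      have := hp0 1 (or_introl erefl); under eq_fun do rewrite mul1r; exact.
    by have := hp0 (-1) (or_intror erefl); under eq_fun do rewrite mulN1r; exact.
  by under eq_fun do rewrite -EFinB; apply: cvg_EFin => //; exact: nearW.
have E0 : \int[mu]_(x in setT) f x = 0.
  rewrite /Rintegral (_ : (\int[mu]_(x in setT) (f x)%:E)%E = 0%E) //.
  rewrite (_ : (fun k => _) = (fun k => (F k.+1%:R)%:E - (F (- k.+1%:R))%:E)%E) in lim1; last first.
    by apply/funext => k; exact: ftc.
  exact: (cvg_unique (@ereal_hausdorff R) lim1 lim2).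
move: E0; rewrite /f RintegralB // !RintegralZl // => /eqP; rewrite subr_eq0 => /eqP E0.
by rewrite -mulrA E0 mulrA mulfV ?mul1r // expf_neq0.
Unshelve. all: by end_near.
Qed.

(** The hypotheses say that the second derivative of [h] is - h: cosines of all phases cover the
    characteristic function without complex integrals. The Stein identity is exact for the normal
    law, so [ode_gauss] applies with error 0. *)
Lemma normal_char (h h' : R -> R) :
  (forall y : R, is_derive y 1 h (h' y)) -> (forall y : R, is_derive y 1 h' (- h y)) ->
  (forall y, `|h y| <= 1) -> (forall y, `|h' y| <= 1) ->
  \int[normal_prob 0 s]_(x in setT) h x = expR (- s ^+ 2 / 2) * h 0.
Proof.
move=> dh dh' h1 h'1.
have ch := continuous_is_derive dh; have ch' := continuous_is_derive dh'.
have cNh : continuous (fun x => - h x) by move=> x; apply: cvgN; exact: ch.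
have Nh1 y : `|- h y| <= 1 by rewrite normrN.
rewrite integral_normal_prob //; last exact: continuous_measurable_fun.
have D (r : R) : is_derive r 1 (fun r => \int[mu]_(x in setT) (h (r * x) * p x))
    (\int[mu]_(x in setT) (h' (r * x) * (x * p x))).
  have mid : measurable_fun setT (id : measurableTypeR R -> R) by exact: measurable_id.
  exact: (is_derive_under measurableT mid integrable_normal integrable_x_normal).
have ode (r : R) : 0 <= r <= 1 -> `|\int[mu]_(x in setT) (h' (r * x) * (x * p x)) +
    s ^+ 2 * r * \int[mu]_(x in setT) (h (r * x) * p x)| <= 0.
  move=> _; rewrite (normal_stein r dh') //.
  rewrite [X in _ * X + _](_ : _ =
    - Rintegral mu setT (fun x => h (r * x) * p x)) ?mulrN ?addNr ?normr0 //.
  rewrite -mulN1r -RintegralZl //; last first.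
    apply: (integrable_bounded_weight measurableT integrable_normal) => //.
    apply: continuous_measurable_fun => x.
    by apply: (@continuous_comp _ _ _ ( *%R r) h); [exact: mulrl_continuous | exact: ch].
  by apply: eq_Rintegral => x _; rewrite mulNr mulN1r.
have := ode_gauss D ode; rewrite mulr0 normr_le0 subr_eq0 => /eqP.
rewrite [X in X = _](_ : _ = \int[mu]_(x in setT) (h x * p x)); last first.
  by apply: eq_Rintegral => x _; rewrite mul1r.
move=> ->; apply: f_equal.
rewrite [X in X = _](_ : _ = \int[mu]_(x in setT) (h 0 * p x)); last first.
  by apply: eq_Rintegral => x _; rewrite mul0r.
rewrite RintegralZl //; last exact: integrable_normal.
by rewrite /Rintegral integral_normal_pdf mulr1.
Qed.

End normal_characteristic.

Section stein_characteristic.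
Context d (T : measurableType d) (R : realType) (mu : probability T R).
Context (D : set T) (mD : measurable D) (muD : mu D = 1%E) (Y : T -> R) (v K : R).
Hypothesis bY : bm D Y.
Hypothesis steinY : forall g g' g'' : R -> R,
  (forall y : R, is_derive y 1 g (g' y)) -> (forall y : R, is_derive y 1 g' (g'' y)) ->
  continuous g'' -> (forall y, `|g y| <= 1) -> (forall y, `|g' y| <= 1) ->
  (forall y, `|g'' y| <= 1) ->
  `|\int[mu]_(x in D) (g (Y x) * Y x) - v * \int[mu]_(x in D) (g' (Y x))| <= K.

(** With g (y) = h' (r y), the Stein identity is the approximate differential equation of
    [ode_gauss] for r -> E h (r Y). The range 0 <= r <= 1 keeps g and its derivatives bounded by
    1. *)
Lemma stein_char (h h' : R -> R) :
  (forall y : R, is_derive y 1 h (h' y)) -> (forall y : R, is_derive y 1 h' (- h y)) ->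
  (forall y, `|h y| <= 1) -> (forall y, `|h' y| <= 1) ->
  `|\int[mu]_(x in D) h (Y x) - expR (- v / 2) * h 0| <= expR `|v| * K.
Proof.
move=> dh dh' h1 h'1.
have ch := continuous_is_derive dh; have ch' := continuous_is_derive dh'.
have i1 : mu.-integrable D (EFin \o (fun=> 1)).
  by apply: (bm_integrable mD muD); exact: bm_cst.
have iY : mu.-integrable D (EFin \o (fun x => Y x * 1)).
  by apply: (bm_integrable mD muD); apply: bmM => //; exact: bm_cst.
have Dphi (r : R) := is_derive_under mD bY.1 i1 iY r dh ch' h1 h'1.
have bh r : bm D (fun x => h (r * Y x)).
  by apply: (bm_continuous (C := 1)) => //; apply: measurable_funM => //; exact: bY.1.
have ode (r : R) : 0 <= r <= 1 -> `|\int[mu]_(x in D) (h' (r * Y x) * (Y x * 1)) +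
    v * r * \int[mu]_(x in D) (h (r * Y x) * 1)| <= K.
  move=> /andP[r0 r1].
  have r1' : `|r| <= 1 by rewrite ger0_norm.
  have d1 := is_derive_scale_comp r dh'.
  have d2 (y : R) : is_derive y 1 (fun x => r * - h (r * x)) (r * (- (r * h' (r * y)))).
    have e1 := is_deriveN (is_derive_scale_comp r dh y).
    apply: (is_derive_eq (is_deriveM (is_derive_cst r y 1) e1)).
    by rewrite /GRing.scale /= mulr0 addr0.
  have := steinY d1 d2.
  have c3 : continuous (fun y => r * - (r * h' (r * y))).
    move=> y; apply: cvgM; first exact: cvg_cst.
    apply: cvgN; apply: cvgM; first exact: cvg_cst.
    by apply: (@continuous_comp _ _ _ ( *%R r) h'); [exact: mulrl_continuous | exact: ch'].
  move=> /(_ c3 (fun y => h'1 _)).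
  have b2 y : `|r * - h (r * y)| <= 1.
    by rewrite normrM normrN mulr_ile1.
  have b3 y : `|r * - (r * h' (r * y))| <= 1.
    by rewrite normrM normrN normrM !mulr_ile1 // mulr_ge0.
  move=> /(_ b2 b3).
  have -> : \int[mu]_(x in D) (r * - h (r * Y x)) = - (r * \int[mu]_(x in D) (h (r * Y x))).
    rewrite -(ExZ mD muD) // -(ExN mD muD); last by apply: bmZ.
    by apply: Ex_eq => x _; rewrite mulrN.
  rewrite mulrN opprK mulrA.
  congr (`|_ + _ * _| <= _); apply: Ex_eq => x _; by rewrite mulr1.
have := ode_gauss Dphi ode.
congr (`|_ - _| <= _).
  by apply: Ex_eq => x _; rewrite mul1r mulr1.
apply: f_equal; rewrite -[RHS](Ex_cst mD muD).
by apply: Ex_eq => x _; rewrite mul0r mulr1.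
Qed.

End stein_characteristic.

Section centering.
Context (R : realType) (beta n : nat) (hbeta : beta = 1%N \/ beta = 2%N).
Context (n_gt0 : (0 < n)%N).
Local Notation G := (@haar_group R beta n).
Local Notation cmx := (cmatrix R n).
Context (P : probability cmx R) (HP : haar_prob beta P).

Let mG : measurable G := @measurable_haar_group R beta n.
Let PG : P G = 1%E := HP.1.

Lemma integral_haar_group (F : cmx -> R) : measurable_fun setT F ->
  (\int[P]_(M in setT) (F M)%:E = \int[P]_(M in G) (F M)%:E)%E.
Proof.
move=> mF; rewrite [RHS]integral_mkcond.
apply: ae_eq_integral => //.
- exact/measurable_EFinP.
- have h := measurable_restrictT (EFin \o F) mG; apply/h.
  by apply: measurable_funTS; exact/measurable_EFinP.
- exists (~` G); split; first exact: measurableC.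
    by have := probability_setC P mG; rewrite [X in (1 - X)%E]PG subee.
  by move=> M /= h GM; apply: h => _; rewrite patchE mem_set.
Qed.

Lemma measurable_Tpq p q : measurable_fun setT (@Tpq R n p q).
Proof.
rewrite /Tpq; under eq_fun do rewrite big_mkcond.
apply: measurable_sum => i; case: (i < p)%N; last by apply: measurable_cst.
under eq_fun do rewrite big_mkcond.
apply: measurable_sum => j; case: (j < q)%N; last by apply: measurable_cst.
have [m1 m2] := @cmeas_entry R n i j.
by apply: measurable_funD; apply: measurable_funX.
Qed.

(** The case F = 1 of [ibp_tau]: an eigenfunction of nonzero eigenvalue is centred. *)
Lemma mean_Tpq p q : (p <= n)%N -> (q <= n)%N ->
  fine (\int[P]_(N in setT) (Tpq p q N)%:E)%E = mT R n p q.
Proof.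
move=> pn qn; rewrite (integral_haar_group (measurable_Tpq p q)).
have bT : bm G (tau (pid_mx p) (pid_mx q)) by exact: bm_tau.
have EW : \int[P]_(M in G) ctrT p q M = 0.
  have pA := bsproj_pid R pn; have pQ := bsproj_pid R qn.
  have := @ibp_tau R beta n hbeta P HP _ _ (fun=> 1) (fun _ _ => 0) pA pQ n_gt0.
  move=> /(_ (bm_cst _ _) (fun t => bm_cst _ _) (fun t => flow_der_cst _ _)) h.
  have lam0 : 4 * beta%:R * n%:R != 0 :> R.
    by rewrite !mulf_neq0 // pnatr_eq0 -?lt0n //; case: hbeta => ->.
  apply/eqP; rewrite -(mulrI_eq0 _ (mulfI lam0)); apply/eqP.
  transitivity (4 * beta%:R * n%:R * \int[P]_(M in G) (1 * (tau (pid_mx p) (pid_mx q) M -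
     complex.Re (\tr (pid_mx p : 'M[R[i]]_n)) * complex.Re (\tr (pid_mx q : 'M[R[i]]_n)) / n%:R))).
    by apply: f_equal; apply: Ex_eq => M _; rewrite mul1r ctrT_ctau.
  rewrite h -[RHS](Ex_cst mG PG); apply: Ex_eq => M _.
  by rewrite big1 // => t _; rewrite mul0r.
have : \int[P]_(M in G) ctrT p q M = \int[P]_(M in G) tau (pid_mx p) (pid_mx q) M - mT R n p q.
  by rewrite /ctrT (ExB mG PG) // ?(Ex_cst mG PG) //; exact: bm_cst.
rewrite EW => /esym/eqP; rewrite subr_eq0 => /eqP <-.
by apply: Ex_eq => M _; rewrite Tpq_tau.
Qed.

Lemma truncn_le_n (s : R) : unit_itv s -> (Num.truncn (n%:R * s) <= n)%N.
Proof.
rewrite /unit_itv /= in_itv /= => /andP[s0 s1].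
rewrite -(@ler_nat R) (le_trans _ (_ : n%:R * s <= _)) ?truncn_le ?mulr_ge0 //.
by rewrite ler_piMr.
Qed.

Lemma WnE s t M : unit_itv s -> unit_itv t ->
  Wn P M s t = ctrT (Num.truncn (n%:R * s)) (Num.truncn (n%:R * t)) M.
Proof.
move=> us ut; rewrite /Wn mean_Tpq ?truncn_le_n //.
by rewrite Tpq_tau.
Qed.

(** With x = p / n, y = q / n, likewise x', y', and m, m' the two minima, [mZ] / n is y y' m + x x'
    m' - x x' y y', so the difference factorises. The identity is exact for each n, and only the
    rounding of the indices remains for the limit. *)
Lemma limit_covE (p q p' q' : nat) :
  (mT R n (minn p p') (minn q q') - mZ R n p q p' q') / n%:R =
  bridge_cov (p%:R / n%:R) (q%:R / n%:R) (p'%:R / n%:R) (q'%:R / n%:R) :> R.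
Proof.
have n0 : n%:R != 0 :> R by rewrite pnatr_eq0 -lt0n.
have minE (a b : nat) : Num.min (a%:R / n%:R) (b%:R / n%:R) = (minn a b)%:R / n%:R :> R.
  by rewrite natr_min minr_pMl // invr_ge0.
rewrite /bridge_cov !minE /mZ /mT; by field.
Qed.

End centering.

Lemma truncn_cvg (R : realType) (s : R) : 0 <= s ->
  (fun n => (Num.truncn (n%:R * s))%:R / n%:R) @ \oo --> s.
Proof.
move=> s0; apply/cvgrPdist_le => e e0.
near=> n.
have n0 : 0 < n%:R :> R by rewrite ltr0n; near: n; exists 1%N.
have /andP[h1 h2] := truncn_itv (mulr_ge0 (ltW n0) s0).
have -> : s - (Num.truncn (n%:R * s))%:R / n%:R =
    (n%:R * s - (Num.truncn (n%:R * s))%:R) / n%:R by field; rewrite gt_eqF.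
rewrite ger0_norm; last by rewrite divr_ge0 // ?subr_ge0 // ltW.
rewrite ler_pdivrMr // (@le_trans _ _ 1) //.
  by rewrite lerBlDl natr1 ltW.
rewrite -ler_pdivrMl // mulr1.
near: n; exists (Num.truncn e^-1).+1 => // n /= hn.
by rewrite (le_trans (ltW (truncnS_gt _))) // ler_nat.
Unshelve. all: by end_near.
Qed.

Lemma bridge_cov_cvg (R : realType) (a b c e : nat -> R) (s t s' t' : R) :
  a @ \oo --> s -> b @ \oo --> t -> c @ \oo --> s' -> e @ \oo --> t' ->
  (fun n => bridge_cov (a n) (b n) (c n) (e n)) @ \oo --> bridge_cov s t s' t'.
Proof.
move=> ha hb hc he.
have cvg_min (x y : nat -> R) l m : x @ \oo --> l -> y @ \oo --> m ->
    (fun n => Num.min (x n) (y n)) @ \oo --> Num.min l m.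
  move=> hx hy; rewrite minr_absE; under eq_fun do rewrite minr_absE.
  apply: cvgM; last exact: cvg_cst.
  by apply: cvgB; [exact: cvgD | apply: cvg_norm; exact: cvgB].
by apply: cvgM; apply: cvgB; [exact: cvg_min | exact: cvgM | exact: cvg_min | exact: cvgM].
Qed.

Lemma cvg_finite_sum (R : realType) (I : Type) (r : seq I) (u : I -> nat -> R) (l : I -> R) :
  (forall i, u i @ \oo --> l i) ->
  (fun n => \sum_(i <- r) u i n) @ \oo --> \sum_(i <- r) l i.
Proof.
move=> ul; elim: r => [|i r IHr].
  by rewrite big_nil; under eq_fun do rewrite big_nil; exact: cvg_cst.
by rewrite big_cons; under eq_fun do rewrite big_cons; exact: cvgD.
Qed.

Section law_transfer.
Context d (T : measurableType d) (R : realType) (Q : probability T R).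

Lemma integral_law (nu : probability (measurableTypeR R) R) (X : T -> measurableTypeR R)
    (h : measurableTypeR R -> R) :
  measurable_fun setT X -> (forall A, measurable A -> Q (X @^-1` A) = nu A) ->
  measurable_fun setT h -> (forall x, `|h x| <= 1) ->
  \int[Q]_(w in setT) h (X w) = \int[nu]_(x in setT) h x.
Proof.
move=> mX lawX mh h1; congr fine.
have ih : Q.-integrable (X @^-1` setT) ((EFin \o h) \o X).
  rewrite preimage_setT.
  apply: (bm_integrable measurableT (probability_setT Q) (F := h \o X)).
  by split; [exact: measurableT_comp | exists 1 => w _; exact: h1].
have := integral_pushforward mX (_ : measurable_fun setT (EFin \o h)) ih measurableT.
rewrite preimage_setT => <-; last exact/measurable_EFinP.
by apply: eq_measure_integral => A mA _; rewrite /= /pushforward lawX.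
Qed.

End law_transfer.

Section characteristic_limits.
Context (R : realType) (beta : nat) (hbeta : beta = 1%N \/ beta = 2%N).
Context (P : forall n, probability (cmatrix R n) R) (HP : forall n, haar_prob beta (P n)).
Local Notation G n := (@haar_group R beta n).
Context (N : nat) (s t th : 'I_N -> R).
Hypothesis st : forall i, unit_itv (s i) /\ unit_itv (t i).

Definition lim_var : R :=
  2 / beta%:R * \sum_i \sum_j th i * th j * bridge_cov (s i) (t i) (s j) (t j).

Context (h h' : R -> R).
Hypothesis dh : forall y : R, is_derive y 1 h (h' y).
Hypothesis dh' : forall y : R, is_derive y 1 h' (- h y).
Hypothesis h1 : forall y, `|h y| <= 1.
Hypothesis h'1 : forall y, `|h' y| <= 1.

(** The number of points and the weights [th] are fixed, so the Stein error is O(1 / n), and the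
    variance converges as a bridge covariance at rounded points. *)
Lemma lim_char : (fun n => \int[P n]_(M in G n) h (\sum_i th i * Wn (P n) M (s i) (t i)))
  @ \oo --> expR (- lim_var / 2) * h 0.
Proof.
pose p n i := Num.truncn (n%:R * s i); pose q n i := Num.truncn (n%:R * t i).
pose B : R := \sum_i `|th i|.
pose v n := 2 / beta%:R * stein_var n (p n) (q n) th.
pose C0 := 2 * (4 * B + 20) * B ^+ 2.
have cvgV : v @ \oo --> lim_var.
  apply: cvgM; first exact: cvg_cst.
  rewrite exchange_big /=.
  have E : \forall n \near \oo, \sum_i \sum_j th i * th j *
      bridge_cov ((p n j)%:R / n%:R) ((q n j)%:R / n%:R) ((p n i)%:R / n%:R) ((q n i)%:R / n%:R)
      = stein_var n (p n) (q n) th.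
    exists 1%N => // n /= n0; apply: eq_bigr => i _; apply: eq_bigr => j _.
    by rewrite limit_covE.
  apply: cvg_trans (near_eq_cvg E) _.
  apply: cvg_finite_sum => i; apply: cvg_finite_sum => j.
  rewrite (mulrC (th j)); apply: cvgM; first exact: cvg_cst.
  have u0 x : unit_itv x -> 0 <= x :> R by rewrite /unit_itv /= in_itv /= => /andP[].
  by apply: bridge_cov_cvg; apply: truncn_cvg; apply: u0; case: (st i); case: (st j).
have cvgE : (fun n => expR (- v n / 2) * h 0) @ \oo --> expR (- lim_var / 2) * h 0.
  apply: cvgM; last exact: cvg_cst.
  apply: continuous_cvg; first exact: continuous_expR.
  by apply: cvgM; [exact: cvgN | exact: cvg_cst].
have cvgK : (fun n => expR `|v n| * (C0 / n%:R)) @ \oo --> 0.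
  rewrite -[X in _ --> X](mulr0 (expR `|lim_var|)); apply: cvgM.
    by apply: continuous_cvg; [exact: continuous_expR | exact: cvg_norm].
  rewrite -[X in _ --> X](mulr0 C0); apply: cvgM; first exact: cvg_cst.
  rewrite -(cvg_shiftS (fun n => n%:R^-1 : R)).
  exact: cvg_harmonic.
apply: (cvg_sub0 _ cvgE); apply: norm_cvg0.
apply: (@squeeze_cvgr _ _ _ _ (fun=> 0) _ _ _ _ _ cvgK) => //; last exact: cvg_cst.
near=> n; rewrite normr_ge0 /= fctE.
have n0 : (0 < n)%N by near: n; exists 1%N.
have pn i : (p n i <= n)%N by apply: truncn_le_n => //; case: (st i).
have qn i : (q n i <= n)%N by apply: truncn_le_n => //; case: (st i).
have st' := stein_identity_approx hbeta n0 (HP n) th pn qn.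
have bY : bm (G n) (ctrT_comb (p n) (q n) th) by exact: bm_ctrT_comb.
have := stein_char (@measurable_haar_group R beta n) (HP n).1 bY st' dh dh' h1 h'1.
congr (`|_ - _| <= _); apply: Ex_eq => M _; apply: f_equal.
by apply: eq_bigr => i _; rewrite (WnE hbeta n0 (HP n)) //; case: (st i).
Unshelve. all: by end_near.
Qed.

End characteristic_limits.

Section phase.
Context (R : realType) (phi : R).

Lemma is_derive_shift (f : R -> R) (df y : R) :
  is_derive (y + phi) 1 f df -> is_derive y 1 (fun z => f (z + phi)) df.
Proof.
move=> hf.
have hs : is_derive y (1 : R) (fun z : R => z + phi) 1.
  by rewrite -[X in is_derive _ _ _ X]addr0; apply: is_deriveD.
have := @is_derive1_comp _ f (fun z : R => z + phi) y df 1 hf hs.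
by rewrite mulr1.
Qed.

Lemma is_derive_cos_shift (y : R) :
  is_derive y 1 (fun z => cos (z + phi)) (- sin (y + phi)).
Proof. by apply: is_derive_shift; exact: is_derive_cos. Qed.

Lemma is_derive_Nsin_shift (y : R) :
  is_derive y 1 (fun z => - sin (z + phi)) (- cos (y + phi)).
Proof. by apply: (@is_derive_shift (fun z => - sin z)); apply: is_deriveN; exact: is_derive_sin. Qed.

Lemma cos_norm_le1 (y : R) : `|cos y| <= 1.
Proof. by rewrite ler_norml cos_le1 cos_geN1. Qed.

Lemma sin_norm_le1 (y : R) : `|sin y| <= 1.
Proof. by rewrite ler_norml sin_le1 sin_geN1. Qed.

Lemma Nsin_norm_le1 (y : R) : `|- sin y| <= 1.
Proof. by rewrite normrN sin_norm_le1. Qed.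
End phase.

Section bridge_characteristic.
Context (R : realType) (beta : nat) (hbeta : beta = 1%N \/ beta = 2%N).
Context (P : forall n, probability (cmatrix R n) R) (HP : forall n, haar_prob beta (P n)).
Context (d : measure_display) (Omega : measurableType d) (Q : probability Omega R).
Context (W : R -> R -> Omega -> R) (HW : tied_down_bridge Q W).
Local Notation G n := (@haar_group R beta n).
Context (N : nat) (s t th : 'I_N -> R).
Hypothesis st : forall i, unit_itv (s i) /\ unit_itv (t i).

Let lv := lim_var beta s t th.

(** exp (- lv / 2) is a limit of mean cosines, hence at most 1. Nonnegativity lets [Num.sqrt lv] be
    read as a standard deviation in [bridge_char]. *)
Lemma lim_var_ge0 : 0 <= lv.
Proof.
have lc := lim_char hbeta HP (th := th) st (@is_derive_cos_shift R 0)
  (@is_derive_Nsin_shift R 0) (fun y => cos_norm_le1 _) (fun y => Nsin_norm_le1 _).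
have : expR (- lv / 2) <= 1.
  rewrite addr0 cos0 mulr1 in lc.
  rewrite -(cvg_lim (@Rhausdorff R) lc); apply: limr_le; first by apply/cvg_ex; eexists; exact: lc.
  near=> n; have n0 : (0 < n)%N by near: n; exists 1%N.
  apply: (le_trans (ler_norm _)).
  apply: (Ex_bound (@measurable_haar_group R beta n) (HP n).1) => [|M _]; last exact: cos_norm_le1.
  apply: bm_cos; apply: measurable_funD => //.
  apply: measurable_sum => i; apply: measurable_funM => //.
  apply: measurable_funB => //.
  apply: (@measurable_funS _ _ _ _ setT) => //; exact: measurable_Tpq.
by rewrite -expR0 ler_expR ler_pdivrMr // mul0r oppr_le0.
Unshelve. all: by end_near.
Qed.

Lemma bridge_char (h h' : R -> R) :
  (forall y : R, is_derive y 1 h (h' y)) -> (forall y : R, is_derive y 1 h' (- h y)) ->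
  (forall y, `|h y| <= 1) -> (forall y, `|h' y| <= 1) ->
  \int[Q]_(w in setT) h (\sum_i th i * (Num.sqrt (2 / beta%:R) * W (s i) (t i) w)) =
  expR (- lv / 2) * h 0.
Proof.
move=> dh dh' h1 h'1.
have [mW _ law] := HW.
pose a i := th i * Num.sqrt (2 / beta%:R).
have mh : measurable_fun setT h.
  apply: continuous_measurable_fun => y.
  by apply/differentiable_continuous/derivable1_diffP; have [] := dh y.
have mX : measurable_fun setT (fun w => \sum_i a i * W (s i) (t i) w).
  by apply: measurable_sum => i; apply: measurable_funM.
have lvE : \sum_i \sum_j a i * a j * bridge_cov (s i) (t i) (s j) (t j) = lv.
  rewrite /lv /lim_var mulr_sumr; apply: eq_bigr => i _.
  rewrite mulr_sumr; apply: eq_bigr => j _; rewrite /a.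
  have : Num.sqrt (2 / beta%:R) * Num.sqrt (2 / beta%:R) = 2 / beta%:R :> R.
    by rewrite -expr2 sqr_sqrtr // divr_ge0.
  by move: (Num.sqrt _) (bridge_cov _ _ _ _) => x y <-; ring.
have {law} := law N s t a st; rewrite lvE => law.
transitivity (\int[Q]_(w in setT) h (\sum_i a i * W (s i) (t i) w)).
  by apply: eq_Rintegral => w _; apply: f_equal; apply: eq_bigr => i _; rewrite mulrA.
(* A combination of variance 0 has the Dirac law at 0; it is treated apart because [normal_char]
   asks for a positive deviation. *)
move: law; rewrite /centered_normal_law; case: eqP => [-> law|/eqP v0 law].
  have -> : - (0 : R) / 2 = 0 by rewrite oppr0 mul0r.
  rewrite expR0 mul1r.
  rewrite (integral_law (nu := (@dirac _ (measurableTypeR R) 0 R : probability _ R)) mX law mh h1).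
  rewrite /Rintegral integral_dirac //; last exact/measurable_EFinP.
  by rewrite diracT mul1e.
have v0' : 0 < lv by rewrite lt_neqAle eq_sym v0 lim_var_ge0.
rewrite (integral_law (nu := normal_prob 0 (Num.sqrt lv)) mX law mh h1).
have s0 : 0 < Num.sqrt lv by rewrite sqrtr_gt0.
rewrite (normal_char s0 dh dh' h1 h'1) sqr_sqrtr //; exact: lim_var_ge0.
Qed.

Lemma phase_cvg (phi : R) :
  (fun n => \int[P n]_(M in G n) cos (\sum_i th i * Wn (P n) M (s i) (t i) + phi)) @ \oo -->
  \int[Q]_(w in setT) cos (\sum_i th i * (Num.sqrt (2 / beta%:R) * W (s i) (t i) w) + phi).
Proof.
rewrite (bridge_char (@is_derive_cos_shift R phi) (@is_derive_Nsin_shift R phi)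
  (fun y => cos_norm_le1 _) (fun y => Nsin_norm_le1 _)).
exact: (lim_char hbeta HP (th := th) st (@is_derive_cos_shift R phi)
  (@is_derive_Nsin_shift R phi) (fun y => cos_norm_le1 _) (fun y => Nsin_norm_le1 _)).
Qed.

End bridge_characteristic.

(** * From characteristic functions to Lipschitz functions *)

Section coin_flips.
Context (R : realType) (A : finType) (u : A -> R).
Hypothesis u01 : forall a, 0 <= u a <= 1.

Definition coin_weight (a : A) (b : bool) : R := if b then u a else 1 - u a.

(** Expectation over independent coins of biases [u a]. As a finite sum it is a polynomial in the
    biases, in the manner of Bernstein polynomials. *)
Definition coin_mean (g : {ffun A -> bool} -> R) : R :=
  \sum_(e : {ffun A -> bool}) (\prod_a coin_weight a (e a)) * g e.

Lemma coin_weight_ge0 a b : 0 <= coin_weight a b.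
Proof. by case: b => /=; have /andP[] := u01 a; rewrite ?subr_ge0. Qed.

Lemma coin_weights_ge0 (e : {ffun A -> bool}) : 0 <= \prod_a coin_weight a (e a).
Proof. by apply: prodr_ge0 => a _; exact: coin_weight_ge0. Qed.

Lemma coin_mean_prod (f : A -> bool -> R) :
  coin_mean (fun e => \prod_a f a (e a)) =
  \prod_a (u a * f a true + (1 - u a) * f a false).
Proof.
transitivity (\prod_a \sum_b coin_weight a b * f a b).
  by rewrite bigA_distr_bigA; apply: eq_bigr => e _; rewrite big_split.
by apply: eq_bigr => a _; rewrite big_bool.
Qed.

Lemma coin_mean1 : coin_mean (fun=> 1) = 1.
Proof.
transitivity (coin_mean (fun e => \prod_(a : A) 1)).
  by apply: eq_bigr => e _; rewrite [X in _ = _ * X]big1.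
rewrite (coin_mean_prod (fun _ _ => 1)) big1 // => a _.
by rewrite !mulr1 addrC subrK.
Qed.

Lemma coin_mean_le f g : (forall e, f e <= g e) -> coin_mean f <= coin_mean g.
Proof. by move=> fg; apply: ler_sum => e _; apply: ler_wpM2l => //; exact: coin_weights_ge0. Qed.

Lemma coin_meanZ c f : coin_mean (fun e => c * f e) = c * coin_mean f.
Proof. by rewrite mulr_sumr; apply: eq_bigr => e _; rewrite mulrCA. Qed.

Lemma coin_meanD f g : coin_mean (fun e => f e + g e) = coin_mean f + coin_mean g.
Proof. by rewrite -big_split; apply: eq_bigr => e _; rewrite mulrDr. Qed.

Lemma coin_mean_cst c : coin_mean (fun=> c) = c.
Proof.
by rewrite -[RHS]mulr1 -coin_mean1 -coin_meanZ; apply: eq_bigr => e _; rewrite mulr1.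
Qed.

Lemma coin_mean_sum (I : Type) (r : seq I) (f : I -> {ffun A -> bool} -> R) :
  coin_mean (fun e => \sum_(i <- r) f i e) = \sum_(i <- r) coin_mean (f i).
Proof.
by rewrite /coin_mean exchange_big; apply: eq_bigr => e _; rewrite mulr_sumr.
Qed.

Lemma coin_cov a a' : coin_mean (fun e => ((e a)%:R - u a) * ((e a')%:R - u a')) =
  if a == a' then u a * (1 - u a) else 0.
Proof.
have pick1 b (z : A -> R) : \prod_c (if c == b then z c else 1) = z b.
  by rewrite -big_mkcond big_pred1_eq.
pose f c (b : bool) := (if c == a then b%:R - u c else 1) * (if c == a' then b%:R - u c else 1).
transitivity (coin_mean (fun e => \prod_c f c (e c))).
  apply: eq_bigr => e _; rewrite /f big_split /=.
  by rewrite (pick1 a (fun c => (e c)%:R - u c)) (pick1 a' (fun c => (e c)%:R - u c)).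
rewrite coin_mean_prod (bigD1 a) //= /f eqxx; case: eqP => [<-|aa'].
  rewrite big1 => [|c /negbTE ->]; last by rewrite !mulr1 addrC subrK.
  by move: (u a) => x; rewrite mulr1 /=; ring.
have -> : u a * ((1 - u a) * 1) + (1 - u a) * ((0 - u a) * 1) = 0 by ring.
by rewrite mul0r.
Qed.

(** The M coins selected by [c] are distinct, so the off-diagonal covariances vanish and the
    variance of the frequency is x (1 - x) / M. *)
Lemma coin_variance (M : nat) (c : 'I_M -> A) (x : R) : (0 < M)%N -> injective c ->
  (forall k, u (c k) = x) ->
  coin_mean (fun e => ((\sum_k (e (c k))%:R) / M%:R - x) ^+ 2) <= M%:R^-1.
Proof.
move=> M0 ci cx; have M0' : M%:R != 0 :> R by rewrite pnatr_eq0 -lt0n.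
have -> : coin_mean (fun e => ((\sum_k (e (c k))%:R) / M%:R - x) ^+ 2) =
    M%:R ^- 2 * coin_mean (fun e => \sum_k \sum_l
      ((e (c k))%:R - u (c k)) * ((e (c l))%:R - u (c l))).
  rewrite -coin_meanZ; apply: eq_bigr => e _; apply: f_equal.
  have -> : \sum_k \sum_l ((e (c k))%:R - u (c k)) * ((e (c l))%:R - u (c l)) =
      (\sum_k ((e (c k))%:R - u (c k))) ^+ 2.
    by rewrite expr2 mulr_suml; apply: eq_bigr => k _; rewrite mulr_sumr.
  rewrite sumrB; have -> : \sum_k u (c k) = M%:R * x.
    by rewrite (eq_bigr _ (fun k _ => cx k)) sumr_const card_ord mulr_natl.
  by move: (\sum_k _) => y; field.
rewrite coin_mean_sum.
have -> : \sum_k coin_mean (fun e => \sum_l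
      ((e (c k))%:R - u (c k)) * ((e (c l))%:R - u (c l))) = M%:R * (x * (1 - x)).
  transitivity (\sum_(k < M) x * (1 - x)); last by rewrite sumr_const card_ord mulr_natl.
  apply: eq_bigr => k _; rewrite coin_mean_sum.
  rewrite (eq_bigr _ (fun l _ => coin_cov (c k) (c l))) (bigD1 k) //= eqxx cx.
  rewrite big1 ?addr0 // => l lk; rewrite ifN //.
  by apply: contra lk => /eqP /ci ->.
have -> : M%:R ^- 2 * (M%:R * (x * (1 - x))) = M%:R^-1 * (x * (1 - x)) by field.
rewrite -[leRHS]mulr1 ler_wpM2l ?invr_ge0 //.
have /andP[] : 0 <= x <= 1 by rewrite -(cx (Ordinal M0)).
by move=> *; nra.
Qed.

End coin_flips.

Section trig_polynomials.
Context (R : realType) (N : nat).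

(** The span of phase-shifted cosines: [phase_cvg] gives convergence on its generators, and the
    product-to-sum formula makes it an algebra. *)
Inductive trigpoly : (('I_N -> R) -> R) -> Prop :=
| trigpoly_cos (th : 'I_N -> R) (phi : R) :
    trigpoly (fun x => cos (\sum_i th i * x i + phi))
| trigpolyD p q : trigpoly p -> trigpoly q -> trigpoly (fun x => p x + q x)
| trigpolyZ c p : trigpoly p -> trigpoly (fun x => c * p x).

Lemma trigpoly_cst (c : R) : trigpoly (fun=> c).
Proof.
have -> : (fun=> c) = (fun x : 'I_N -> R => c * cos (\sum_i 0 * x i + 0)).
  by apply/funext => x; rewrite big1 ?addr0 ?cos0 ?mulr1 // => i _; rewrite mul0r.
exact/trigpolyZ/trigpoly_cos.
Qed.

Lemma trigpolyM p q : trigpoly p -> trigpoly q -> trigpoly (fun x => p x * q x).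
Proof.
move=> tp; elim: tp q => {p} [th phi|p1 p2 _ IH1 _ IH2|c p _ IH] q tq; last 2 first.
- under eq_fun do rewrite mulrDl.
  by apply: trigpolyD; [exact: IH1 | exact: IH2].
- by under eq_fun do rewrite -mulrA; exact/trigpolyZ/IH.
elim: tq => {q} [th' phi'|q1 q2 _ IH1 _ IH2|c q _ IH]; last 2 first.
- by under eq_fun do rewrite mulrDr; apply: trigpolyD.
- by under eq_fun do rewrite mulrCA; exact/trigpolyZ.
have -> : (fun x : 'I_N -> R => cos (\sum_i th i * x i + phi) * cos (\sum_i th' i * x i + phi')) =
   (fun x => 2^-1 * (cos (\sum_i (th i + th' i) * x i + (phi + phi')) +
                     cos (\sum_i (th i - th' i) * x i + (phi - phi')))).
  apply/funext => x.
  have -> : \sum_i (th i + th' i) * x i + (phi + phi') =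
      (\sum_i th i * x i + phi) + (\sum_i th' i * x i + phi').
    by under eq_bigr do rewrite mulrDl; rewrite big_split addrACA.
  have -> : \sum_i (th i - th' i) * x i + (phi - phi') =
      (\sum_i th i * x i + phi) - (\sum_i th' i * x i + phi').
    under eq_bigr do rewrite mulrBl; rewrite sumrB.
    by move: (\sum_i _) (\sum_i _) => a b; ring.
  move: (_ + phi) (_ + phi') => a b; rewrite (cosD a) (cosB a).
  by move: (cos a) (cos b) (sin a) (sin b) => *; field.
by apply/trigpolyZ/trigpolyD; exact: trigpoly_cos.
Qed.

Lemma trigpoly_prod (I : Type) (r : seq I) (p : I -> ('I_N -> R) -> R) :
  (forall i, trigpoly (p i)) -> trigpoly (fun x => \prod_(i <- r) p i x).
Proof.
move=> tp; elim: r => [|i r IHr].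
  by under eq_fun do rewrite big_nil; exact: trigpoly_cst.
by under eq_fun do rewrite big_cons; exact: trigpolyM.
Qed.

Lemma trigpoly_sum (I : Type) (r : seq I) (p : I -> ('I_N -> R) -> R) :
  (forall i, trigpoly (p i)) -> trigpoly (fun x => \sum_(i <- r) p i x).
Proof.
move=> tp; elim: r => [|i r IHr].
  by under eq_fun do rewrite big_nil; exact: trigpoly_cst.
by under eq_fun do rewrite big_cons; exact: trigpolyD.
Qed.

Lemma trigpoly_sin (K : R) (i : 'I_N) : trigpoly (fun x => sin (x i / K)).
Proof.
have -> : (fun x : 'I_N -> R => sin (x i / K)) =
    (fun x => cos (\sum_j (if j == i then K^-1 else 0) * x j + - (pi / 2))).
  apply/funext => x; rewrite cosBpihalf; apply: f_equal.
  rewrite (bigD1 i) //= eqxx big1 => [|j /negbTE ->]; last by rewrite mul0r.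
  by rewrite addr0 mulrC.
exact: trigpoly_cos.
Qed.

End trig_polynomials.

Section sine_inverse.
Context (R : realType).

Lemma cos_ge_cos1 (c : R) : -1 <= c <= 1 -> cos 1 <= cos c :> R.
Proof.
move=> /andP[c1 c2]; have pi1 : (1 : R) <= pi by rewrite (le_trans _ (@pi_ge2 R)) // ler1n.
have key (b : R) : 0 <= b -> b <= 1 -> cos 1 <= cos b.
  move=> b0; rewrite le_eqVlt => /orP[/eqP -> //|b1].
  by rewrite ltW // ltr_cos // in_itv /= ?ler01 ?pi1 ?b0 // (le_trans (ltW b1)).
have [c0|c0] := leP 0 c; first exact: key.
by rewrite -(cosN c); apply: key; lra.
Qed.

Lemma sin_lower_lip (a b : R) : -1 <= a -> a <= b -> b <= 1 ->
  cos 1 * (b - a) <= sin b - sin a.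
Proof.
move=> a1 ab b1.
have [c cab ->] := @MVT_segment R sin cos a b ab (fun x _ => is_derive_sin x)
  (continuous_subspaceT (@continuous_sin R)).
rewrite ler_wpM2r ?subr_ge0 //; apply: cos_ge_cos1.
by move: cab; rewrite in_itv /= => /andP[h1 h2]; rewrite (le_trans a1 h1) (le_trans h2 b1).
Qed.

(** [psi] is the arcsine, clamped to 1 or -1 beyond the range of sin on [-1, 1]. All real [r] are
    allowed because an empirical frequency may leave that range; cos 1 bounds the derivative of sin
    from below. *)
Lemma sin_approx_inverse : exists psi : R -> R, forall r b : R, -1 <= b <= 1 ->
  cos 1 * `|psi r - b| <= `|r - sin b|.
Proof.
suff /choice[psi psiP] : forall r : R, exists a : R, forall b : R, -1 <= b <= 1 ->
  cos 1 * `|a - b| <= `|r - sin b| by exists psi.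
move=> r; have [r1|r1] := leP (sin 1) r.
  exists 1 => b /andP[b1 b2]; have := sin_lower_lip b1 b2 (lexx _).
  have c1 := @cos1_gt0 R.
  have : 0 <= cos 1 * (1 - b) by rewrite mulr_ge0 ?subr_ge0 // ltW.
  by move=> h h'; rewrite !ger0_norm ?subr_ge0 //; lra.
have [r2|r2] := leP r (- sin 1).
  exists (-1) => b /andP[b1 b2]; have := sin_lower_lip (lexx _) b1 b2.
  have c1 := @cos1_gt0 R.
  have : 0 <= cos 1 * (b - (-1)) by rewrite mulr_ge0 ?subr_ge0 // ltW.
  rewrite sinN => h h'; rewrite (distrC (-1)) (distrC r) !ger0_norm ?subr_ge0 //; lra.
have [a aI ar] : exists2 a : R, a \in `[-1, 1]%R & sin a = r.
  apply: IVT; first lra.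
    by apply: continuous_subspaceT; exact: continuous_sin.
  by rewrite sinN ge_min le_max (ltW r1) (ltW r2) orbT.
move: aI; rewrite in_itv /= => /andP[a1 a2].
exists a => b /andP[b1 b2]; rewrite -ar.
have [ab|ab] := leP a b.
  rewrite (distrC a) (distrC (sin a)) (ger0_norm (_ : 0 <= b - a)) ?subr_ge0 //.
  exact: le_trans (sin_lower_lip a1 ab b2) (ler_norm _).
rewrite (ger0_norm (_ : 0 <= a - b)) ?subr_ge0 ?(ltW ab) //.
exact: le_trans (sin_lower_lip b1 (ltW ab) a2) (ler_norm _).
Qed.

End sine_inverse.

Section approximation.
Context (R : realType) (N : nat) (h : ('I_N -> R) -> R) (m : R).
Hypothesis m0 : 0 <= m.
Hypothesis h1 : forall x, `|h x| <= 1.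
Hypothesis h_lip : forall x y, `|h x - h y| <= m * \sum_i `|x i - y i|.

(* Each coordinate is replaced by a coin of bias u_i = (1 + sin (x_i / K)) / 2
   flipped M times; averaging h over the outcomes is a trigonometric polynomial. *)
Lemma trig_approx (K e : R) : 0 < K -> 0 < e -> exists p, [/\ trigpoly p,
  (forall x, `|p x| <= 1) &
  forall x, `|h x - p x| <= e + 2 * \sum_i Num.min 1 (x i ^+ 2 / K ^+ 2)].
Proof.
move=> K0 e0.
have [psi psiP] := sin_approx_inverse R.
have k0 := @cos1_gt0 R.
pose L := m * (2 * K / cos 1) * N%:R.
have c0 : 0 <= m * (2 * K / cos 1) by rewrite !mulr_ge0 // ?invr_ge0 ltW.
have L0 : 0 <= L by rewrite mulr_ge0.
(* [dl] and the number [M] of coins are chosen so that, in the bound |z| <= dl + z^2 / dl weighted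
   by L, each of the two terms contributes at most e / 2 in mean. *)
pose dl := e / (2 * (L + 1)).
have dl0 : 0 < dl by rewrite divr_gt0 // mulr_gt0 // ltr_wpDl.
pose M := (Num.truncn (2 * L / (e * dl))).+1.
have M0 : (0 < M)%N by [].
pose A := ('I_N * 'I_M)%type.
pose u (x : 'I_N -> R) (a : A) := (1 + sin (x a.1 / K)) / 2.
have u01 x a : 0 <= u x a <= 1.
  have h' := sin_geN1 (x a.1 / K); have h'' := sin_le1 (x a.1 / K).
  by rewrite /u; apply/andP; split; lra.
pose mean (i : 'I_N) (f : {ffun A -> bool}) : R := (\sum_k (f (i, k))%:R) / M%:R.
pose phi f := h (fun i => K * psi (2 * mean i f - 1)).
pose p x := coin_mean (u x) phi.
have cm_norm x g : `|coin_mean (u x) g| <= coin_mean (u x) (fun f => `|g f|).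
  apply: (le_trans (ler_norm_sum _ _ _)); apply: ler_sum => f _.
  by rewrite normrM ger0_norm // coin_weights_ge0.
have p1 x : `|p x| <= 1.
  apply: (le_trans (cm_norm _ _)).
  rewrite -[leRHS](coin_mean_cst (u x)); apply: coin_mean_le => // f; exact: h1.
exists p; split => //.
  apply: trigpoly_sum => f; apply: trigpolyM; last exact: trigpoly_cst.
  apply: trigpoly_prod => a.
  have tu : trigpoly (fun x : 'I_N -> R => (1 + sin (x a.1 / K)) / 2).
    under eq_fun do rewrite mulrC.
    by apply: trigpolyZ; apply: trigpolyD; [exact: trigpoly_cst | exact: trigpoly_sin].
  rewrite /coin_weight; case: (f a) => //.
  under eq_fun do rewrite -mulN1r.
  by apply: trigpolyD; [exact: trigpoly_cst | exact: trigpolyZ].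
move=> x.
have min0 i : 0 <= Num.min 1 (x i ^+ 2 / K ^+ 2).
  by rewrite le_min ler01 divr_ge0 ?sqr_ge0.
(* Outside the cube |x_i| <= K the trivial bound 2 is covered by a minimum equal to 1. *)
have [[i xi]|xK] := pselect (exists i, K < `|x i|).
  have mi : Num.min 1 (x i ^+ 2 / K ^+ 2) = 1.
    apply/min_idPl; rewrite ler_pdivlMr ?exprn_gt0 // mul1r -(real_normK (num_real (x i))).
    by rewrite lerXn2r ?nnegrE ?normr_ge0 // ltW.
  have : 1 <= \sum_i Num.min 1 (x i ^+ 2 / K ^+ 2).
    by rewrite (bigD1 i) //= mi lerDl sumr_ge0.
  have := ler_normB (h x) (p x); have := h1 x; have := p1 x; lra.
have {}xK i : -1 <= x i / K <= 1.
  rewrite -ler_norml normrM normfV (gtr0_norm K0) ler_pdivrMr // mul1r leNgt.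
  by apply/negP => hi; apply: xK; exists i.
rewrite (@le_trans _ _ e) //; last by rewrite lerDl mulr_ge0 // sumr_ge0.
have -> : h x - p x = coin_mean (u x) (fun f => h x + -1 * phi f).
  by rewrite coin_meanD coin_mean_cst coin_meanZ mulN1r.
apply: (le_trans (cm_norm _ _)).
apply: (@le_trans _ _ (coin_mean (u x) (fun f => \sum_i m * (2 * K / cos 1) *
   (dl + dl^-1 * (mean i f - u x (i, ord0)) ^+ 2)))).
  apply: coin_mean_le => // f; rewrite mulN1r.
  apply: (le_trans (h_lip _ _)); rewrite mulr_sumr; apply: ler_sum => i _.
  rewrite -mulrA ler_wpM2l //.
  have -> : x i - K * psi (2 * mean i f - 1) = K * - (psi (2 * mean i f - 1) - x i / K).
    by move: (psi _) => y; field; rewrite gt_eqF.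
  rewrite normrM normrN (gtr0_norm K0).
  have -> : 2 * K / cos 1 = K * (2 / cos 1) :> R by move: (cos 1) k0 => z z0; field; rewrite gt_eqF.
  rewrite -mulrA ler_wpM2l ?(ltW K0) // mulrAC ler_pdivlMr // mulrC.
  apply: (le_trans (psiP _ _ (xK i))).
  have -> : 2 * mean i f - 1 - sin (x i / K) = 2 * (mean i f - u x (i, ord0)).
    by rewrite /u /=; move: (sin _) (mean _ _) => y z; field.
  rewrite normrM ger0_norm // ler_wpM2l //.
  move: (mean i f - _) => z; rewrite -[z ^+ 2](real_normK (num_real z)).
  move: `|z| (normr_ge0 z) => {}z z0.
  have -> : dl + dl^-1 * z ^+ 2 = z + ((dl - z / 2) ^+ 2 + 3 / 4 * z ^+ 2) / dl.
    by field; rewrite gt_eqF.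
  by rewrite lerDl divr_ge0 ?(ltW dl0) // addr_ge0 ?sqr_ge0 // mulr_ge0 ?sqr_ge0 // divr_ge0.
rewrite coin_mean_sum.
apply: (@le_trans _ _ (\sum_(i < N) m * (2 * K / cos 1) * (dl + dl^-1 * M%:R^-1))).
  apply: ler_sum => i _; rewrite coin_meanZ ler_wpM2l //.
  rewrite coin_meanD coin_mean_cst coin_meanZ lerD2l ler_wpM2l ?invr_ge0 ?(ltW dl0) //.
  apply: (coin_variance (u01 x) (c := fun k => (i, k))) => // k l [] //.
rewrite sumr_const card_ord -[X in X <= _]mulr_natr mulrAC -/L mulrDr.
have h1' : L * dl <= e / 2.
  rewrite /dl mulrA ler_pdivrMr ?mulr_gt0 ?ltr_wpDl //.
  have -> : e / 2 * (2 * (L + 1)) = e * L + e by field.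
  by rewrite mulrC lerDl ltW.
have h2' : L * (dl^-1 / M%:R) <= e / 2.
  rewrite mulrA ler_pdivrMr ?ltr0n // ler_pdivrMr //.
  have := truncnS_gt (2 * L / (e * dl)); rewrite -/M.
  rewrite ltr_pdivrMr ?(mulr_gt0 e0 dl0) // => hM; move: (M%:R) hM => y hM; lra.
by rewrite (splitr e) lerD.
Qed.

End approximation.

Section lipschitz_of_vector.
Context d (T : measurableType d) (R : realType) (D : set T) (N : nat).
Context (X : 'I_N -> T -> R).
Hypothesis mX : forall i, measurable_fun D (X i).

Lemma bm_trigpoly p : trigpoly p -> bm D (fun w => p (fun i => X i w)).
Proof.
elim => {p} [th phi|p q _ IHp _ IHq|c p _ IH]; [|exact: bmD|exact: bmZ].
apply: bm_cos; apply: measurable_funD => //.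
by apply: measurable_sum => i; apply: measurable_funM.
Qed.

Lemma bm_truncated_square (K : R) : bm D (fun w => \sum_i Num.min 1 (X i w ^+ 2 / K ^+ 2)).
Proof.
apply: bm_sum => i _; split.
  apply: measurable_minr => //; apply: measurable_funM => //.
  exact: measurable_funX.
exists 1 => w _; rewrite ger0_norm; last by rewrite le_min ler01 divr_ge0 ?sqr_ge0.
by rewrite ge_min lexx.
Qed.

Lemma truncated_square_cvg0 w :
  (fun k => \sum_i Num.min 1 (X i w ^+ 2 / k.+1%:R ^+ 2)) @ \oo --> (0 : R).
Proof.
rewrite [X in _ --> X](_ : 0 = \sum_(i < N) 0 :> R); last by rewrite big1.
apply: cvg_finite_sum => i.
apply: (@squeeze_cvgr _ _ _ _ (fun=> 0) (fun k => X i w ^+ 2 * k.+1%:R^-1)).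
- near=> k; rewrite le_min ler01 divr_ge0 ?sqr_ge0 //= ge_min; apply/orP; right.
  by rewrite ler_wpM2l ?sqr_ge0 // lef_pV2 ?posrE ?exprn_gt0 // expr2 ler_peMr // ler1n.
- exact: cvg_cst.
- by rewrite -[X in _ --> X](mulr0 (X i w ^+ 2)); apply: cvgM; [exact: cvg_cst | exact: cvg_harmonic].
Unshelve. all: by end_near.
Qed.

Context (h : ('I_N -> R) -> R) (m : R).
Hypothesis m0 : 0 <= m.
Hypothesis h1 : forall x, `|h x| <= 1.
Hypothesis h_lip : forall x y, `|h x - h y| <= m * \sum_i `|x i - y i|.

(** Measurability comes from a pointwise limit of trigonometric polynomials, taking K = k + 1 and
    error 1 / (k + 1) in [trig_approx]. *)
Lemma bm_lipschitz : bm D (fun w => h (fun i => X i w)).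
Proof.
split; last by exists 1 => w _.
have /choice[p pP] : forall k : nat, exists p, trigpoly p /\
    forall x, `|h x - p x| <= k.+1%:R^-1 + 2 * \sum_i Num.min 1 (x i ^+ 2 / k.+1%:R ^+ 2).
  move=> k; have k0 : 0 < k.+1%:R :> R by rewrite ltr0n.
  have [|p [tp _ hp]] := trig_approx m0 h1 h_lip k0 (e := k.+1%:R^-1).
    by rewrite invr_gt0.
  by exists p.
apply: (@measurable_fun_cvg _ _ _ D (fun k w => p k (fun i => X i w))).
  by move=> k; have [] := bm_trigpoly (pP k).1.
move=> w _; apply: (cvg_sub0 _ (cvg_cst _)); apply: norm_cvg0.
apply: (@squeeze_cvgr _ _ _ _ (fun=> 0)
  (fun k => k.+1%:R^-1 + 2 * \sum_i Num.min 1 (X i w ^+ 2 / k.+1%:R ^+ 2))).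
- by near=> k; rewrite normr_ge0 /= distrC (pP k).2.
- exact: cvg_cst.
- rewrite -[X in _ --> X]addr0 -[X in _ --> _ + X](mulr0 2).
  apply: cvgD; first exact: cvg_harmonic.
  by apply: cvgM; [exact: cvg_cst | exact: truncated_square_cvg0].
Unshelve. all: by end_near.
Qed.

End lipschitz_of_vector.

Section finite_dimensional_convergence.
Context (R : realType) (beta : nat) (hbeta : beta = 1%N \/ beta = 2%N).
Context (P : forall n, probability (cmatrix R n) R) (HP : forall n, haar_prob beta (P n)).
Context (d : measure_display) (Omega : measurableType d) (Q : probability Omega R).
Context (W : R -> R -> Omega -> R) (HW : tied_down_bridge Q W).
Local Notation G n := (@haar_group R beta n).
Context (N : nat) (s t : 'I_N -> R).
Hypothesis st : forall i, unit_itv (s i) /\ unit_itv (t i).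

Let X n (M : cmatrix R n) i := Wn (P n) M (s i) (t i).
Let Xoo w i := Num.sqrt (2 / beta%:R) * W (s i) (t i) w.

Lemma measurable_Wn n a b (E : set (cmatrix R n)) :
  measurable_fun E (fun M => Wn (P n) M a b).
Proof.
apply: (@measurable_funS _ _ _ _ setT) => //; apply: measurable_funB => //.
exact: measurable_Tpq.
Qed.

Lemma trigpoly_cvg p : trigpoly p ->
  (fun n => \int[P n]_(M in G n) p (X M)) @ \oo --> \int[Q]_(w in setT) p (Xoo w).
Proof.
have bX n q : trigpoly q -> bm (G n) (fun M => q (X M)).
  by move=> tq; apply: (bm_trigpoly (X := fun i M => @X n M i)) => // i; exact: measurable_Wn.
have bXoo q : trigpoly q -> bm setT (fun w => q (Xoo w)).
  move=> tq; apply: (bm_trigpoly (X := fun i w => Xoo w i)) => // i.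
  by apply: measurable_funM => //; case: HW.
have mG n := @measurable_haar_group R beta n; have PG n := (HP n).1.
elim => {p} [th phi|p q tp IHp tq IHq|c p tp IH].
- exact: (phase_cvg hbeta HP HW st).
- rewrite (ExD measurableT (probability_setT Q) (bXoo _ tp) (bXoo _ tq)).
  under eq_fun do rewrite (ExD (mG _) (PG _) (bX _ _ tp) (bX _ _ tq)).
  exact: cvgD.
- rewrite (ExZ measurableT (probability_setT Q) _ (bXoo _ tp)).
  under eq_fun do rewrite (ExZ (mG _) (PG _) _ (bX _ _ tp)).
  by apply: cvgM; first exact: cvg_cst.
Qed.

Context (h : ('I_N -> R) -> R) (m : R).
Hypothesis m0 : 0 <= m.
Hypothesis h1 : forall x, `|h x| <= 1.
Hypothesis h_lip : forall x y, `|h x - h y| <= m * \sum_i `|x i - y i|.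

(** Convergence is known for a fixed trigonometric polynomial. The truncation term of [trig_approx]
    is small for large K, by bounded convergence on the limit side and uniformly in n on the matrix
    side. *)
Lemma fidi_cvg :
  (fun n => \int[P n]_(M in G n) h (X M)) @ \oo --> \int[Q]_(w in setT) h (Xoo w).
Proof.
have mG n := @measurable_haar_group R beta n; have PG n := (HP n).1.
have mX n i : measurable_fun (G n) (fun M => @X n M i) by exact: measurable_Wn.
have mXoo i : measurable_fun setT (fun w => Xoo w i).
  by apply: measurable_funM => //; case: HW.
have bh n : bm (G n) (fun M => h (X M)) := bm_lipschitz (mX n) m0 h1 h_lip.
have bhoo : bm setT (fun w => h (Xoo w)) := bm_lipschitz mXoo m0 h1 h_lip.
pose S k (x : 'I_N -> R) := \sum_i Num.min 1 (x i ^+ 2 / k.+1%:R ^+ 2).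
have bS n k : bm (G n) (fun M => S k (X M)) := bm_truncated_square (mX n) _.
have bSoo k : bm setT (fun w => S k (Xoo w)) := bm_truncated_square mXoo _.
apply/cvgrPdist_lt => e e0.
have e8 : 0 < e / 8 by rewrite divr_gt0.
have cS : (fun k => 2 * \int[Q]_(w in setT) S k (Xoo w)) @ \oo --> (0 : R).
  rewrite -[X in _ --> X](mulr0 2); apply: cvgM; first exact: cvg_cst.
  rewrite -[X in _ --> X](Ex_cst measurableT (probability_setT Q)).
  apply: (Ex_cvg measurableT (probability_setT Q) (C := N%:R)).
  - by move=> k; have [] := bSoo k.
  - move=> k w _; rewrite ger0_norm; last first.
      by apply: sumr_ge0 => i _; rewrite le_min ler01 divr_ge0 ?sqr_ge0.
    rewrite -[X in _ <= X%:R]card_ord -sumr_const; apply: ler_sum => i _.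
    by rewrite ge_min lexx.
  - by move=> w _; exact: (truncated_square_cvg0 (fun i w => Xoo w i)).
(* On the matrix side min (1, y^2 / K^2) <= |y| / K, so [E_norm_ctrT] bounds the truncation term by
   2 * N * 2 / K. *)
have cK : (fun k => 4 * N%:R * k.+1%:R^-1) @ \oo --> (0 : R).
  by rewrite -[X in _ --> X](mulr0 (4 * N%:R)); apply: cvgM; [exact: cvg_cst | exact: cvg_harmonic].
have [k [kS kK]] : exists k, 2 * \int[Q]_(w in setT) S k (Xoo w) < e / 8 /\
    4 * N%:R * k.+1%:R^-1 < e / 8 :> R.
  have [k1 _ hk1] := @cvgr_lt _ _ _ _ _ _ cS _ e8.
  have [k2 _ hk2] := @cvgr_lt _ _ _ _ _ _ cK _ e8.
  by exists (maxn k1 k2); split; [apply: hk1; rewrite /= leq_maxl | apply: hk2; rewrite /= leq_maxr].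
have k0 : 0 < k.+1%:R :> R by rewrite ltr0n.
have [p [tp p1 hp]] := trig_approx m0 h1 h_lip k0 e8.
have bp n : bm (G n) (fun M => p (X M)) := bm_trigpoly (mX n) tp.
have bpoo : bm setT (fun w => p (Xoo w)) := bm_trigpoly mXoo tp.
have hpoo : `|\int[Q]_(w in setT) h (Xoo w) - \int[Q]_(w in setT) p (Xoo w)| <= e / 8 + e / 8.
  rewrite -(ExB measurableT (probability_setT Q) bhoo bpoo).
  apply: (le_trans (Ex_norm measurableT (probability_setT Q) (bmB bhoo bpoo))).
  apply: (@le_trans _ _ (\int[Q]_(w in setT) (e / 8 + 2 * S k (Xoo w)))).
    apply: (Ex_le measurableT (probability_setT Q)) => //; first exact/bm_norm/bmB.
    by apply: bmD; [exact: bm_cst | exact: bmZ].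
  rewrite (ExD measurableT (probability_setT Q)) ?(Ex_cst measurableT (probability_setT Q));
    [|exact: bm_cst|exact: bmZ].
  by rewrite lerD2l (ExZ measurableT (probability_setT Q)) // ltW.
near=> n.
have n0 : (0 < n)%N by near: n; exists 1%N.
have hpn : `|\int[P n]_(M in G n) h (X M) - \int[P n]_(M in G n) p (X M)| <= e / 8 + e / 8.
  rewrite -(ExB (mG n) (PG n) (bh n) (bp n)).
  apply: (le_trans (Ex_norm (mG n) (PG n) (bmB (bh n) (bp n)))).
  pose a i := Num.truncn (n%:R * s i); pose b i := Num.truncn (n%:R * t i).
  have bW i : bm (G n) (fun M => `|ctrT (a i) (b i) M|) by apply: bm_norm; exact: bm_ctrT.
  have bsum : bm (G n) (fun M => \sum_i (2 / k.+1%:R) * `|ctrT (a i) (b i) M|).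
    by apply: bm_sum => i _; exact: bmZ.
  apply: (@le_trans _ _ (\int[P n]_(M in G n)
      (e / 8 + \sum_i (2 / k.+1%:R) * `|ctrT (a i) (b i) M|))).
    apply: (Ex_le (mG n) (PG n)); first exact/bm_norm/bmB.
      by apply: bmD => //; exact: bm_cst.
    move=> M _; apply: (le_trans (hp _)); rewrite lerD2l mulr_sumr.
    apply: ler_sum => i _; rewrite -mulrA ler_wpM2l //.
    rewrite -(WnE hbeta n0 (HP n)); [|by case: (st i)..].
    rewrite /X; move: (Wn _ _ _ _) => y; rewrite ge_min.
    rewrite -(real_normK (num_real y)); move: `|y| (normr_ge0 y) => {}y y0.
    have [yk|/ltW yk] := leP y k.+1%:R; apply/orP; [right|left].
      rewrite ler_pdivrMr ?exprn_gt0 // (_ : _ * _ ^+ 2 = y * k.+1%:R); last first.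
        by field; rewrite gt_eqF.
      by rewrite expr2 ler_wpM2l.
    by rewrite mulrC ler_pdivlMr // mul1r.
  rewrite (ExD (mG n) (PG n)) ?(Ex_cst (mG n) (PG n)) //; last exact: bm_cst.
  rewrite lerD2l (Ex_sum (mG n) (PG n)); last by move=> i; exact: bmZ.
  apply: (le_trans _ (ltW kK)).
  rewrite (_ : 4 * N%:R * _ = \sum_(i < N) 2 / k.+1%:R * 2); last first.
    by rewrite sumr_const card_ord -[RHS]mulr_natr; move: (k.+1%:R^-1) => y; ring.
  apply: ler_sum => i _; rewrite (ExZ (mG n) (PG n)) //.
  rewrite ler_wpM2l ?divr_ge0 //.
  by apply: (E_norm_ctrT hbeta n0 (HP n)); apply: truncn_le_n => //; case: (st i).
have hnear : `|\int[Q]_(w in setT) p (Xoo w) - \int[P n]_(M in G n) p (X M)| < e / 8.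
  by near: n; move/cvgrPdist_lt : (trigpoly_cvg tp); apply.
move: hpoo hpn hnear; move: (\int[Q]_(w in setT) h _) (\int[Q]_(w in setT) p _)
  (\int[P n]_(M in G n) h _) (\int[P n]_(M in G n) p _) => x y z v.
rewrite !ler_norml !ltr_norml => /andP[? ?] /andP[? ?] /andP[? ?].
by apply/andP; split; lra.
Unshelve. all: by end_near.
Qed.

End finite_dimensional_convergence.

(** * Chaining *)

Section increments.
Context (R : realType) (beta n : nat) (hbeta : beta = 1%N \/ beta = 2%N).
Context (n_gt0 : (0 < n)%N).
Local Notation C := R[i].
Local Notation G := (@haar_group R beta n).
Local Notation cmx := (cmatrix R n).
Local Notation Re := (@complex.Re R).
Local Notation pid p := (pid_mx p : 'M[C]_n).
Context (P : probability cmx R) (HP : haar_prob beta P).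
Local Notation E F := (Rintegral P G F).

Let mG : measurable G := @measurable_haar_group R beta n.
Let PG : P G = 1%E := HP.1.

(* Order 8 is needed: there are about (n / 2 ^ j)^2 increments of size 2 ^ j, and the sum of
   their eighth moments is of order (2 ^ j / n)^2, which is summable over j. *)
Lemma moment8 A Q (v : R) : bsproj A -> bsproj Q ->
  Num.min (Re (\tr A)) (Re (\tr Q)) <= v ->
  E (fun M => ctau A Q M ^+ 8) <= 105 * (2 * v / n%:R) ^+ 4.
Proof.
move=> pA pQ mv.
have m0 : 0 <= Num.min (Re (\tr A)) (Re (\tr Q)).
  rewrite le_min; have := hproj_tr_ge0 pA.1 pA.1; rewrite pA.1.1 => ->.
  by have := hproj_tr_ge0 pQ.1 pQ.1; rewrite pQ.1.1 => ->.
have step k := moment_step hbeta n_gt0 HP pA pQ (k := k).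
set x := 8 * Num.min _ _ / _ in step.
have b1 : 1 <= beta%:R :> R by rewrite ler1n; case: hbeta => ->.
have n0 : 0 < n%:R :> R by rewrite ltr0n.
have xv : x <= 2 * v / n%:R.
  rewrite /x ler_pdivrMr ?mulr_gt0 ?(lt_le_trans ltr01 b1) //.
  rewrite (_ : _ / _ * _ = 8 * v * beta%:R); last by field; rewrite gt_eqF.
  apply: (@le_trans _ _ (8 * v)); first by rewrite ler_wpM2l.
  by rewrite ler_peMr // mulr_ge0 // (le_trans m0).
have x0 : 0 <= x.
  by rewrite /x divr_ge0 ?mulr_ge0 // ltW // mulr_gt0 // mulr_gt0 // (lt_le_trans ltr01 b1).
move: x xv x0 step => x xv x0 step.
have s0 : E (fun M => ctau A Q M ^+ 0) = 1.
  by rewrite -[RHS](Ex_cst mG PG); apply: Ex_eq => M _; rewrite expr0.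
have {s0} s2 : E (fun M => ctau A Q M ^+ 2) <= x.
  by have := step 0%N isT; rewrite s0 mulr1 mul1r.
have s4 : E (fun M => ctau A Q M ^+ 4) <= 3 * x ^+ 2.
  apply: (le_trans (step 2%N isT)); rewrite expr2 mulrA ler_wpM2l //.
  by rewrite mulr_ge0.
have s6 : E (fun M => ctau A Q M ^+ 6) <= 15 * x ^+ 3.
  apply: (le_trans (step 4%N isT)).
  rewrite (_ : 15 * x ^+ 3 = 5%:R * x * (3 * x ^+ 2)); last by ring.
  by rewrite ler_wpM2l // mulr_ge0.
have s8 : E (fun M => ctau A Q M ^+ 8) <= 105 * x ^+ 4.
  apply: (le_trans (step 6%N isT)).
  rewrite (_ : 105 * x ^+ 4 = 7%:R * x * (15 * x ^+ 3)); last by ring.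
  by rewrite ler_wpM2l // mulr_ge0.
by apply: (le_trans s8); rewrite ler_wpM2l // lerXn2r // nnegrE // (le_trans x0).
Qed.

(** A difference of two centred T's is again a [ctau], for a projection of rank p' - p. *)
Lemma increment_row8 p p' q : (p <= p' <= n)%N -> (q <= n)%N ->
  E (fun M => (ctrT p' q M - ctrT p q M) ^+ 8) <= 105 * (2 * (p' - p)%:R / n%:R) ^+ 4.
Proof.
move=> /andP[pp' p'n] qn.
have pn := leq_trans pp' p'n.
have trE : \tr (pid p' - pid p) = (p' - p)%:R.
  by rewrite raddfB /= !tr_pid // natrB.
apply: le_trans (moment8 (v := (p' - p)%:R) (A := pid p' - pid p) (Q := pid q) _ _ _).
- rewrite le_eqVlt; apply/orP; left; apply/eqP; apply: Ex_eq => M _; apply: f_equal2 => //.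
  rewrite /ctau trE tauBl tr_pid // !Re_nat /ctrT /mT natrB //.
  by move: (tau _ _ _) (tau _ _ _) => x y; ring.
- by apply: bsproj_pidB; rewrite pp' p'n.
- exact: bsproj_pid.
- by rewrite trE Re_nat ge_min lexx.
Qed.

Lemma increment_col8 p q q' : (q <= q' <= n)%N -> (p <= n)%N ->
  E (fun M => (ctrT p q' M - ctrT p q M) ^+ 8) <= 105 * (2 * (q' - q)%:R / n%:R) ^+ 4.
Proof.
move=> /andP[qq' q'n] pn.
have qn := leq_trans qq' q'n.
have trE : \tr (pid q' - pid q) = (q' - q)%:R.
  by rewrite raddfB /= !tr_pid // natrB.
apply: le_trans (moment8 (v := (q' - q)%:R) (A := pid p) (Q := pid q' - pid q) _ _ _).
- rewrite le_eqVlt; apply/orP; left; apply/eqP; apply: Ex_eq => M _; apply: f_equal2 => //.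
  rewrite /ctau trE tauBr tr_pid // !Re_nat /ctrT /mT natrB //.
  by move: (tau _ _ _) (tau _ _ _) => x y; ring.
- exact: bsproj_pid.
- by apply: bsproj_pidB; rewrite qq' q'n.
- by rewrite trE Re_nat ge_min lexx orbT.
Qed.

End increments.

Section dyadic_chaining.
Context (R : realType) (n : nat) (w : nat -> nat -> R) (dl : nat -> R).
Hypothesis dl0 : forall j, 0 < dl j.

(** Indices are cut at n: the last cell may be incomplete. *)
Definition row_incr j a b := w (minn (a.+1 * 2 ^ j) n) (minn (b * 2 ^ j) n) -
  w (minn (a * 2 ^ j) n) (minn (b * 2 ^ j) n).
Definition col_incr j a b := w (minn (a * 2 ^ j) n) (minn (b.+1 * 2 ^ j) n) -
  w (minn (a * 2 ^ j) n) (minn (b * 2 ^ j) n).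

(* By [norm_le_pow8] this dominates every increment of dyadic level j at once; it replaces
   a maximum by a sum of moments. *)
Definition level_osc j : R := 2 * dl j + dl j ^- 7 *
  \sum_(a < (n %/ 2 ^ j).+1) \sum_(b < (n %/ 2 ^ j).+1)
    (row_incr j a b ^+ 8 + col_incr j a b ^+ 8).

Lemma norm_le_pow8 (x y : R) : 0 < x -> `|y| <= x + x ^- 7 * y ^+ 8.
Proof.
move=> x0; have y8 : y ^+ 8 = `|y| ^+ 8.
  by rewrite -[8%N]/(2 * 4)%N !exprM real_normK ?num_real.
rewrite y8; move: `|y| (normr_ge0 y) => {y8}y y0.
have x7 : 0 < x ^+ 7 by rewrite exprn_gt0.
have [yx|/ltW xy] := leP y x.
  by rewrite (le_trans yx) // lerDl mulr_ge0 ?invr_ge0 ?exprn_ge0 // ltW.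
rewrite (@le_trans _ _ (x ^- 7 * y ^+ 8)) //; last by rewrite lerDr ltW.
rewrite mulrC ler_pdivlMr // [leRHS]exprS ler_wpM2l // lerXn2r // nnegrE //.
exact: ltW.
Qed.

Lemma pow8_ge0 (y : R) : 0 <= y ^+ 8.
Proof. by rewrite -[8%N]/(2 * 4)%N exprM exprn_ge0 // sqr_ge0. Qed.

(** The two increments may sit in different cells, because [grid_step] passes through an
    intermediate corner. *)
Lemma incr_le_level j a a' b b' : (a <= n %/ 2 ^ j)%N -> (b <= n %/ 2 ^ j)%N ->
  (a' <= n %/ 2 ^ j)%N -> (b' <= n %/ 2 ^ j)%N ->
  `|row_incr j a b| + `|col_incr j a' b'| <= level_osc j.
Proof.
move=> an bn an' bn'; set K := (n %/ 2 ^ j)%N in an bn an' bn' *.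
apply: (le_trans (lerD (norm_le_pow8 _ (dl0 j)) (norm_le_pow8 _ (dl0 j)))).
rewrite addrACA -mulr2n -mulr_natl lerD2l -mulrDr ler_wpM2l //.
  by rewrite invr_ge0 exprn_ge0 // ltW.
have sum_ge (f : nat -> nat -> R) x y : (forall x y, 0 <= f x y) -> (x <= K)%N -> (y <= K)%N ->
    f x y <= \sum_(c < K.+1) \sum_(e < K.+1) f c e.
  move=> f0 xK yK; rewrite (bigD1 (Ordinal (xK : x < K.+1)%N)) //=.
  rewrite (bigD1 (Ordinal (yK : y < K.+1)%N)) //= -addrA lerDl addr_ge0 //.
    by apply: sumr_ge0.
  by apply: sumr_ge0 => i _; apply: sumr_ge0.
rewrite (_ : \sum_(c < K.+1) _ = \sum_(c < K.+1) \sum_(e < K.+1) row_incr j c e ^+ 8 +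
   \sum_(c < K.+1) \sum_(e < K.+1) col_incr j c e ^+ 8); last first.
  by rewrite -big_split; apply: eq_bigr => c _; rewrite -big_split.
apply: lerD.
  by apply: (sum_ge (fun c e => row_incr j c e ^+ 8)) => // *; exact: pow8_ge0.
by apply: (sum_ge (fun c e => col_incr j c e ^+ 8)) => // *; exact: pow8_ge0.
Qed.

Definition dyadic j p := (p %/ 2 ^ j * 2 ^ j)%N.

Lemma dyadic_le_n j p : (p <= n)%N -> minn (dyadic j p) n = dyadic j p.
Proof. by move=> pn; apply/minn_idPl; rewrite (leq_trans (leq_trunc_div _ _)). Qed.

Lemma level_osc_ge0 j : 0 <= level_osc j.
Proof. by apply: le_trans (@incr_le_level j 0 0 0 0 _ _ _ _); rewrite ?addr_ge0. Qed.

Lemma grid_step j a a' b b' : (a <= a' <= a.+1)%N -> (b <= b' <= b.+1)%N ->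
  (a' <= n %/ 2 ^ j)%N -> (b' <= n %/ 2 ^ j)%N ->
  `|w (minn (a' * 2 ^ j) n) (minn (b' * 2 ^ j) n) -
    w (minn (a * 2 ^ j) n) (minn (b * 2 ^ j) n)| <= level_osc j.
Proof.
move=> /andP[aa' a'a] /andP[bb' b'b] a'n b'n.
have an := leq_trans aa' a'n; have bn := leq_trans bb' b'n.
apply: (le_trans _ (incr_le_level an b'n an bn)).
rewrite -(subrKA (w (minn (a * 2 ^ j) n) (minn (b' * 2 ^ j) n))).
apply: (le_trans (ler_normD _ _)); apply: lerD.
  have [->|->] : a' = a \/ a' = a.+1 by lia.
    by rewrite subrr normr0.
  by [].
have [->|->] : b' = b \/ b' = b.+1 by lia.
  by rewrite subrr normr0.
by [].
Qed.

(** Rounding to a multiple of 2 ^ (j + 1) lowers a level j cell index by 0 or 1, so at most one row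
    and one column increment are needed. *)
Lemma dyadic_step j p q : (p <= n)%N -> (q <= n)%N ->
  `|w (dyadic j p) (dyadic j q) - w (dyadic j.+1 p) (dyadic j.+1 q)| <= level_osc j.
Proof.
move=> pn qn.
have dS x : (x <= n)%N -> exists2 c, (c <= x %/ 2 ^ j <= c.+1)%N &
    dyadic j.+1 x = minn (c * 2 ^ j) n.
  move=> xn; exists (x %/ 2 ^ j %/ 2 * 2)%N.
    by have := divn_eq (x %/ 2 ^ j) 2; have := ltn_pmod (x %/ 2 ^ j) (isT : 0 < 2)%N; lia.
  by rewrite -(dyadic_le_n j.+1 xn) /dyadic expnSr divnMA mulnA mulnAC.
have [a aP ->] := dS p pn; have [b bP ->] := dS q qn.
rewrite -(dyadic_le_n j pn) -(dyadic_le_n j qn).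
by apply: grid_step => //; exact: leq_div2r.
Qed.

Lemma dyadic_chain J p q : (p <= n)%N -> (q <= n)%N ->
  `|w p q - w (dyadic J p) (dyadic J q)| <= \sum_(j < J) level_osc j.
Proof.
move=> pn qn; elim: J => [|J IHJ].
  by rewrite big_ord0 /dyadic expn0 !divn1 !muln1 subrr normr0.
rewrite big_ord_recr /= -(subrKA (w (dyadic J p) (dyadic J q))).
by apply: (le_trans (ler_normD _ _)); apply: lerD => //; exact: dyadic_step.
Qed.

(* Two points at distance less than 2 ^ J lie in equal or adjacent cells of level J:
   hence the factor 2 and the level J itself in the sum. *)
Lemma chaining J p q p' q' : (p <= n)%N -> (q <= n)%N -> (p' <= p)%N -> (q' <= q)%N ->
  (p - p' < 2 ^ J)%N -> (q - q' < 2 ^ J)%N ->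
  `|w p q - w p' q'| <= 2 * \sum_(j < J.+1) level_osc j.
Proof.
move=> pn qn p'p q'q pJ qJ.
have near x x' : (x' <= x)%N -> (x - x' < 2 ^ J)%N ->
    (x' %/ 2 ^ J <= x %/ 2 ^ J <= (x' %/ 2 ^ J).+1)%N.
  move=> x'x xJ; rewrite leq_div2r //=.
  rewrite -ltnS ltn_divLR ?expn_gt0 // !mulSn.
  by have := divn_eq x' (2 ^ J); have := ltn_pmod x' (expn_gt0 2 J : _ = true); lia.
have p'n := leq_trans p'p pn; have q'n := leq_trans q'q qn.
have h1 := dyadic_chain J pn qn; have h2 := dyadic_chain J p'n q'n.
have h3 : `|w (dyadic J p) (dyadic J q) - w (dyadic J p') (dyadic J q')| <= level_osc J.
  rewrite -(dyadic_le_n J pn) -(dyadic_le_n J qn) -(dyadic_le_n J p'n) -(dyadic_le_n J q'n).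
  by apply: grid_step; rewrite ?near // leq_div2r.
have l0 := level_osc_ge0 J.
rewrite big_ord_recr /=; move: h1 h2 h3 l0.
move: (w p q) (w p' q') (w (dyadic J p) _) (w (dyadic J p') _) (\sum_(j < J) _) (level_osc J).
move=> x y z v S l; rewrite !ler_norml => /andP[? ?] /andP[? ?] /andP[? ?] ?.
by apply/andP; split; lra.
Qed.

End dyadic_chaining.

Section oscillation.
Context (R : realType) (beta n : nat) (hbeta : beta = 1%N \/ beta = 2%N).
Context (n_gt0 : (0 < n)%N).
Local Notation G := (@haar_group R beta n).
Local Notation cmx := (cmatrix R n).
Context (P : probability cmx R) (HP : haar_prob beta P).
Local Notation E F := (Rintegral P G F).
Local Notation WM := (fun M p q => ctrT p q M).

Let mG : measurable G := @measurable_haar_group R beta n.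
Let PG : P G = 1%E := HP.1.

Lemma bm_row_incr8 j a b : bm G (fun M => row_incr n (WM M) j a b ^+ 8).
Proof. by apply/bmX/bmB; exact: bm_ctrT. Qed.

Lemma bm_col_incr8 j a b : bm G (fun M => col_incr n (WM M) j a b ^+ 8).
Proof. by apply/bmX/bmB; exact: bm_ctrT. Qed.

Lemma bm_level_osc dl j : bm G (fun M => level_osc n (WM M) dl j).
Proof.
apply: bmD; first exact: bm_cst.
apply: bmZ; apply: bm_sum => a _; apply: bm_sum => b _.
by apply: bmD; [exact: bm_row_incr8 | exact: bm_col_incr8].
Qed.

(** A level has K^2 cells with K 2^j <= 2 n. Each carries two increments of eighth moment at most
    105 * 16 (2^j / n)^4, and 16 * 2 * 4 = 128. *)
Lemma E_level_osc (dl : nat -> R) j : 0 < dl j -> (2 ^ j <= n)%N ->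
  E (fun M => level_osc n (WM M) dl j) <=
  2 * dl j + 105 * 128 * dl j ^- 7 * (2 ^+ j / n%:R) ^+ 2.
Proof.
move=> dl0 jn.
have n0 : 0 < n%:R :> R by rewrite ltr0n.
pose v : R := 105 * (2 * 2 ^+ j / n%:R) ^+ 4.
have incr (a : nat) : (minn (a.+1 * 2 ^ j) n - minn (a * 2 ^ j) n <= 2 ^ j)%N.
  by rewrite mulSn; lia.
have mono (a : nat) : (minn (a * 2 ^ j) n <= minn (a.+1 * 2 ^ j) n <= n)%N.
  by rewrite geq_minr andbT mulSn; lia.
have pow_le (x : nat) : (x <= 2 ^ j)%N -> 105 * (2 * x%:R / n%:R) ^+ 4 <= v.
  move=> xj; rewrite ler_wpM2l // lerXn2r ?nnegrE ?divr_ge0 ?mulr_ge0 ?exprn_ge0 //.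
  by rewrite ler_pM2r ?invr_gt0 // ler_pM2l // -natrX ler_nat.
have row_le a b : E (fun M => row_incr n (WM M) j a b ^+ 8) <= v.
  apply: (le_trans (increment_row8 hbeta n_gt0 HP (mono a) (geq_minr _ _))).
  exact: pow_le.
have col_le a b : E (fun M => col_incr n (WM M) j a b ^+ 8) <= v.
  apply: (le_trans (increment_col8 hbeta n_gt0 HP (mono b) (geq_minr _ _))).
  exact: pow_le.
have bsum (a : 'I_(n %/ 2 ^ j).+1) : bm G (fun M => \sum_(b < (n %/ 2 ^ j).+1)
    (row_incr n (WM M) j a b ^+ 8 + col_incr n (WM M) j a b ^+ 8)).
  by apply: bm_sum => b _; apply: bmD; [exact: bm_row_incr8 | exact: bm_col_incr8].
rewrite /level_osc (ExD mG PG) ?(Ex_cst mG PG); last 2 first.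
- exact: bm_cst.
- by apply: bmZ; apply: bm_sum => a _; exact: bsum.
rewrite lerD2l (ExZ mG PG); last by apply: bm_sum => a _; exact: bsum.
rewrite (mulrC (105 * 128)) -mulrA ler_wpM2l ?invr_ge0 ?exprn_ge0 ?(ltW dl0) //.
rewrite (Ex_sum mG PG) //.
apply: (@le_trans _ _ (\sum_(a < (n %/ 2 ^ j).+1) \sum_(b < (n %/ 2 ^ j).+1) (v + v))).
  apply: ler_sum => a _; rewrite (Ex_sum mG PG); last first.
    by move=> b; apply: bmD; [exact: bm_row_incr8 | exact: bm_col_incr8].
  apply: ler_sum => b _; rewrite (ExD mG PG) ?lerD //; [exact: bm_row_incr8 | exact: bm_col_incr8].
rewrite !sumr_const !card_ord -mulrnA -[X in X <= _]mulr_natr natrM.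
set K := (_.+1)%:R; set z : R := 2 ^+ j.
have z0 : 0 < z by rewrite exprn_gt0.
have Kz : K * z <= 2 * n%:R.
  rewrite /K /z -natrX -!natrM ler_nat mulSn.
  by have := leq_trunc_div n (2 ^ j); lia.
have K0 : 0 <= K by [].
have -> : (v + v) * (K * K) = 105 * 32 * ((K * z) ^+ 2 * z ^+ 2 / n%:R ^+ 4).
  by rewrite /v -/z; field; rewrite gt_eqF.
have -> : 105 * 128 * (z / n%:R) ^+ 2 = 105 * 32 * ((2 * n%:R) ^+ 2 * z ^+ 2 / n%:R ^+ 4).
  by field; rewrite gt_eqF.
apply: ler_wpM2l; first exact: mulr_ge0.
rewrite ler_wpM2r ?invr_ge0 ?exprn_ge0 // ?(ltW n0) //.
by rewrite ler_wpM2r ?sqr_ge0 // lerXn2r // nnegrE mulr_ge0 // ltW.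
Qed.

Lemma geometric_sum_le (J : nat) : \sum_(j < J.+1) (9 / 10 : R) ^+ (J - j) <= 10.
Proof.
suff -> : \sum_(j < J.+1) (9 / 10 : R) ^+ (J - j) = 10 * (1 - (9 / 10) ^+ J.+1).
  rewrite mulrBr mulr1 lerBlDr lerDl mulr_ge0 // exprn_ge0 //; lra.
elim: J => [|J IHJ]; first by rewrite big_ord1 subn0; field.
rewrite big_ord_recl subn0 (eq_bigr (fun j : 'I_J.+1 => (9 / 10 : R) ^+ (J - j))) ?IHJ.
  by rewrite !exprS; move: (_ ^+ J) => x; field.
by move=> j _; rewrite /= /bump /= add1n subSS.
Qed.

(** With r = (9 / 10)^i and u = 2^i, the last hypothesis is 4 (9 / 10)^8 >= 1 raised to the power i:
    thresholds decrease geometrically towards fine levels, yet slowly enough for their power -7 to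
    be paid by the decay of the moments. *)
Lemma level_weight_le (K x r u z : R) : 0 <= K -> 0 < x -> 0 < r -> 1 <= u ^+ 2 * r ^+ 8 ->
  2 * (x * r) + K * (x * r) ^- 7 * z ^+ 2 <= (2 * x + K * x ^- 7 * (u * z) ^+ 2) * r.
Proof.
move=> K0 x0 r0 ur; rewrite -subr_ge0.
have -> : (2 * x + K * x ^- 7 * (u * z) ^+ 2) * r - (2 * (x * r) + K * (x * r) ^- 7 * z ^+ 2) =
    K * z ^+ 2 * (u ^+ 2 * r ^+ 8 - 1) / (x ^+ 7 * r ^+ 7).
  by field; rewrite !gt_eqF.
rewrite divr_ge0 //; first by rewrite mulr_ge0 ?subr_ge0 // mulr_ge0 // sqr_ge0.
by rewrite mulr_ge0 // exprn_ge0 // ltW.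
Qed.

Lemma E_osc J (eta : R) : 0 < eta -> (2 ^ J <= n)%N ->
  E (fun M => \sum_(j < J.+1) level_osc n (WM M) (fun j => eta * (9 / 10) ^+ (J - j)) j) <=
  20 * eta + 105 * 128 * 10 * eta ^- 7 * (2 ^+ J / n%:R) ^+ 2.
Proof.
move=> eta0 Jn; pose dl j : R := eta * (9 / 10) ^+ (J - j).
have r0 : 0 < 9 / 10 :> R by lra.
rewrite (Ex_sum mG PG); last by move=> j; exact: bm_level_osc.
set c := 2 * eta + 105 * 128 * eta ^- 7 * (2 ^+ J / n%:R) ^+ 2.
apply: (@le_trans _ _ (\sum_(j < J.+1) c * (9 / 10) ^+ (J - j))).
  apply: ler_sum => j _; have jJ : (j <= J)%N by rewrite -ltnS.
  have dl0 : 0 < dl j by rewrite mulr_gt0 // exprn_gt0.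
  apply: (le_trans (E_level_osc dl0 _)); first by rewrite (leq_trans _ Jn) // leq_exp2l.
  rewrite /c; have -> : 2 ^+ J / n%:R = 2 ^+ (J - j) * (2 ^+ j / n%:R) :> R by rewrite mulrA -exprD subnK.
  rewrite /dl; apply: level_weight_le => //.
  rewrite -!exprM !(mulnC (J - j)%N) !exprM -exprMn.
  rewrite exprn_ege1 // -[8%N]/(2 * 2 * 2)%N !(exprM (9 / 10)).
  have sq (a b : R) : 0 <= a -> a <= b -> a * a <= b ^+ 2.
    by move=> a0 ab; rewrite expr2 ler_pM.
  (* Three squarings, rounded down at each stage, give (9 / 10)^8 >= 36 / 100 > 1 / 4. *)
  have h2 : 8 / 10 <= (9 / 10) ^+ 2 :> R by apply: (le_trans _ (sq (9 / 10) _ _ (lexx _))); lra.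
  have h4 : 6 / 10 <= ((9 / 10) ^+ 2) ^+ 2 :> R by apply: (le_trans _ (sq _ _ _ h2)); lra.
  have h8 := sq _ _ (ltac:(lra) : 0 <= 6 / 10 :> R) h4.
  by rewrite (expr2 2); move: (_ ^+ 2 ^+ 2 ^+ 2) h8 => y h8; lra.
rewrite -mulr_sumr (le_trans (ler_wpM2l _ (geometric_sum_le J))) //.
  by rewrite /c addr_ge0 ?mulr_ge0 ?invr_ge0 ?exprn_ge0 ?sqr_ge0 // ltW.
rewrite /c le_eqVlt; apply/orP; left; apply/eqP.
by move: (eta ^- 7) (_ ^+ 2) => x y; ring.
Qed.

End oscillation.

Section grid_oscillation.
Context (R : realType) (beta : nat) (hbeta : beta = 1%N \/ beta = 2%N).

(** Rounding s down to mesh 1 / k lowers the matrix index by less than n / k + 1; the bound is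
    multiplied by k to stay among integers. *)
Lemma truncn_grid_close (n k : nat) (s : R) : (0 < k <= n)%N -> 0 <= s ->
  (Num.truncn (n%:R * ((Num.truncn (k%:R * s))%:R / k%:R) : R) <= Num.truncn (n%:R * s))%N /\
  ((Num.truncn (n%:R * s) - Num.truncn (n%:R * ((Num.truncn (k%:R * s))%:R / k%:R) : R)) * k < n + k)%N.
Proof.
move=> /andP[k0 kn] s0.
have kR : 0 < k%:R :> R by rewrite ltr0n.
have nR : 0 < n%:R :> R by rewrite ltr0n (leq_trans k0).
have /andP[a1 a2] := truncn_itv (mulr_ge0 (ltW kR) s0).
have /andP[b1 b2] := truncn_itv (mulr_ge0 (ltW nR) s0).
move: (Num.truncn (k%:R * s)) (Num.truncn (n%:R * s)) a1 a2 b1 b2 => c p a1 a2 b1 b2.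
have y0 : 0 <= n%:R * (c%:R / k%:R) :> R by rewrite !mulr_ge0 ?invr_ge0 // ltW.
have /andP[c1 c2] := truncn_itv y0.
move: (Num.truncn _) c1 c2 => p' c1 c2.
have cs : c%:R / k%:R <= s by rewrite ler_pdivrMr // mulrC.
split.
  rewrite -ltnS -(@ltr_nat R); apply: le_lt_trans b2; apply: (le_trans c1).
  by rewrite ler_pM2l.
have : (k * p < n + k * p'.+1)%N.
  rewrite -(@ltr_nat R) natrD !natrM.
  have h1 : n%:R * c%:R < k%:R * p'.+1%:R :> R.
    by move: c2; rewrite mulrA ltr_pdivrMr // (mulrC k%:R).
  have h2 : k%:R * p%:R <= k%:R * (n%:R * s) by rewrite ler_pM2l.
  have h3 : n%:R * (k%:R * s) < n%:R * c.+1%:R by rewrite ltr_pM2l.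
  move: h2; rewrite mulrCA => h2; move: h3; rewrite -natr1 => h3; nra.
by rewrite mulnBl mulnS; clear -k0; lia.
Qed.

(** 2^J lies between 2 n / k and 4 n / k. Being above n / k + 1, it lets [chaining] bridge a grid
    cell; being at most 4 n / k, it makes the bound of [E_osc] small for large k. *)
Lemma dyadic_level (n k : nat) : (4 <= k <= n)%N -> exists J,
  [/\ (2 ^ J * k <= 4 * n)%N, (2 ^ J <= n)%N & (2 * n < 2 ^ J * k)%N].
Proof.
move=> /andP[k4 kn]; set u := (2 * n %/ k)%N.
have k0 : (0 < k)%N by lia.
have u0 : (0 < u)%N by rewrite divn_gt0 //; lia.
exists (trunc_log 2 u).+1.
have h1 := trunc_logP (isT : 1 < 2)%N u0; have h2 := trunc_log_ltn u (isT : 1 < 2)%N.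
have h3 := divn_eq (2 * n) k; have h4 := ltn_pmod (2 * n) k0; rewrite -/u in h3.
move: h1 h2; rewrite expnS; set z := (2 ^ _)%N => h1 h2.
have h5 : (2 * z * k <= 4 * n)%N by nia.
by split => //; nia.
Qed.

(** The tightness estimate: one random variable dominates the oscillation over all cells at once,
    with a mean small uniformly in n. *)
Lemma Wn_osc (e : R) : 0 < e -> exists k0, (0 < k0)%N /\ forall k n, (k0 <= k <= n)%N ->
  forall P : probability (cmatrix R n) R, haar_prob beta P -> exists Rv : cmatrix R n -> R,
  [/\ bm (@haar_group R beta n) Rv,
    (forall M s t, unit_itv s -> unit_itv t ->
      `|Wn P M s t - Wn P M ((Num.truncn (k%:R * s))%:R / k%:R)
                            ((Num.truncn (k%:R * t))%:R / k%:R)| <= Rv M) &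
    \int[P]_(M in @haar_group R beta n) Rv M <= e].
Proof.
(* After the factor 2 of [chaining], the first term of [E_osc] is 40 eta = e / 2 and the second at
   most c / k, which is below e / 2 once k > 2 c / e. *)
move=> e0; pose eta := e / 80.
have eta0 : 0 < eta by rewrite divr_gt0.
have [K K0 KE] : exists2 K : R, 0 <= K & 105 * 128 * 10 = K.
  exists (105 * 128 * 10); last by [].
  by apply: mulr_ge0; [exact: mulr_ge0 | exact: ler0n].
pose c := 2 * K * eta ^- 7 * 16.
have c0 : 0 <= c by rewrite !mulr_ge0 // invr_ge0 exprn_ge0 // ltW.
exists (maxn 4 (Num.truncn (2 * c / e)).+1); split; first by rewrite leq_max.
move=> k n /andP[]; rewrite geq_max => /andP[k4 kc] kn P HP.
have n0 : (0 < n)%N by lia.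
have k0 : (0 < k)%N by lia.
have [|J [J1 J2 J3]] := @dyadic_level n k; first by rewrite k4 kn.
pose dl (j : nat) : R := eta * (9 / 10) ^+ (J - j).
have dl0 j : 0 < dl j by rewrite mulr_gt0 // exprn_gt0 // divr_gt0.
exists (fun M => 2 * \sum_(j < J.+1) level_osc n (fun p q => ctrT p q M) dl j); split.
- by apply: bmZ; apply: bm_sum => j _; exact: bm_level_osc.
- move=> M s t us ut.
  have u0 (x : R) : unit_itv x -> 0 <= x :> R by rewrite /unit_itv /= in_itv /= => /andP[].
  have ug (x : R) : unit_itv x -> unit_itv ((Num.truncn (k%:R * x))%:R / k%:R : R).
    move=> ux; have := truncn_le_n k ux; rewrite /unit_itv /= in_itv /= => hk.
    by rewrite divr_ge0 //= ler_pdivrMr ?ltr0n // mul1r ler_nat.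
  have us' := ug _ us; have ut' := ug _ ut.
  rewrite !(WnE hbeta n0 HP) //.
  have kn' : (0 < k <= n)%N by rewrite k0.
  have [s1 s2] := truncn_grid_close kn' (u0 _ us).
  have [t1 t2] := truncn_grid_close kn' (u0 _ ut).
  apply: (@chaining R n (fun p q => ctrT p q M) dl dl0) => //; rewrite ?truncn_le_n //.
    by rewrite -(ltn_pmul2r k0) (leq_trans s2) //; clear -J3 kn; lia.
  by rewrite -(ltn_pmul2r k0) (leq_trans t2) //; clear -J3 kn; lia.
have mG := @measurable_haar_group R beta n.
rewrite (ExZ mG HP.1); last by apply: bm_sum => j _; exact: bm_level_osc.
have := E_osc hbeta n0 HP eta0 J2; rewrite KE => hE.
apply: (le_trans (ler_wpM2l _ hE)) => //.
have nR : 0 < n%:R :> R by rewrite ltr0n.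
have kR : 0 < k%:R :> R by rewrite ltr0n.
have x4 : 2 ^+ J / n%:R <= 4 / k%:R :> R.
  by rewrite ler_pdivrMr // mulrAC ler_pdivlMr // -natrX -!natrM ler_nat.
have x16 : (2 ^+ J / n%:R) ^+ 2 <= 16 / k%:R :> R.
  have : (2 ^+ J / n%:R) ^+ 2 <= (4 / k%:R) ^+ 2 :> R.
    by rewrite lerXn2r // nnegrE divr_ge0 ?exprn_ge0 // ltW.
  move/le_trans; apply; rewrite exprMn exprVn (_ : 4 ^+ 2 = 16 :> R); last by ring.
  rewrite ler_wpM2l // lef_pV2 ?posrE ?exprn_gt0 // expr2.
  by apply: ler_peMr; [exact: ltW | rewrite ler1n].
apply: (@le_trans _ _ (2 * (20 * eta) + c / k%:R)).
  rewrite mulrDr lerD2l /c -!mulrA !ler_wpM2l ?invr_ge0 ?exprn_ge0 // ltW //.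
have -> : 2 * (20 * eta) = e / 2 by rewrite /eta; field.
rewrite [leRHS]splitr lerD2l ler_pdivrMr //.
move: kc; rewrite -(@ler_nat R).
have := truncnS_gt (2 * c / e); move: (Num.truncn _) => m h1 h2.
have : 2 * c / e < k%:R by exact: lt_le_trans h1 h2.
by rewrite ltr_pdivrMr // => h3; lra.
Qed.

End grid_oscillation.

(** * Functionals of paths *)

Section paths.
Context (R : realType).
Implicit Types (x y : R -> R -> R) (s t : R).

Definition grid (k : nat) (s : R) : R := (Num.truncn (k%:R * s))%:R / k%:R.

Lemma unit_itvE s : unit_itv s = (0 <= s <= 1) :> Prop.
Proof. by rewrite /unit_itv /= in_itv. Qed.

Lemma unit_grid k s : (0 < k)%N -> unit_itv s -> unit_itv (grid k s).
Proof.
move=> k0 us; have := truncn_le_n k us; rewrite unit_itvE /grid => hk.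
by rewrite divr_ge0 //= ler_pdivrMr ?ltr0n // mul1r ler_nat.
Qed.

Lemma grid_close k s : (0 < k)%N -> unit_itv s -> `|grid k s - s| < k%:R^-1.
Proof.
rewrite unit_itvE => k0 /andP[s0 _]; have kR : 0 < k%:R :> R by rewrite ltr0n.
have /andP[h1 h2] := truncn_itv (mulr_ge0 (ltW kR) s0).
rewrite distrC /grid (_ : s - _ = (k%:R * s - (Num.truncn (k%:R * s))%:R) / k%:R); last first.
  by field; rewrite gt_eqF.
rewrite ger0_norm; last by rewrite divr_ge0 ?subr_ge0 // ltW.
by rewrite -[ltRHS]mul1r ltr_pM2r ?invr_gt0 // ltrBlDl natr1.
Qed.

Lemma truncn_grid k s : (0 < k)%N -> unit_itv s ->
  Num.truncn (k%:R * grid k s) = Num.truncn (k%:R * s).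
Proof.
by move=> k0 us; rewrite /grid mulrC divfK ?natrK // pnatr_eq0 -lt0n.
Qed.

(** From the right the index is that of s; from the left it is the same unless k s is an integer,
    when it is one less. *)
Lemma truncn_one_sided k s (b : bool) : unit_itv s -> exists (c : nat) (d : R), [/\ 0 < d,
  (b -> c = Num.truncn (k%:R * s)) &
  forall s' : R, unit_itv s' -> qrel b s' s -> `|s' - s| < d -> Num.truncn (k%:R * s' : R) = c].
Proof.
rewrite unit_itvE => /andP[s0 s1].
have [->|k0] := posnP k.
  by exists (Num.truncn (0 * s)), 1; split => // s' _ _ _; rewrite !mul0r.
have kR : 0 < k%:R :> R by rewrite ltr0n.
have /andP[h1 h2] := truncn_itv (mulr_ge0 (ltW kR) s0).
move: (Num.truncn _) h1 h2 => c h1 h2.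
have dist d s' : `|s' - s| < d / k%:R -> `|k%:R * s' - k%:R * s| < d.
  by rewrite -mulrBr normrM gtr0_norm // ltr_pdivlMr // mulrC.
case: b => /=.
  exists c, ((c.+1%:R - k%:R * s) / k%:R); split => //.
    by rewrite divr_gt0 // subr_gt0.
  move=> s' _ ss' /dist; rewrite ltr_norml => /andP[_ hs].
  apply: truncn_def; rewrite (le_trans h1) ?ler_pM2l //=; lra.
have [h1'|h1'] := ltP (c%:R) (k%:R * s).
  exists c, ((k%:R * s - c%:R) / k%:R); split => //.
    by rewrite divr_gt0 // subr_gt0.
  move=> s' _ ss' /dist; rewrite ltr_norml => /andP[hs _].
  apply: truncn_def; rewrite (lt_trans _ h2) ?ltr_pM2l // andbT; lra.
(* Here k s = c. If c = 0 then s = 0 and no point of [0, 1] lies strictly to its left, so the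
   predecessor of 0 is never met. *)
exists c.-1, (1 / k%:R); split => //; first by rewrite divr_gt0.
move=> s'; rewrite unit_itvE => /andP[s'0 _] ss' /dist; rewrite ltr_norml => /andP[hs _].
have c0 : (0 < c)%N.
  rewrite lt0n; apply/eqP => c0; move: h1'; rewrite c0 leNgt.
  by rewrite mulr_gt0 // (le_lt_trans s'0).
have ss2 : k%:R * s' < k%:R * s by rewrite ltr_pM2l.
apply: truncn_def; rewrite prednK //.
have : c%:R = c.-1%:R + 1 :> R by rewrite natr1 prednK.
by move=> cE; apply/andP; split; lra.
Qed.

Lemma inD_grid k (v : nat -> nat -> R) :
  inD (fun s t => v (Num.truncn (k%:R * s)) (Num.truncn (k%:R * t))).
Proof.
have ql (s t : R) (b1 b2 : bool) : unit_itv s -> unit_itv t -> exists c c',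
    [/\ b1 -> c = Num.truncn (k%:R * s), b2 -> c' = Num.truncn (k%:R * t) &
    quadrant_lim (fun s t : R => v (Num.truncn (k%:R * s)) (Num.truncn (k%:R * t))) s t b1 b2 (v c c')].
  move=> us ut; have [c [d [d0 hc hd]]] := @truncn_one_sided k s b1 us.
  have [c' [d' [d'0 hc' hd']]] := @truncn_one_sided k t b2 ut.
  exists c, c'; split => // e e0; exists (Num.min d d'); first by rewrite lt_min d0.
  move=> s' t' us' ut' q1 q2; rewrite !lt_min => /andP[sd _] /andP[_ td].
  by rewrite (hd _ us' q1 sd) (hd' _ ut' q2 td) subrr normr0.
move=> s t us ut; split.
  have [c [c' [h1 h2 hq]]] := ql s t true true us ut.
  by rewrite -h1 // -h2.
by move=> b1 b2; have [c [c' [_ _ hq]]] := ql s t b1 b2 us ut; exists (v c c').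
Qed.

Definition continuous_path x :=
  {within @unit_itv R `*` @unit_itv R, continuous (fun p : R * R => x p.1 p.2)}.

Lemma continuous_path_at x s t (e : R) : continuous_path x -> unit_itv s -> unit_itv t -> 0 < e ->
  exists2 d : R, 0 < d & forall s' t', unit_itv s' -> unit_itv t' ->
    `|s' - s| < d -> `|t' - t| < d -> `|x s' t' - x s t| < e.
Proof.
move=> cx us ut e0.
have /subspace_continuousP/(_ (s, t) (conj us ut)) := cx.
move=> /cvgrPdist_lt /(_ e e0) /nbhs_ballP[d /= d0 hd].
exists d => // s' t' us' ut' ss tt.
rewrite distrC; apply: (hd (s', t')) => //.
by split; rewrite /ball /= distrC.
Qed.

Lemma inD_continuous x : continuous_path x -> inD x.
Proof.
move=> cx; have ql (s t : R) (b1 b2 : bool) : unit_itv s -> unit_itv t -> quadrant_lim x s t b1 b2 (x s t).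
  move=> us ut e e0; have [d d0 hd] := continuous_path_at cx us ut e0.
  by exists d => // *; exact: hd.
by move=> s t us ut; split; [exact: ql | move=> b1 b2; exists (x s t); exact: ql].
Qed.

(** Uniformity comes from compactness of the square, covered by neighbourhoods of points taken
    jointly with a neighbourhood of infinity for k. *)
Lemma continuous_path_grid x (e : R) : continuous_path x -> 0 < e ->
  \forall k \near \oo, forall s t, unit_itv s -> unit_itv t ->
    `|x s t - x (grid k s) (grid k t)| <= e.
Proof.
move=> cx e0.
have cpt : compact (@unit_itv R `*` @unit_itv R).
  by apply: compact_setX; exact: segment_compact.
have /compact_near_coveringP/near_covering_withinP := cpt.
move=> /(_ nat \oo (fun k (p : R * R) =>
  `|x p.1 p.2 - x (grid k p.1) (grid k p.2)| <= e)) H.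
have {}H : \forall k \near \oo, @unit_itv R `*` @unit_itv R `<=`
    (fun p : R * R => `|x p.1 p.2 - x (grid k p.1) (grid k p.2)| <= e).
  apply: H => -[s t] [/= us ut].
  have e2 : 0 < e / 2 by rewrite divr_gt0.
  have [d d0 hd] := continuous_path_at cx us ut e2.
  have d2 : 0 < d / 2 by rewrite divr_gt0.
  (* k > 2 / d keeps the rounded point within d / 2 of the original one, hence within d of the
     centre. *)
  exists (ball (s, t) (d / 2), [set k : nat | (Num.truncn (2 / d) < k)%N]).
    split => /=; first exact: nbhsx_ballx.
    by exists (Num.truncn (2 / d)).+1.
  move=> [[s' t'] k] /= [[bs bt] hk] [us' ut'].
  have k0 : (0 < k)%N by rewrite (leq_trans _ hk).
  have kd : k%:R^-1 < d / 2.
    rewrite -[d / 2]invrK ltf_pV2 ?posrE ?invr_gt0 // ?ltr0n //.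
    rewrite invf_div (lt_le_trans (truncnS_gt _)) // ler_nat //.
  have near_s a a' : unit_itv a' -> ball a (d / 2) a' -> `|a' - a| < d /\ `|grid k a' - a| < d.
    move=> ua; rewrite /ball /= distrC => aa; split; first by rewrite (lt_le_trans aa) // ler_pdivrMr // ler_peMr ?ltW // ltr1n.
    have gk := grid_close k0 ua.
    rewrite -(subrKA a') (le_lt_trans (ler_normD _ _)) // (splitr d) ltrD //.
    exact: lt_trans kd.
  have [s1 s2] := near_s s s' us' bs; have [t1 t2] := near_s t t' ut' bt.
  have h1 := hd _ _ us' ut' s1 t1.
  have h2 := hd _ _ (unit_grid k0 us') (unit_grid k0 ut') s2 t2.
  rewrite -(subrKA (x s t)) (le_trans (ler_normD _ _)) // (splitr e) lerD //; first exact: ltW.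
  by rewrite distrC ltW.
near=> k => s t us ut.
by apply: (near H k _ (s, t)).
Unshelve. all: by end_near.
Qed.

(** The identity is a time change. Skorokhod continuity thus implies sup-norm continuity, the form
    in which it enters [inf_conv_cvg]. *)
Lemma skorokhod_dist_le x y (r : R) : 0 <= r ->
  (forall s t, unit_itv s -> unit_itv t -> `|x s t - y s t| <= r) ->
  (skorokhod_dist x y <= r%:E)%E.
Proof.
move=> r0 xy.
have sub0 (A : set R) : (ereal_sup [set (`|s - s|)%:E | s in A] <= r%:E)%E.
  by apply: ge_ereal_sup => _ [s _ <-]; rewrite lee_fin subrr normr0.
apply: (@le_trans _ _ (maxe (ereal_sup [set (`|x s t - y s t|)%:E | s in @unit_itv R
                          & t in @unit_itv R])
             (maxe (ereal_sup [set (`|s - s|)%:E | s in @unit_itv R])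
                   (ereal_sup [set (`|t - t|)%:E | t in @unit_itv R])))).
  apply: ereal_inf_lbound; exists id, id; split => //.
    by split => //; split => //; split => //; apply: continuous_subspaceT => z; exact: cvg_id.
  by split => //; split => //; split => //; apply: continuous_subspaceT => z; exact: cvg_id.
rewrite !ge_max !sub0 !andbT.
by apply: ge_ereal_sup => _ [s us [t ut <-]]; rewrite lee_fin xy.
Qed.

End paths.

Section lipschitz_functionals.
Context (R : realType) (g : (R -> R -> R) -> R) (m : R).
Hypothesis m0 : 0 <= m.
Hypothesis g1 : forall x, inD x -> `|g x| <= 1.
Hypothesis g_lip : forall x y (r : R), inD x -> inD y ->
  (forall s t : R, unit_itv s -> unit_itv t -> `|x s t - y s t| <= r) -> `|g x - g y| <= m * r.

Section grid_functional.
Context (k : nat) (k0 : (0 < k)%N).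
Local Notation N := #|{: 'I_k.+1 * 'I_k.+1}|.

Definition grid_s (i : 'I_N) : R := (enum_val i).1%:R / k%:R.
Definition grid_t (i : 'I_N) : R := (enum_val i).2%:R / k%:R.

(** The passage from vectors to paths, which turns [g] into a function of finitely many reals. For
    an index beyond k, [inord] falls back to 0; this does not occur on [0, 1]. *)
Definition step_path (v : 'I_N -> R) (s t : R) : R :=
  v (enum_rank (inord (Num.truncn (k%:R * s)), inord (Num.truncn (k%:R * t)))).

Definition grid_values (x : R -> R -> R) (i : 'I_N) : R := x (grid_s i) (grid_t i).

Lemma unit_grid_st i : unit_itv (grid_s i) /\ unit_itv (grid_t i).
Proof.
have kR : 0 < k%:R :> R by rewrite ltr0n.
split; rewrite unit_itvE divr_ge0 //= ler_pdivrMr // mul1r ler_nat -ltnS.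
  exact: ltn_ord (enum_val i).1.
exact: ltn_ord (enum_val i).2.
Qed.

Lemma inD_step_path v : inD (step_path v).
Proof. exact: (inD_grid k (fun a b => v (enum_rank (inord a, inord b)))). Qed.

Lemma step_path_values x s t : unit_itv s -> unit_itv t ->
  step_path (grid_values x) s t = x (grid k s) (grid k t).
Proof.
move=> us ut; rewrite /step_path /grid_values /grid_s /grid_t enum_rankK /=.
by rewrite !inordK // ltnS truncn_le_n.
Qed.

Lemma step_functional_le1 v : `|g (step_path v)| <= 1.
Proof. exact/g1/inD_step_path. Qed.

Lemma step_functional_lip v v' :
  `|g (step_path v) - g (step_path v')| <= m * \sum_i `|v i - v' i|.
Proof.
apply: g_lip; [exact: inD_step_path..|] => s t _ _.
rewrite /step_path; move: (enum_rank _) => i.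
by rewrite (bigD1 i) //= lerDl sumr_ge0.
Qed.

Lemma step_functional_close x (r : R) : inD x ->
  (forall s t, unit_itv s -> unit_itv t -> `|x s t - x (grid k s) (grid k t)| <= r) ->
  `|g x - g (step_path (grid_values x))| <= m * r.
Proof.
move=> Dx xr; apply: g_lip => //; first exact: inD_step_path.
by move=> s t us ut; rewrite step_path_values // xr.
Qed.

End grid_functional.
Arguments grid_values : clear implicits.

Context (beta : nat) (hbeta : beta = 1%N \/ beta = 2%N).
Context (P : forall n, probability (cmatrix R n) R) (HP : forall n, haar_prob beta (P n)).
Context (d : measure_display) (Omega : measurableType d) (Q : probability Omega R).
Context (W : R -> R -> Omega -> R) (HW : tied_down_bridge Q W).
Local Notation G n := (@haar_group R beta n).
Local Notation X n M := (Wn (P n) M).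
Local Notation Xoo w := (fun s t => Num.sqrt (2 / beta%:R) * W s t w).

Lemma inD_Wn n M : inD (X n M).
Proof.
exact: (inD_grid n (fun p q => Tpq p q M - fine (\int[P n]_(N in setT) (Tpq p q N)%:E)%E)).
Qed.

Lemma continuous_bridge w : continuous_path (Xoo w).
Proof.
have [_ /(_ w)/subspace_continuousP cW _] := HW; apply/subspace_continuousP => p ap.
by apply: cvgM; [exact: cvg_cst | exact: cW].
Qed.

Lemma inD_bridge w : inD (Xoo w).
Proof. exact/inD_continuous/continuous_bridge. Qed.

(** The path is already a step path of mesh 1 / n, so [g] sees it through finitely many values;
    measurability follows from [bm_step_Wn]. *)
Lemma lip_WnE n M : (0 < n)%N -> g (X n M) = g (step_path (grid_values n (X n M))).
Proof.
move=> n0; apply/eqP; rewrite -subr_eq0 -normr_le0 -(mulr0 m).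
apply: step_functional_close => //; first exact: inD_Wn.
move=> s t us ut; rewrite /Wn /= !truncn_grid // subrr normr0 //.
Qed.

Lemma bm_step_Wn n k E : (0 < k)%N -> bm E (fun M => g (step_path (grid_values k (X n M)))).
Proof.
move=> k0; apply: (@bm_lipschitz _ _ _ E _ (fun i M => grid_values k (X n M) i) _
  (fun v => g (step_path v)) m m0 (@step_functional_le1 k) (@step_functional_lip k)) => i.
exact: measurable_Wn.
Qed.

Lemma bm_lip_Wn n E : (0 < n)%N -> bm E (fun M => g (X n M)).
Proof.
by move=> n0; under eq_fun do rewrite lip_WnE //; exact: bm_step_Wn.
Qed.

Lemma bm_step_bridge k : (0 < k)%N -> bm setT (fun w => g (step_path (grid_values k (Xoo w)))).
Proof.
move=> k0; apply: (@bm_lipschitz _ _ _ setT _ (fun i w => grid_values k (Xoo w) i) _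
  (fun v => g (step_path v)) m m0 (@step_functional_le1 k) (@step_functional_lip k)) => i.
by apply: measurable_funM => //; have [mW _ _] := HW.
Qed.

Lemma step_bridge_cvg w :
  (fun k => g (step_path (grid_values k.+1 (Xoo w)))) @ \oo --> g (Xoo w).
Proof.
apply/cvgrPdist_le => e e0.
have e1 : 0 < e / (m + 1) by rewrite divr_gt0 // ltr_wpDl.
have [k0 _ hk] := continuous_path_grid (@continuous_bridge w) e1.
exists k0 => // k /= kk.
have hk' := hk k.+1 (leq_trans kk (leqnSn k) : (k0 <= k.+1)%N).
have h := step_functional_close (@inD_bridge w) hk'.
apply: (le_trans h).
by rewrite mulrA ler_pdivrMr ?ltr_wpDl // mulrC ler_wpM2l ?lerDl // ltW.
Qed.

Lemma bm_lip_bridge : bm setT (fun w => g (Xoo w)).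
Proof.
split; last by exists 1 => w _; exact/g1/inD_bridge.
apply: (@measurable_fun_cvg _ _ _ setT (fun k w => g (step_path (grid_values k.+1 (Xoo w))))).
  by move=> k; have [] := @bm_step_bridge k.+1 isT.
by move=> w _; exact: step_bridge_cvg.
Qed.

(** The mesh k is fixed first, for the bridge by continuity of its paths and for the matrix process
    by [Wn_osc], uniformly in n >= k. Finite-dimensional convergence then compares the two step
    paths. *)
Lemma lip_cvg :
  (fun n => \int[P n]_(M in G n) g (X n M)) @ \oo --> \int[Q]_(w in setT) g (Xoo w).
Proof.
have mG n := @measurable_haar_group R beta n; have PG n := (HP n).1.
apply/cvgrPdist_lt => e e0.
have e4 : 0 < e / 4 by rewrite divr_gt0.
have m1 : 0 < m + 1 by rewrite ltr_wpDl.
have e1 : 0 < e / 4 / (m + 1) by rewrite divr_gt0.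
have [k1 [k1_gt0 hosc]] := Wn_osc hbeta e1.
have cQ : (fun k => \int[Q]_(w in setT) g (step_path (grid_values k.+1 (Xoo w)))) @ \oo -->
    \int[Q]_(w in setT) g (Xoo w).
  apply: (Ex_cvg measurableT (probability_setT Q) (C := 1)).
  - by move=> k; have [] := @bm_step_bridge k.+1 isT.
  - by move=> k w _; exact: step_functional_le1.
  - by move=> w _; exact: step_bridge_cvg.
have [k2 _ hk2] := @cvgr_dist_lt _ _ _ _ _ _ _ cQ _ e4.
pose k := (maxn k1 k2).+1.
have k_gt0 : (0 < k)%N by [].
have {hk2} hQ : `|\int[Q]_(w in setT) g (Xoo w) -
    \int[Q]_(w in setT) g (step_path (grid_values k (Xoo w)))| < e / 4.
  by apply: hk2; rewrite /= leq_maxr.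
have fc := fidi_cvg hbeta HP HW (@unit_grid_st k k_gt0) m0 (@step_functional_le1 k)
  (@step_functional_lip k).
near=> n.
have kn : (k <= n)%N by near: n; exists k.
have n0 : (0 < n)%N by exact: leq_trans kn.
have hF : `|\int[Q]_(w in setT) g (step_path (grid_values k (Xoo w))) -
    \int[P n]_(M in G n) g (step_path (grid_values k (X n M)))| < e / 4.
  by near: n; move/cvgrPdist_lt : fc; apply.
have [|Rv [bR hR ER]] := hosc k n _ (P n) (HP n).
  by rewrite kn andbT ltnW // ltnS leq_maxl.
have hX : `|\int[P n]_(M in G n) g (X n M) -
    \int[P n]_(M in G n) g (step_path (grid_values k (X n M)))| <= e / 4.
  have b1 := @bm_lip_Wn n (G n) n0; have b2 := @bm_step_Wn n k (G n) k_gt0.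
  rewrite -(ExB (mG n) (PG n) b1 b2).
  apply: (le_trans (Ex_norm (mG n) (PG n) (bmB b1 b2))).
  apply: (@le_trans _ _ (\int[P n]_(M in G n) (m * Rv M))).
    apply: (Ex_le (mG n) (PG n)); [exact/bm_norm/bmB | exact: bmZ |] => M _.
    by apply: step_functional_close => //; [exact: inD_Wn | exact: hR].
  rewrite (ExZ (mG n) (PG n)) // (le_trans (ler_wpM2l m0 ER)) //.
  by rewrite mulrA ler_pdivrMr // mulrC ler_wpM2l ?lerDl // ltW.
move: hQ hF hX.
move: (\int[Q]_(w in setT) g _) (\int[Q]_(w in setT) g (step_path _))
  (\int[P n]_(M in G n) g _) (\int[P n]_(M in G n) g (step_path _)) => x y z v.
rewrite !ler_norml !ltr_norml => /andP[? ?] /andP[? ?] /andP[? ?].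
by apply/andP; split; lra.
Unshelve. all: by end_near.
Qed.

End lipschitz_functionals.

(** * Approximation from below by Lipschitz functionals *)

Section inf_convolution.
Context (R : realType) (f : (R -> R -> R) -> R).
Hypothesis f1 : forall x, inD x -> `|f x| <= 1.
Implicit Types (x y : R -> R -> R) (m r : R).

Definition sup_close x y r :=
  forall s t : R, unit_itv s -> unit_itv t -> `|x s t - y s t| <= r.

(* Sup-norm Lipschitz minorants of f, increasing to f pointwise with m. *)
Definition inf_conv_set m x : set R :=
  [set v | exists y r, [/\ inD y, 0 <= r, sup_close x y r & v = f y + m * r]].

Definition inf_conv m x : R := inf (inf_conv_set m x).

Lemma sup_close_ge0 x y r : sup_close x y r -> 0 <= r.
Proof.
have u0 : @unit_itv R 0 by rewrite unit_itvE lexx ler01.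
by move=> /(_ 0 0 u0 u0); exact: le_trans.
Qed.

Lemma inf_conv_lb m x : 0 <= m -> lbound (inf_conv_set m x) (-1).
Proof.
move=> m0 _ [y [r [Dy r0 _ ->]]].
have /ler_normlP[h _] := f1 Dy; have := mulr_ge0 m0 r0; lra.
Qed.

Lemma inf_conv_self m x : inD x -> inf_conv_set m x (f x).
Proof.
by move=> Dx; exists x, 0; split=> [//|//|s t _ _|]; rewrite ?subrr ?normr0 // mulr0 addr0.
Qed.

Lemma inf_conv_le m x : 0 <= m -> inD x -> inf_conv m x <= f x.
Proof.
move=> m0 Dx; apply: ge_inf; last exact: inf_conv_self.
by exists (-1); exact: inf_conv_lb.
Qed.

Lemma inf_conv_ge m x (c : R) : inD x -> lbound (inf_conv_set m x) c -> c <= inf_conv m x.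
Proof. by move=> Dx hc; apply: lb_le_inf => //; exists (f x); exact: inf_conv_self. Qed.

Lemma inf_conv_norm_le1 m x : 0 <= m -> inD x -> `|inf_conv m x| <= 1.
Proof.
move=> m0 Dx; rewrite ler_norml inf_conv_ge ?(inf_conv_lb m0) //=; last exact: inf_conv_lb.
by rewrite (le_trans (inf_conv_le m0 Dx)) //; have /ler_normlP[] := f1 Dx.
Qed.

Lemma inf_conv_lip m x y r : 0 <= m -> inD x -> inD y -> sup_close x y r ->
  `|inf_conv m x - inf_conv m y| <= m * r.
Proof.
move=> m0 Dx Dy xy.
have key x' y' : inD x' -> inD y' -> sup_close x' y' r -> inf_conv m x' - m * r <= inf_conv m y'.
  move=> Dx' Dy' xy'; apply: inf_conv_ge => // _ [z [r' [Dz r'0 yz ->]]].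
  rewrite lerBlDr -addrA -mulrDr; apply: ge_inf; first by exists (-1); exact: inf_conv_lb.
  exists z, (r' + r); split => //; first by rewrite addr_ge0 // (sup_close_ge0 xy').
  move=> s t us ut; rewrite -(subrKA (y' s t)) (le_trans (ler_normD _ _)) // addrC lerD //.
    exact: yz.
  exact: xy'.
have h1 := key _ _ Dx Dy xy.
have h2 : inf_conv m y - m * r <= inf_conv m x.
  by apply: key => // s t us ut; rewrite distrC xy.
by rewrite ler_norml; apply/andP; split; lra.
Qed.

Lemma inf_conv_cvg x : continuous_on_D f -> inD x ->
  (fun m : nat => inf_conv m%:R x) @ \oo --> f x.
Proof.
move=> cf Dx; apply/cvgrPdist_le => e e0.
have [d d0 hd] := cf x Dx e e0.
exists (Num.truncn (2 / d)).+1 => // m /= hm.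
(* 2 is the largest possible oscillation of f: at sup-distance at least d the penalty outweighs any
   gain, and below d continuity at x applies. *)
have md : 2 <= m%:R * d.
  by rewrite -ler_pdivrMr // (le_trans (ltW (truncnS_gt _))) // ler_nat.
have m0 : 0 <= m%:R :> R by [].
rewrite ger0_norm ?subr_ge0 ?inf_conv_le // lerBlDr -lerBlDl.
apply: inf_conv_ge => // _ [y [r [Dy r0 xy ->]]].
have /ler_normlP[_ fx1] := f1 Dx; have /ler_normlP[fy1 _] := f1 Dy.
have [rd|rd] := ltP r d.
  have : `|f x - f y| < e.
    by apply: hd => //; rewrite (le_lt_trans (skorokhod_dist_le r0 xy)) // lte_fin.
  rewrite ltr_norml => /andP[_ h]; have := mulr_ge0 m0 r0; lra.
have : m%:R * d <= m%:R * r by rewrite ler_wpM2l.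
lra.
Qed.

End inf_convolution.

Section weak_convergence.
Context (R : realType) (beta : nat) (hbeta : beta = 1%N \/ beta = 2%N).
Context (P : forall n, probability (cmatrix R n) R) (HP : forall n, haar_prob beta (P n)).
Context (d : measure_display) (Omega : measurableType d) (Q : probability Omega R).
Context (W : R -> R -> Omega -> R) (HW : tied_down_bridge Q W).
Local Notation G n := (@haar_group R beta n).
Local Notation X n M := (Wn (P n) M).
Local Notation Xoo w := (fun s t => Num.sqrt (2 / beta%:R) * W s t w).

(** Measurability of [f] along the paths is inherited from its Lipschitz minorants, of which it is
    the pointwise limit. *)
Lemma bm_continuous_Wn f n E : (forall x, inD x -> `|f x| <= 1) -> continuous_on_D f ->
  (0 < n)%N -> bm E (fun M => f (X n M)).
Proof.
move=> f1 cf n0; split; last by exists 1 => M _; exact/f1/inD_Wn.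
apply: (@measurable_fun_cvg _ _ _ E (fun m M => inf_conv f m%:R (X n M))).
  move=> m; have [] // := @bm_lip_Wn R (inf_conv f m%:R) m%:R _ _ _ P n E n0 => //.
    by move=> x; exact: inf_conv_norm_le1.
  by move=> x y r; exact: inf_conv_lip.
by move=> M _; apply: inf_conv_cvg => //; exact: inD_Wn.
Qed.

Lemma bm_continuous_bridge f : (forall x, inD x -> `|f x| <= 1) -> continuous_on_D f ->
  bm setT (fun w => f (Xoo w)).
Proof.
move=> f1 cf; split; last by exists 1 => w _; apply: f1; exact: inD_bridge HW _.
apply: (@measurable_fun_cvg _ _ _ setT (fun m w => inf_conv f m%:R (Xoo w))).
  move=> m; have [] // := @bm_lip_bridge R (inf_conv f m%:R) m%:R _ _ _ beta _ _ Q W HW => //.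
    by move=> x; exact: inf_conv_norm_le1.
  by move=> x y r; exact: inf_conv_lip.
by move=> w _; apply: inf_conv_cvg => //; exact: inD_bridge HW _.
Qed.

Lemma bridge_inf_conv_cvg f : (forall x, inD x -> `|f x| <= 1) -> continuous_on_D f ->
  (fun m : nat => \int[Q]_(w in setT) inf_conv f m%:R (Xoo w)) @ \oo -->
  \int[Q]_(w in setT) f (Xoo w).
Proof.
move=> f1 cf; apply: (Ex_cvg measurableT (probability_setT Q) (C := 1)).
- move=> m; have [] // := @bm_lip_bridge R (inf_conv f m%:R) m%:R _ _ _ beta _ _ Q W HW => //.
    by move=> x; exact: inf_conv_norm_le1.
  by move=> x y r; exact: inf_conv_lip.
- by move=> m w _; apply: inf_conv_norm_le1 => //; exact: inD_bridge HW _.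
- by move=> w _; apply: inf_conv_cvg => //; exact: inD_bridge HW _.
Qed.

(** A minorant controls one side only; [weak_cvg] obtains the other by applying this to - f. *)
Lemma weak_lower_bound f (e : R) : (forall x, inD x -> `|f x| <= 1) -> continuous_on_D f ->
  0 < e -> \forall n \near \oo,
  \int[Q]_(w in setT) f (Xoo w) - e <= \int[P n]_(M in G n) f (X n M).
Proof.
move=> f1 cf e0; have e2 : 0 < e / 2 by rewrite divr_gt0.
have [m _ hm] := @cvgr_dist_lt _ _ _ _ _ _ _ (bridge_inf_conv_cvg f1 cf) _ e2.
have {}hm := hm m (leqnn m).
have m0 : 0 <= m%:R :> R by [].
have g1 x : inD x -> `|inf_conv f m%:R x| <= 1 by exact: inf_conv_norm_le1.
have glip x y (r : R) : inD x -> inD y -> sup_close x y r ->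
    `|inf_conv f m%:R x - inf_conv f m%:R y| <= m%:R * r by exact: inf_conv_lip.
have cg := lip_cvg m0 g1 glip hbeta HP HW.
near=> n; have n0 : (0 < n)%N by near: n; exists 1%N.
have hn : `|\int[Q]_(w in setT) inf_conv f m%:R (Xoo w) -
    \int[P n]_(M in G n) inf_conv f m%:R (X n M)| < e / 2.
  by near: n; move/cvgrPdist_lt : cg; apply.
have : \int[P n]_(M in G n) inf_conv f m%:R (X n M) <= \int[P n]_(M in G n) f (X n M).
  apply: (Ex_le (@measurable_haar_group R beta n) (HP n).1).
  - exact: (bm_lip_Wn m0 g1 glip).
  - exact: bm_continuous_Wn.
  - by move=> M _; apply: inf_conv_le => //; exact: inD_Wn.
move: hm hn; rewrite !ltr_norml => /andP[? ?] /andP[? ?] ?; lra.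
Unshelve. all: by end_near.
Qed.

Lemma weak_cvg f : (forall x, inD x -> `|f x| <= 1) -> continuous_on_D f ->
  (fun n => \int[P n]_(M in G n) f (X n M)) @ \oo --> \int[Q]_(w in setT) f (Xoo w).
Proof.
move=> f1 cf; apply/cvgrPdist_le => e e0.
have Nf1 x : inD x -> `|- f x| <= 1 by rewrite normrN; exact: f1.
have cNf : continuous_on_D (fun x => - f x).
  move=> x Dx r r0; have [dl dl0 h] := cf x Dx r r0; exists dl => // y Dy xy.
  by rewrite -opprD normrN; exact: h.
have bf := bm_continuous_bridge f1 cf.
near=> n; have n0 : (0 < n)%N by near: n; exists 1%N.
have h1 : \int[Q]_(w in setT) f (Xoo w) - e <= \int[P n]_(M in G n) f (X n M).
  by near: n; exact: weak_lower_bound.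
have : \int[Q]_(w in setT) (- f (Xoo w)) - e <= \int[P n]_(M in G n) (- f (X n M)).
  by near: n; exact: (weak_lower_bound Nf1 cNf e0).
have bn := bm_continuous_Wn (G n) f1 cf n0.
rewrite (ExN measurableT (probability_setT Q) bf).
rewrite (ExN (@measurable_haar_group R beta n) (HP n).1 bn) => h2.
by rewrite ler_norml; apply/andP; split; lra.
Unshelve. all: by end_near.
Qed.

End weak_convergence.

Theorem theorem1p1 (R : realType) (beta : nat) (hbeta : beta = 1%N \/ beta = 2%N)
  (P : forall n : nat, probability (cmatrix R n) R)
  (HP : forall n : nat, haar_prob beta (P n))
  (d : measure_display) (Omega : measurableType d) (Q : probability Omega R)
  (W : R -> R -> Omega -> R) (HW : tied_down_bridge Q W)
  (f : (R -> R -> R) -> R) (f_bnd : bounded_on_D f) (f_cont : continuous_on_D f) :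
  ((fun n : nat => \int[P n]_(M in setT) (f (Wn (P n) M))%:E) @ \oo -->
   \int[Q]_(w in setT) (f (fun s t => Num.sqrt (2 / beta%:R) * W s t w))%:E)%E.
Proof.
have [K fK] := f_bnd.
(* [K] may be zero or negative; this makes the scaling factor positive. *)
pose B : R := `|K| + 1.
have B0 : 0 < B by rewrite ltr_wpDl.
pose F x := B^-1 * f x.
have fE x : f x = B * F x by rewrite /F mulrA divff ?gt_eqF // mul1r.
have F1 x : inD x -> `|F x| <= 1.
  move=> Dx; rewrite normrM gtr0_norm ?invr_gt0 // mulrC ler_pdivrMr // mul1r.
  by rewrite (le_trans (fK x Dx)) // (le_trans (ler_norm _)) // lerDl.
have cF : continuous_on_D F.
  move=> x Dx e e0; have [|dl dl0 h] := f_cont x Dx (B * e); first exact: mulr_gt0.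
  exists dl => // y Dy xy; rewrite -mulrBr normrM gtr0_norm ?invr_gt0 //.
  by rewrite mulrC ltr_pdivrMr // mulrC; exact: h.
have bfn n E : (0 < n)%N -> bm E (fun M => f (Wn (P n) M)).
  by move=> n0; under eq_fun do rewrite fE; apply: bmZ; exact: bm_continuous_Wn.
have bFn n : (0 < n)%N -> bm (@haar_group R beta n) (fun M => F (Wn (P n) M)).
  by move=> n0; exact: bm_continuous_Wn.
have bF : bm setT (fun w => F (fun s t => Num.sqrt (2 / beta%:R) * W s t w)).
  exact: (bm_continuous_bridge beta HW).
have limE : (\int[Q]_(w in setT) (f (fun s t => Num.sqrt (2 / beta%:R) * W s t w))%:E)%E =
    (B * \int[Q]_(w in setT) F (fun s t => Num.sqrt (2 / beta%:R) * W s t w))%:E.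
  rewrite -(ExZ measurableT (probability_setT Q) _ bF) /Rintegral fineK.
    by apply: eq_integral => w _; rewrite fE.
  apply: integrable_fin_num => //.
  exact: (bm_integrable measurableT (probability_setT Q) (bmZ B bF)).
rewrite limE.
have : (fun n => (B * \int[P n]_(M in @haar_group R beta n) F (Wn (P n) M))%:E) @ \oo -->
    (B * \int[Q]_(w in setT) F (fun s t => Num.sqrt (2 / beta%:R) * W s t w))%:E.
  apply: cvg_EFin; first exact: nearW.
  by apply: cvgM; [exact: cvg_cst | exact: (weak_cvg hbeta HP HW F1 cF)].
(* The integral over all matrices is replaced by the one over the group for n >= 1, where the
   functional of the path is known to be measurable. *)
apply: cvg_trans; apply: near_eq_cvg; exists 1%N => // n /= n0.
have mG := @measurable_haar_group R beta n.
rewrite (integral_haar_group (HP n)); last by have [] := bfn n setT n0.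
rewrite -(ExZ mG (HP n).1 _ (bFn n n0)) /Rintegral fineK.
  by apply: eq_integral => M _; rewrite fE.
apply: integrable_fin_num => //.
exact: (bm_integrable mG (HP n).1 (bmZ B (bFn n n0))).
Qed.
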